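(* Let $H\in\mathcal L(\ell^2(\Omega))$ be a real-space Hamiltonian for double-incommensurate twisted trilayer graphene (as in the context), and let $\mathcal G$ be the Bloch transform. The momentum space Hamiltonian $\widetilde H\in\mathcal L\big(\bigoplus_{j=1}^3L^2(\Gamma_j^*;\mathbb C^2)\big)$, defined as the unique operator satisfying the intertwining relation $\mathcal GH\psi=\widetilde H\mathcal G\psi$ for all $\psi\in\ell^2(\Omega)$, is given by the matrix of operators $$\widetilde H_{k\beta}^{j\alpha}=\delta_k^j\sum_{R\in\mathcal R_j}e^{-i(\cdot)\cdot(R+\tau_{j\alpha}-\tau_{j\beta})}\big(h_{j\beta}^{j\alpha}\big)_R+(1-\delta_k^j)\,c_j^*c_k^*\sum_{G\in\mathcal R_j^*}e^{iG\cdot\tau_{j\alpha}}\,\widehat h_{k\beta}^{j\alpha}(\cdot+G)\,T_G$$ for all $(j\alpha,k\beta)\in\mathcal A^2$, where $\widehat h_{k\beta}^{j\alpha}(\xi)=\frac1{(2\pi)^2}\int_{\mathbb R^2}h_{k\beta}^{j\alpha}(x)e^{-i\xi\cdot x}dx$.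
   Context: Lattices. Let $a=1.42\sqrt3$, $A=\frac a2\begin{bmatrix}2&1\\0&\sqrt3\end{bmatrix}$, $B=2\pi A^{-T}$, and let $\mathfrak R_\theta$ be the counterclockwise rotation of $\mathbb R^2$ by $\theta$. For twist angles $\theta_1,\theta_2,\theta_3$ and $j\in\{1,2,3\}$ put $A_j=\mathfrak R_{\theta_j}A$, $B_j=\mathfrak R_{\theta_j}B$, $\mathcal R_j=A_j\mathbb Z^2$, $\mathcal R_j^*=B_j\mathbb Z^2$, $\Gamma_j^*=B_j[0,1)^2$ (area $|\Gamma_j^*|$), $c_j^*=\sqrt{|\Gamma_j^*|}$. Orbital indices: $\mathcal A_j=\{jA,jB\}$, $\mathcal A=\bigcup_j\mathcal A_j$, with shifts $\tau_{jA}=0$, $\tau_{jB}=\mathfrak R_{\theta_j}\frac a2(1,\tfrac{\sqrt3}{3})^T$. Double incommensurability (assumed): for both $(\mathcal R_j)_{j=1}^3$ and $(\mathcal R_j^* )_{j=1}^3$, for every $I\subset\{1,2,3\}$ and lattice vectors $v_j$ in the $j$th lattice, $\sum_{j\in I}v_j=0$ iff $v_j=0$ for all $j\in I$. Hamiltonian. $\Omega_j=\mathcal R_j\times\mathcal A_j$, $\Omega=\bigsqcup_{j=1}^3\Omega_j$. Given intralayer hoppings $h_{j\beta}^{j\alpha}:\mathcal R_j\to\mathbb C$ and, for $j\ne k$, continuous interlayer hoppings $h_{k\beta}^{j\alpha}:\mathbb R^2\to\mathbb C$, $$(H\psi)_{(R,j\alpha)}=\sum_{(R',j\beta)\in\Omega_j}(h_{j\beta}^{j\alpha})_{R-R'}\psi_{(R',j\beta)}+\sum_{k\neq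 j}\sum_{(R',k\beta)\in\Omega_k}h_{k\beta}^{j\alpha}(R+\tau_{j\alpha}-R'-\tau_{k\beta})\psi_{(R',k\beta)}.$$ Standing assumptions: there are $\gamma_1,\gamma_2>0$ such that for $j\neq k$ and all orbitals $\sup_x|h_{k\beta}^{j\alpha}(x)|e^{\gamma_1\|x\|_2}+\sup_\xi|\widehat h_{k\beta}^{j\alpha}(\xi)|e^{\gamma_2\|\xi\|_2}<\infty$, and $\sup_{R\in\mathcal R_j}|(h_{j\beta}^{j\alpha})_R|e^{\gamma_1\|R\|_2}<\infty$; $(h_{j\beta}^{j\alpha})_R=\overline{(h_{j\alpha}^{j\beta})_{-R}}$ and $h_{k\beta}^{j\alpha}(x)=\overline{h_{j\alpha}^{k\beta}(-x)}$; $h_{3\beta}^{1\alpha}=h_{1\beta}^{3\alpha}=0$. Bloch transform. $\mathcal G_j:\ell^2(\Omega_j)\to L^2(\Gamma_j^*;\mathbb C^2)$, $[\mathcal G_j\psi_j]_{j\alpha}(q)=\frac1{c_j^*}\sum_{R\in\mathcal R_j}e^{-iq\cdot(R+\tau_{j\alpha})}\psi_{(R,j\alpha)}$, and $\mathcal G=\bigoplus_{j=1}^3\mathcal G_j$. Elements of $L^2(\Gamma_j^*;\mathbb C^2)$ are extended to $\mathbb R^2$ quasi-periodically: $\widetilde\psi_{j\alpha}(q+G)=e^{-iG\cdot\tau_{j\alpha}}\widetilde\psi_{j\alpha}(q)$ for $G\in\mathcal R_j^*$. Notation. $f(\cdot)$ denotes the multiplication operator $[f(\cdot)\widetilde\psi](q)=f(q)\widetilde\psi(q)$;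 $T_G$ is translation, $(T_G\widetilde\psi)(q)=\widetilde\psi(q+G)$ (using the quasi-periodic extension). $\widetilde H_{k\beta}^{j\alpha}$ is the entry mapping component $k\beta$ to component $j\alpha$. *)

(* Defs.v *)
From HB Require Import structures.
From mathcomp Require Import all_boot all_order all_algebra.
From mathcomp Require Import finmap complex.
From mathcomp Require Import summability.
From mathcomp Require Import all_classical all_reals all_analysis.

Set Implicit Arguments.
Unset Strict Implicit.
Unset Printing Implicit Defensive.

Import Order.TTheory GRing.Theory Num.Theory.
Import numFieldNormedType.Exports.
Import ComplexField.Normc.

Local Open Scope classical_set_scope.
Local Open Scope complex_scope.
Local Open Scope ring_scope.

Section Plane.
Context {R : realType}.
Local Notation plane := (R * R)%type.
Local Notation C := (R[i]^o).

Definition mx2 (a b c d : R) : 'M[R]_2 :=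
  \matrix_(i, j) if i == 0 then (if j == 0 then a else b)
                 else (if j == 0 then c else d).

Definition apply2 (M : 'M[R]_2) (x : plane) : plane :=
  (M 0 0 * x.1 + M 0 1 * x.2, M 1 0 * x.1 + M 1 1 * x.2).

Definition dot2 (x y : plane) : R := x.1 * y.1 + x.2 * y.2.

(* The library norm of a product is the sup norm, not the Euclidean one. *)
Definition norm2 (x : plane) : R := Num.sqrt (dot2 x x).

Definition rotation (t : R) : 'M[R]_2 := mx2 (cos t) (- sin t) (sin t) (cos t).

Definition mu2 :
    {measure set (measurableTypeR R * measurableTypeR R)%type -> \bar R} :=
  (@lebesgue_measure R \x @lebesgue_measure R)%E.

Definition expi (t : R) : C := cos t +i* sin t.

Definition cintegral (f : plane -> C) : C :=
  (\int[mu2]_x complex.Re (f x)) +i* (\int[mu2]_x complex.Im (f x)).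

Definition fourier (h : plane -> C) (xi : plane) : C :=
  (((2 * pi) ^- 2)%:C : C) * cintegral (fun x => h x * expi (- dot2 xi x)).

Definition in_lattice (M : 'M[R]_2) : {pred plane} :=
  fun v => `[< exists n : int * int, v = apply2 M (n.1%:~R, n.2%:~R) >].

Lemma in_lattice_zmod_closed M : zmod_closed (in_lattice M).
Proof.
split=> [|x y /asboolP[m ->] /asboolP[n ->]]; apply/asboolP.
  by exists (0, 0); rewrite /apply2 /= !mulr0 addr0.
exists (m.1 - n.1, m.2 - n.2); congr pair => /=;
  by rewrite !rmorphB /= !mulrBr opprD addrACA.
Qed.

HB.instance Definition _ (M : 'M[R]_2) :=
  GRing.isZmodClosed.Build plane (in_lattice M) (in_lattice_zmod_closed M).

Definition lattice (M : 'M[R]_2) : Type := {v : plane | in_lattice M v}.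

HB.instance Definition _ (M : 'M[R]_2) := SubType.on (lattice M).
HB.instance Definition _ (M : 'M[R]_2) := Choice.on (lattice M).
HB.instance Definition _ (M : 'M[R]_2) :=
  [SubChoice_isSubZmodule of lattice M by <:].

Definition cell (M : 'M[R]_2) : set plane :=
  apply2 M @` (`[0, 1[ `*` `[0, 1[).

Definition incommensurate (M : 'I_3 -> 'M[R]_2) : Prop :=
  forall (I : {set 'I_3}) (v : forall j, lattice (M j)),
    \sum_(j in I) val (v j) = 0 <-> (forall j, j \in I -> v j = 0).

End Plane.

(* Bounded linear operators between spaces of functions: [dU] and [dV] are the
   functions belonging to the space, [nU] and [nV] the (semi)norms, and [eV] the
   equality of the target space (e.g. equality almost everywhere). *)
Record bounded_operator {R : realType} {U V : lmodType R[i]}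
    (dU : set U) (nU : U -> R)
    (dV : set V) (nV : V -> R) (eV : V -> V -> Prop) (T : U -> V) : Prop := {
  operator_maps : forall f, dU f -> dV (T f);
  operator_linear : forall (c : R[i]) f g, dU f -> dU g ->
    eV (T (c *: f + g)) (c *: T f + T g);
  operator_bounded : exists M : R, forall f, dU f -> nV (T f) <= M * nU f }.

(* The layers 1, 2, 3 are the elements 0, 1, 2 of 'I_3; the orbital index jA is
   (j, false) and jB is (j, true). *)
Notation orbital := ('I_3 * bool)%type.

Section TrilayerGraphene.
Context {R : realType} (theta : 'I_3 -> R).
Local Notation plane := (R * R)%type.
Local Notation mplane := (measurableTypeR R * measurableTypeR R)%type.
Local Notation C := (R[i]^o).

Definition lattice_const : R := 142%:R / 100%:R * Num.sqrt 3%:R.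

Definition graphene_mx : 'M[R]_2 :=
  (lattice_const / 2%:R) *: mx2 2%:R 1 0 (Num.sqrt 3%:R).

Definition graphene_dual_mx : 'M[R]_2 := (2%:R * pi) *: (invmx graphene_mx)^T.

Definition layer_mx (j : 'I_3) : 'M[R]_2 := rotation (theta j) *m graphene_mx.

Definition dual_mx (j : 'I_3) : 'M[R]_2 :=
  rotation (theta j) *m graphene_dual_mx.

Definition bz (j : 'I_3) : set plane := cell (dual_mx j).

Definition cstar (j : 'I_3) : R := Num.sqrt (fine (mu2 (bz j))).

Definition orbital_shift (p : orbital) : plane :=
  if p.2 then apply2 (rotation (theta p.1))
                (lattice_const / 2%:R,
                 lattice_const / 2%:R * (Num.sqrt 3%:R / 3%:R))
  else 0.

Definition layer_sites (j : 'I_3) : Type := (lattice (layer_mx j) * bool)%type.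

Definition sites : Type := {j : 'I_3 & layer_sites j}.

Definition site (j : 'I_3) (x : layer_sites j) : sites := existT layer_sites j x.

Definition ell2_sq (psi : sites -> C) : \bar R :=
  (\esum_(w in setT) (normc (psi w) ^+ 2)%:E)%E.

Definition ell2 : set (sites -> C) := [set psi | (ell2_sq psi < +oo)%E].

Definition ell2_norm (psi : sites -> C) : R := Num.sqrt (fine (ell2_sq psi)).

Definition ell2_operator (H : (sites -> C) -> (sites -> C)) : Prop :=
  bounded_operator ell2 ell2_norm ell2 ell2_norm eq H.

(* [hintra j a b] is the hopping from orbital jb to orbital ja, and [hinter p s]
   the hopping from orbital s to orbital p; [hinter p s] is only relevant for
   orbitals of different layers. *)
Implicit Types (hintra : forall j, bool -> bool -> lattice (layer_mx j) -> C)
               (hinter : orbital -> orbital -> plane -> C).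

Record standing_assumptions hintra hinter : Prop := {
  inter_continuous : forall p s : orbital, p.1 != s.1 -> continuous (hinter p s);
  hopping_decay : exists gamma1 gamma2 : R, [/\ 0 < gamma1, 0 < gamma2,
    forall p s : orbital, p.1 != s.1 ->
      (ereal_sup [set (normc (hinter p s x) * expR (gamma1 * norm2 x))%:E
                 | x in [set: plane]] +
       ereal_sup [set (normc (fourier (hinter p s) xi)
                        * expR (gamma2 * norm2 xi))%:E
                 | xi in [set: plane]] < +oo)%E &
    forall j a b,
      (ereal_sup [set (normc (hintra j a b r) * expR (gamma1 * norm2 (val r)))%:E
                 | r in [set: lattice (layer_mx j)]] < +oo)%E];
  intra_hermitian : forall j a b r, hintra j a b r = (hintra j b a (- r))^*;
  inter_hermitian : forall p s : orbital, p.1 != s.1 ->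
    forall x, hinter p s x = (hinter s p (- x))^*;
  inter_neighbours : forall a b x,
    hinter (ord0, a) (ord_max, b) x = 0 /\ hinter (ord_max, a) (ord0, b) x = 0 }.

(* [sum] is the limit of the finite partial sums along the filter [totally], i.e.
   unconditional summation. *)
Definition hamiltonian_formula hintra hinter (psi : sites -> C)
    (j : 'I_3) (r : lattice (layer_mx j)) (a : bool) : C :=
  sum (fun x : layer_sites j =>
         hintra j a x.2 (r - x.1) * psi (site x))
  + \sum_(k < 3 | k != j) sum (fun x : layer_sites k =>
         hinter (j, a) (k, x.2)
           (val r + orbital_shift (j, a) - val x.1 - orbital_shift (k, x.2))
         * psi (site x)).

Definition is_hamiltonian hintra hinter (H : (sites -> C) -> (sites -> C)) :=
  ell2_operator H /\
  forall psi, ell2 psi -> forall (j : 'I_3) (r : lattice (layer_mx j)) (a : bool),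
    H psi (site (r, a)) = hamiltonian_formula hintra hinter psi r a.

(* L^2(bz j; C), by functions on the plane whose values outside [bz j] are
   irrelevant. [mplane] selects the sigma-algebra on which [mu2] is defined. *)
Definition L2 (j : 'I_3) : set (plane -> C) := [set f : plane -> C |
  [/\ measurable_fun (bz j : set mplane) (fun q : mplane => complex.Re (f q)),
      measurable_fun (bz j : set mplane) (fun q : mplane => complex.Im (f q)) &
      (\int[mu2]_(q in bz j) (normc (f q) ^+ 2)%:E < +oo)%E]].

Definition L2_norm (j : 'I_3) (f : plane -> C) : R :=
  Num.sqrt (fine (\int[mu2]_(q in bz j) (normc (f q) ^+ 2)%:E)%E).

(* The direct sum over j of L^2(bz j; C^2). *)
Definition L2sum : set (orbital -> plane -> C) :=
  [set f | forall p, L2 p.1 (f p)].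

Definition L2sum_norm (f : orbital -> plane -> C) : R :=
  Num.sqrt (\sum_(p : orbital) L2_norm p.1 (f p) ^+ 2).

Definition L2sum_eq (f g : orbital -> plane -> C) : Prop :=
  forall p, ae_eq mu2 (bz p.1) (f p) (g p).

Definition L2sum_operator
    (T : (orbital -> plane -> C) -> (orbital -> plane -> C)) : Prop :=
  bounded_operator L2sum L2sum_norm L2sum L2sum_norm L2sum_eq T.

(* For a square-summable psi the Bloch series need not converge pointwise: it
   converges unconditionally in L^2(bz j). *)
Definition is_bloch (psi : sites -> C) (f : orbital -> plane -> C) : Prop :=
  forall p : orbital, L2 p.1 (f p) /\
    L2_norm p.1 (f p - (fun q => ((cstar p.1)^-1)%:C *
      partial_sum (fun r : lattice (layer_mx p.1) =>
        expi (- dot2 q (val r + orbital_shift p)) * psi (site (r, p.2))) F))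
    @[F --> totally] --> (0 : R).

Definition bloch (psi : sites -> C) : orbital -> plane -> C :=
  xget 0 [set f | is_bloch psi f].

(* The unique G in the lattice such that q - G belongs to [bz j]. *)
Definition cell_point (j : 'I_3) (q : plane) : lattice (dual_mx j) :=
  xget 0 [set G | bz j (q - val G)].

Definition quasi_periodic_ext (s : orbital) (f : plane -> C) (q : plane) : C :=
  let G := val (cell_point s.1 q) in expi (- dot2 G (orbital_shift s)) * f (q - G).

Definition translation (s : orbital) (G : plane) (f : plane -> C) : plane -> C :=
  fun q => quasi_periodic_ext s f (q + G).

Definition multiplication (m f : plane -> C) : plane -> C := fun q => m q * f q.

(* T is the sum of the family S of operators from L^2(bz k) to L^2(bz j), in the
   sense of unconditional convergence in operator norm. *)
Definition operator_sum (k j : 'I_3) (I : choiceType)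
    (S : I -> (plane -> C) -> (plane -> C)) (T : (plane -> C) -> (plane -> C)) :=
  (forall i f, L2 k f -> L2 j (S i f)) /\
  forall e : R, 0 < e -> \forall F \near totally, forall f, L2 k f ->
    L2_norm j (T f - partial_sum (fun i => S i f) F) <= e * L2_norm k f.

Definition entry (T : (orbital -> plane -> C) -> (orbital -> plane -> C))
    (p s : orbital) (f : plane -> C) : plane -> C :=
  T (fun s' => if s' == s then f else 0) p.

Definition momentum_entry hintra hinter (p s : orbital)
    (T : (plane -> C) -> (plane -> C)) : Prop :=
  if s.1 == p.1 then
    operator_sum s.1 p.1 (fun r : lattice (layer_mx p.1) =>
      multiplication (fun q =>
        expi (- dot2 q (val r + orbital_shift p - orbital_shift (p.1, s.2))) *
        hintra p.1 p.2 s.2 r)) T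
  else
    operator_sum s.1 p.1 (fun (G : lattice (dual_mx p.1)) f =>
      multiplication (fun q =>
        ((cstar p.1 * cstar s.1)%:C : C) * expi (dot2 (val G) (orbital_shift p)) *
        fourier (hinter p s) (q + val G))
      (translation s (val G) f)) T.

Definition intertwines (H : (sites -> C) -> (sites -> C))
    (Ht : (orbital -> plane -> C) -> (orbital -> plane -> C)) : Prop :=
  forall psi, ell2 psi -> L2sum_eq (bloch (H psi)) (Ht (bloch psi)).

End TrilayerGraphene.

(* Main.v *)
(** The Bloch modes e_r(q) = exp(-i q.(r + tau)) / c*, with r in the lattice of a
    layer, form an orthonormal basis of L^2 of the cell of its dual lattice.  Hence
    the Bloch transform is the isomorphism that reads a square-summable sequence as
    a sequence of coefficients, and Ht is the conjugate of H by it; its matrix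
    elements in these bases are the hoppings.

    A bounded operator is the sum, in operator norm, of a family S_i with summable
    norms as soon as each of its matrix elements is the limit of the partial sums of
    those of the S_i.  Inside a layer S_R maps e_r to h_R e_(r + R).  Between two
    layers the matrix element of S_G is the integral, over the translate by G of the
    cell, of the Fourier transform of h times exp(i xi.y), where y is the difference
    of the two positions.  These translates tile the plane, so the sum over G is the
    integral over the plane, that is h(y) by Fourier inversion.  The norms of the S_G
    are summable because the Fourier transform decays exponentially and T_G is
    bounded uniformly in G: the modulus of a quasi-periodic function is periodic and
    finitely many cells of one dual lattice cover a cell of the other. *)
From HB Require Import structures.
From mathcomp Require Import all_boot all_order all_algebra.
From mathcomp Require Import finmap complex.
From mathcomp Require Import summability.
From mathcomp Require Import all_classical all_reals all_analysis.
From mathcomp Require Import measurable_realfun ring lra zify.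
Require Import Defs.

Set Implicit Arguments.
Unset Strict Implicit.
Unset Printing Implicit Defensive.

Import Order.TTheory GRing.Theory Num.Theory.
Import numFieldNormedType.Exports.
Import ComplexField.Normc.

Local Open Scope classical_set_scope.
Local Open Scope complex_scope.
Local Open Scope ring_scope.


(** * Square-integrable complex functions and orthonormal systems *)

(** L^2 is represented by actual functions with a seminorm, so the Bloch transform is a choice of
    representative and the conjugate of [H] is linear only almost everywhere. It therefore enters
    the convergence argument through its coefficients, which are exactly linear. The coefficients
    also carry the passage from weak to norm convergence: summable norms make the tails small
    uniformly in the argument, and the matrix elements merely identify the limit.

    Two analytic facts rest on explicit kernels. For completeness of the modes, polynomials in
    cosines converge boundedly on a cell to the indicators of quadrants in lattice coordinates, and
    Dynkin's theorem carries orthogonality from quadrants to all measurable sets. For Fourier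
    inversion, the convergence factor exp(-e(|s| + |t|)) is a product whose transform is a product
    of Cauchy kernels, and the one-variable integrals involved have elementary antiderivatives. *)

Section ComplexScalars.
Context {R : realType}.
Implicit Types z w : R[i].

Lemma normc_sqr z : normc z ^+ 2 = complex.Re z ^+ 2 + complex.Im z ^+ 2.
Proof. by case: z => a b /=; rewrite sqr_sqrtr// addr_ge0// sqr_ge0. Qed.

Lemma normc_ge0 z : 0 <= normc z.
Proof. by case: z => a b /=; exact: sqrtr_ge0. Qed.

Lemma cReD z w : complex.Re (z + w) = complex.Re z + complex.Re w.
Proof. by case: z w => a b [c d]. Qed.

Lemma cImD z w : complex.Im (z + w) = complex.Im z + complex.Im w.
Proof. by case: z w => a b [c d]. Qed.

Lemma cReN z : complex.Re (- z) = - complex.Re z.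
Proof. by case: z. Qed.

Lemma cImN z : complex.Im (- z) = - complex.Im z.
Proof. by case: z. Qed.

Lemma cReM z w : complex.Re (z * w)
  = complex.Re z * complex.Re w - complex.Im z * complex.Im w.
Proof. by case: z w => a b [c d]. Qed.

Lemma cImM z w : complex.Im (z * w)
  = complex.Re z * complex.Im w + complex.Im z * complex.Re w.
Proof. by case: z w => a b [c d]. Qed.

Lemma cReJ z : complex.Re (z^*)%C = complex.Re z.
Proof. by case: z. Qed.

Lemma cImJ z : complex.Im (z^*)%C = - complex.Im z.
Proof. by case: z. Qed.

Lemma complexP z w :
  complex.Re z = complex.Re w -> complex.Im z = complex.Im w -> z = w.
Proof. by case: z w => a b [c d] /= -> ->. Qed.

Lemma normcJ z : normc (z^*)%C = normc z.
Proof. by case: z => a b /=; rewrite sqrrN. Qed.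

Lemma normc_real (a : R) : normc (a%:C) = `|a|.
Proof. by rewrite /= expr0n /= addr0 sqrtr_sqr. Qed.

Lemma Re_le_normc z : `|complex.Re z| <= normc z.
Proof.
by case: z => a b /=; rewrite -sqrtr_sqr ler_wsqrtr// lerDl sqr_ge0.
Qed.

Lemma Im_le_normc z : `|complex.Im z| <= normc z.
Proof.
by case: z => a b /=; rewrite -sqrtr_sqr ler_wsqrtr// lerDr sqr_ge0.
Qed.

Lemma normc_le_ReIm z : normc z <= `|complex.Re z| + `|complex.Im z|.
Proof.
have h : 0 <= `|complex.Re z| + `|complex.Im z| by rewrite addr_ge0.
rewrite -(ler_sqr (normc_ge0 z) h) normc_sqr sqrrD.
by rewrite !real_normK ?num_real// addrAC lerDl pmulrn_lge0// mulr_ge0.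
Qed.

Lemma normc_sum (I : Type) (s : seq I) (F : I -> R[i]) :
  normc (\sum_(i <- s) F i) <= \sum_(i <- s) normc (F i).
Proof.
elim: s => [|i s ih]; first by rewrite !big_nil normc0.
by rewrite !big_cons (le_trans (le_normcD _ _))// lerD2l.
Qed.

Lemma normc_dist z w : `|normc z - normc w| <= normc (z - w).
Proof.
have := le_normcD (z - w) w; have := le_normcD (w - z) z.
rewrite !subrK -[w - z]opprB normcN ler_norml => h1 h2.
by apply/andP; split; [rewrite lerNl opprB|]; rewrite lerBlDr.
Qed.

Lemma mulcJ z : z * (z^*)%C = (normc z ^+ 2)%:C.
Proof.
by apply: complexP; rewrite ?cReM ?cImM cReJ cImJ ?normc_sqr /= ?expr2; ring.
Qed.

End ComplexScalars.

(** * The L^2 seminorm of complex functions *)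

Section ComplexL2.
Context d (T : measurableType d) (R : realType).
Variables (mu : {measure set T -> \bar R}) (D : set T).
Hypothesis mD : measurable D.
Local Notation C := (R[i]^o).
Implicit Types f g : T -> C.

Definition cmeasurable f :=
  measurable_fun D (fun x => complex.Re (f x)) /\
  measurable_fun D (fun x => complex.Im (f x)).

Lemma cmeasurableD f g : cmeasurable f -> cmeasurable g ->
  cmeasurable (fun x => f x + g x).
Proof.
move=> [f1 f2] [g1 g2]; split.
  by under eq_fun do rewrite cReD; exact: measurable_funD.
by under eq_fun do rewrite cImD; exact: measurable_funD.
Qed.

Lemma cmeasurableN f : cmeasurable f -> cmeasurable (fun x => - f x).
Proof.
move=> [f1 f2]; split.
  by under eq_fun do rewrite cReN; exact: measurableT_comp.
by under eq_fun do rewrite cImN; exact: measurableT_comp.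
Qed.

Lemma cmeasurableM f g : cmeasurable f -> cmeasurable g ->
  cmeasurable (fun x => (f x : R[i]) * g x).
Proof.
move=> [f1 f2] [g1 g2]; split.
  under eq_fun do rewrite cReM.
  by apply: measurable_funB; exact: measurable_funM.
under eq_fun do rewrite cImM.
by apply: measurable_funD; exact: measurable_funM.
Qed.

Lemma cmeasurableJ f : cmeasurable f -> cmeasurable (fun x => (f x)^*).
Proof.
move=> [f1 f2]; split; first by under eq_fun do rewrite cReJ.
by under eq_fun do rewrite cImJ; exact: measurableT_comp.
Qed.

Lemma cmeasurable_cst (c : C) : cmeasurable (fun=> c).
Proof. by split; exact: measurable_cst. Qed.

Lemma cmeasurable_sum (I : Type) (s : seq I) (F : I -> T -> C) :
  (forall i, cmeasurable (F i)) -> cmeasurable (fun x => \sum_(i <- s) F i x).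
Proof.
move=> hF; elim: s => [|i s ih].
  by under eq_fun do rewrite big_nil; exact: cmeasurable_cst.
by under eq_fun do rewrite big_cons; exact: cmeasurableD.
Qed.

Lemma cmeasurable_sqr f : cmeasurable f ->
  measurable_fun D (fun x => normc (f x) ^+ 2).
Proof.
move=> [f1 f2]; under eq_fun do rewrite normc_sqr.
by apply: measurable_funD; exact: measurable_funX.
Qed.

Lemma cmeasurable_normc f : cmeasurable f ->
  measurable_fun D (fun x => normc (f x)).
Proof.
move=> /cmeasurable_sqr m2.
rewrite (_ : (fun _ => _) = Num.sqrt \o (fun x => normc (f x) ^+ 2)).
  apply: measurableT_comp => //; apply: continuous_measurable_fun.
  exact: sqrt_continuous.
by apply/funext => x /=; rewrite sqrtr_sqr ger0_norm// normc_ge0.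
Qed.

Definition sqint f : \bar R := (\int[mu]_(x in D) (normc (f x) ^+ 2)%:E)%E.

Definition nrm2 f : R := Num.sqrt (fine (sqint f)).

Definition in_L2 f :=
  [/\ measurable_fun D (fun x => complex.Re (f x)),
      measurable_fun D (fun x => complex.Im (f x)) & (sqint f < +oo)%E].

Lemma in_L2_cmeasurable f : in_L2 f -> cmeasurable f.
Proof. by case. Qed.

Lemma sqint_ge0 f : (0 <= sqint f)%E.
Proof. by apply: integral_ge0 => x _; rewrite lee_fin sqr_ge0. Qed.

Lemma in_L2P f : cmeasurable f -> (sqint f < +oo)%E -> in_L2 f.
Proof. by case=> ? ? ?; split. Qed.

Lemma nrm2_ge0 f : 0 <= nrm2 f. Proof. exact: sqrtr_ge0. Qed.

Lemma nrm2_sqrE f : in_L2 f -> (nrm2 f ^+ 2)%:E = sqint f.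
Proof.
move=> [_ _ h]; rewrite sqr_sqrtr; last by rewrite fine_ge0// sqint_ge0.
by rewrite fineK// ge0_fin_numE// sqint_ge0.
Qed.

Lemma in_L2_le f g (K : R) : cmeasurable f -> in_L2 g -> 0 <= K ->
  (forall x, D x -> normc (f x) <= K * normc (g x)) ->
  in_L2 f /\ nrm2 f <= K * nrm2 g.
Proof.
move=> mf Lg K0 h.
have le : (sqint f <= (K ^+ 2)%:E * sqint g)%E.
  rewrite -ge0_integralZl_EFin ?sqr_ge0//; last 2 first.
  - by move=> x _; rewrite lee_fin sqr_ge0.
  - by apply/measurable_EFinP/cmeasurable_sqr/in_L2_cmeasurable.
  apply: ge0_le_integral => //.
  - by move=> x _; rewrite lee_fin sqr_ge0.
  - exact/measurable_EFinP/cmeasurable_sqr.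
  - apply: measurable_funeM; apply/measurable_EFinP/cmeasurable_sqr.
    exact: in_L2_cmeasurable.
  - move=> x Dx; rewrite -EFinM lee_fin -exprMn.
    by rewrite ler_sqr ?nnegrE ?h// ?mulr_ge0 ?normc_ge0.
have Lf : in_L2 f.
  apply: in_L2P => //; apply: le_lt_trans le _.
  by rewrite -nrm2_sqrE// -EFinM ltry.
split=> //; rewrite -ler_sqr ?nnegrE ?mulr_ge0 ?nrm2_ge0//.
by rewrite exprMn -lee_fin (EFinM (K ^+ 2)) !nrm2_sqrE.
Qed.

(** The weight [t] comes from 2 a b <= t a^2 + b^2 / t; leaving it free lets it be tuned to the two
    norms afterwards. *)
Lemma sqint_add_le f g (t : R) : 0 < t -> cmeasurable f -> cmeasurable g ->
  (sqint (fun x => f x + g x)%R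
   <= (1 + t)%:E * sqint f + (1 + t^-1)%:E * sqint g)%E.
Proof.
move=> t0 mf mg.
have ti0 : 0 <= t^-1 by rewrite invr_ge0 ltW.
have h k : cmeasurable k -> measurable_fun D (fun x => (normc (k x) ^+ 2)%:E).
  by move=> mk; apply/measurable_EFinP/cmeasurable_sqr.
rewrite -!ge0_integralZl_EFin//; try by
  [rewrite addr_ge0// ltW|move=> x _; rewrite lee_fin sqr_ge0|exact: h].
rewrite -ge0_integralD//; try by
  [move=> x _; rewrite -EFinM lee_fin mulr_ge0 ?sqr_ge0 ?addr_ge0// ltW
  |apply: measurable_funeM; exact: h].
apply: ge0_le_integral => //.
- by move=> x _; rewrite lee_fin sqr_ge0.
- exact/h/cmeasurableD.
- by apply: emeasurable_funD; apply: measurable_funeM; exact: h.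
- move=> x _; rewrite -!EFinM -EFinD lee_fin.
  set a := normc (f x); set b := normc (g x).
  apply: (@le_trans _ _ ((a + b) ^+ 2)).
    by rewrite ler_sqr ?nnegrE ?addr_ge0 ?normc_ge0// le_normcD.
  have -> : (1 + t) * a ^+ 2 + (1 + t^-1) * b ^+ 2
    = (a + b) ^+ 2 + t^-1 * (t * a - b) ^+ 2.
    by field; rewrite gt_eqF.
  by rewrite lerDl mulr_ge0 ?sqr_ge0.
Qed.

Lemma in_L2D f g : in_L2 f -> in_L2 g -> in_L2 (fun x => f x + g x).
Proof.
move=> Lf Lg; have [mf mg] := (in_L2_cmeasurable Lf, in_L2_cmeasurable Lg).
apply: in_L2P; first exact: cmeasurableD.
apply: le_lt_trans (sqint_add_le ltr01 mf mg) _.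
by rewrite -!nrm2_sqrE// -!EFinM -EFinD ltry.
Qed.

Lemma nrm2D f g : in_L2 f -> in_L2 g ->
  nrm2 (fun x => f x + g x) <= nrm2 f + nrm2 g.
Proof.
move=> Lf Lg; have [mf mg] := (in_L2_cmeasurable Lf, in_L2_cmeasurable Lg).
apply/ler_addgt0Pr => e e0.
(* The weight used below is the ratio of these two numbers, for which the weighted inequality
   becomes Minkowski's; the extra [e / 2] keeps both positive. *)
set a := nrm2 f + e / 2; set b := nrm2 g + e / 2.
have a0 : 0 < a by rewrite ltr_wpDl ?nrm2_ge0// divr_gt0.
have b0 : 0 < b by rewrite ltr_wpDl ?nrm2_ge0// divr_gt0.
have -> : nrm2 f + nrm2 g + e = a + b by rewrite /a /b; field.
have := sqint_add_le (divr_gt0 b0 a0) mf mg.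
rewrite -!nrm2_sqrE//; last exact: in_L2D.
rewrite -!EFinM -EFinD lee_fin => h.
have ab0 : 0 <= a + b by rewrite addr_ge0// ltW.
rewrite -(ler_sqr (nrm2_ge0 _) ab0); apply: le_trans h _.
have -> : (a + b) ^+ 2 = (1 + b / a) * a ^+ 2 + (1 + (b / a)^-1) * b ^+ 2.
  by field; rewrite !gt_eqF.
have e20 : 0 <= e / 2 by rewrite divr_ge0 ?ltW.
apply: lerD; apply: ler_wpM2l.
- by rewrite addr_ge0// divr_ge0 ?ltW.
- by rewrite ler_sqr ?nnegrE ?nrm2_ge0 ?(ltW a0) ?(ltW b0)// lerDl.
- by rewrite addr_ge0// invr_ge0 divr_ge0 ?ltW.
- by rewrite ler_sqr ?nnegrE ?nrm2_ge0 ?(ltW a0) ?(ltW b0)// lerDl.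
Qed.

Lemma in_L2Z (c : C) f : in_L2 f -> in_L2 (fun x => (c : R[i]) * f x).
Proof.
move=> Lf; have mf := in_L2_cmeasurable Lf.
apply: (proj1 (in_L2_le _ Lf (normc_ge0 c) _)) => [|x _].
  exact/cmeasurableM/mf/cmeasurable_cst.
by rewrite normcM.
Qed.

Lemma in_L2B f g : in_L2 f -> in_L2 g -> in_L2 (fun x => f x - g x).
Proof.
move=> Lf /(in_L2Z (-1)) Lg; have := in_L2D Lf Lg.
by congr in_L2; apply/funext => x; rewrite mulN1r.
Qed.

Lemma nrm2_subC f g : nrm2 (fun x => f x - g x) = nrm2 (fun x => g x - f x).
Proof.
rewrite /nrm2 /sqint; congr (Num.sqrt (fine _)); apply: eq_integral => x _.
by rewrite -opprB normcN.
Qed.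

Lemma nrm2_sub_trans g f h : in_L2 f -> in_L2 g -> in_L2 h ->
  nrm2 (fun x => f x - h x)
  <= nrm2 (fun x => f x - g x) + nrm2 (fun x => g x - h x).
Proof.
move=> Lf Lg Lh; apply: le_trans (nrm2D (in_L2B Lf Lg) (in_L2B Lg Lh)).
by rewrite le_eqVlt; apply/orP; left; apply/eqP; congr nrm2; apply/funext => x; rewrite addrA subrK.
Qed.

Lemma nrm2_eq0P f : in_L2 f -> (nrm2 f = 0 <-> ae_eq mu D f (fun=> 0)).
Proof.
move=> Lf; have mf := in_L2_cmeasurable Lf.
have -> : (nrm2 f = 0) = (sqint f = 0%E).
  apply/propext; split=> h; first by rewrite -nrm2_sqrE// h expr0n.
  by rewrite /nrm2 h /= sqrtr0.
have h x : (`|(normc (f x) ^+ 2)%:E| = (normc (f x) ^+ 2)%:E)%E.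
  by rewrite gee0_abs// lee_fin sqr_ge0.
have msq : measurable_fun D (fun x => (normc (f x) ^+ 2)%:E).
  exact/measurable_EFinP/cmeasurable_sqr.
have := ae_eq_integral_abs mu mD msq.
rewrite /sqint; under eq_integral do rewrite h.
move=> ->; split; apply: filterS => x hx Dx.
  move: (hx Dx) => [] /eqP; rewrite sqrf_eq0 => /eqP.
  exact: eq0_normc.
by rewrite (hx Dx) normc0 expr0n.
Qed.

End ComplexL2.

(** * Integrals of complex functions *)

Section ComplexIntegral.
Context d (T : measurableType d) (R : realType).
Variables (mu : {measure set T -> \bar R}) (D : set T).
Hypothesis mD : measurable D.
Local Notation C := (R[i]^o).
Implicit Types f g : T -> C.

Definition cintegrable f :=
  mu.-integrable D (fun x => (complex.Re (f x))%:E) /\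
  mu.-integrable D (fun x => (complex.Im (f x))%:E).

Definition cint f : C :=
  (\int[mu]_(x in D) complex.Re (f x)) +i* (\int[mu]_(x in D) complex.Im (f x)).

Lemma eq_cint f g : {in D, f =1 g} -> cint f = cint g.
Proof.
by move=> h; congr (_ +i* _); apply: eq_Rintegral => x xD; rewrite h.
Qed.

Lemma cintegrableD f g : cintegrable f -> cintegrable g ->
  cintegrable (fun x => f x + g x).
Proof.
move=> [f1 f2] [g1 g2]; split.
  by under eq_fun do rewrite cReD EFinD; exact: integrableD.
by under eq_fun do rewrite cImD EFinD; exact: integrableD.
Qed.

Lemma cintD f g : cintegrable f -> cintegrable g ->
  cint (fun x => f x + g x) = cint f + cint g.
Proof.
move=> [f1 f2] [g1 g2]; rewrite /cint.
under eq_Rintegral do rewrite cReD.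
under [X in _ +i* X]eq_Rintegral do rewrite cImD.
by rewrite !RintegralD.
Qed.

Lemma cintegrableZ (c : C) f : cintegrable f ->
  cintegrable (fun x => (c : R[i]) * f x).
Proof.
move=> [f1 f2]; split.
  under eq_fun do rewrite cReM EFinB !EFinM.
  by apply: integrableB => //; exact: integrableZl.
under eq_fun do rewrite cImM EFinD !EFinM.
by apply: integrableD => //; exact: integrableZl.
Qed.

Lemma cintZ (c : C) f : cintegrable f ->
  cint (fun x => (c : R[i]) * f x) = (c : R[i]) * cint f.
Proof.
move=> [f1 f2].
have h (a : R) u : mu.-integrable D (EFin \o u) ->
  mu.-integrable D (EFin \o (fun x => a * u x)).
  move=> iu; have := integrableZl mD a iu.
  by congr (mu.-integrable D _); apply/funext => x; rewrite /= EFinM.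
apply: complexP; rewrite ?cReM ?cImM /cint /=.
  under eq_Rintegral do rewrite cReM.
  by rewrite RintegralB ?RintegralZl//; exact: h.
under eq_Rintegral do rewrite cImM.
by rewrite RintegralD ?RintegralZl//; exact: h.
Qed.

Lemma cintB f g : cintegrable f -> cintegrable g ->
  cint (fun x => f x - g x) = cint f - cint g.
Proof.
move=> hf hg; have := cintD hf (cintegrableZ (-1) hg).
rewrite cintZ// mulN1r => <-.
by congr cint; apply/funext => x; rewrite mulN1r.
Qed.

Lemma cintegrable0 : cintegrable (fun=> 0).
Proof. by split; exact: integrable0. Qed.

Lemma cint0 : cint (fun=> 0) = 0.
Proof.
by apply: complexP; rewrite /cint /= /Rintegral integral0.
Qed.

Lemma cintegrable_sum (I : eqType) (s : seq I) (F : I -> T -> C) :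
  (forall i, cintegrable (F i)) -> cintegrable (fun x => \sum_(i <- s) F i x).
Proof.
move=> hF; elim: s => [|i s ih].
  by under eq_fun do rewrite big_nil; exact: cintegrable0.
by under eq_fun do rewrite big_cons; exact: cintegrableD.
Qed.

Lemma cint_sum (I : eqType) (s : seq I) (F : I -> T -> C) :
  (forall i, cintegrable (F i)) ->
  cint (fun x => \sum_(i <- s) F i x) = \sum_(i <- s) cint (F i).
Proof.
move=> hF; elim: s => [|i s ih].
  by under eq_fun do rewrite big_nil; rewrite cint0 big_nil.
under eq_fun do rewrite big_cons.
by rewrite big_cons -ih cintD//; exact: cintegrable_sum.
Qed.

Lemma cintegrable_le f (u : T -> R) : cmeasurable D f ->
  mu.-integrable D (EFin \o u) -> (forall x, D x -> normc (f x) <= u x) ->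
  cintegrable f.
Proof.
move=> [f1 f2] iu h.
split; apply: le_integrable iu => //; try exact/measurable_EFinP.
- move=> x Dx /=; rewrite lee_fin (le_trans (Re_le_normc _))//.
  by rewrite (le_trans (h x Dx))// ler_norm.
- move=> x Dx /=; rewrite lee_fin (le_trans (Im_le_normc _))//.
  by rewrite (le_trans (h x Dx))// ler_norm.
Qed.

Hypothesis finD : (mu D < +oo)%E.

Lemma integrable_cst_lty (a : R) : mu.-integrable D (fun=> a%:E).
Proof.
apply/integrableP; split; first exact: measurable_cst.
by rewrite integral_cst// lte_mul_pinfty// lee_fin.
Qed.

(** On a set of finite measure |f| K <= |f|^2 + K^2 has an integrable right side. *)
Lemma in_L2_cintegrable f (K : R) g : in_L2 mu D f -> cmeasurable D g ->
  (forall x, D x -> normc (g x) <= K) ->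
  cintegrable (fun x => (f x : R[i]) * g x).
Proof.
move=> Lf mg hg; have mf := in_L2_cmeasurable Lf.
apply: (@cintegrable_le _ (fun x => normc (f x) ^+ 2 + K ^+ 2)).
- exact: cmeasurableM.
- apply: (@integrableD _ _ _ _ _ mD (fun x => (normc (f x) ^+ 2)%:E)
    (fun=> (K ^+ 2)%:E)).
    apply/integrableP; split; first exact/measurable_EFinP/cmeasurable_sqr.
    case: Lf => _ _; apply: le_lt_trans.
    rewrite le_eqVlt; apply/orP; left; apply/eqP; apply: eq_integral => x _.
    by rewrite gee0_abs// lee_fin sqr_ge0.
  exact: integrable_cst_lty.
- move=> x Dx; rewrite normcM.
  have a0 := normc_ge0 (f x); have b0 := normc_ge0 (g x).
  have ab := ler_wpM2l a0 (hg x Dx); apply: le_trans ab _.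
  have := sqr_ge0 (normc (f x) - K).
  have : 0 <= normc (f x) * K by rewrite mulr_ge0// (le_trans b0)// hg.
  by nra.
Qed.

Lemma nrm2_sqrR f : in_L2 mu D f ->
  nrm2 mu D f ^+ 2 = \int[mu]_(x in D) (normc (f x) ^+ 2).
Proof. by move=> Lf; rewrite /Rintegral -/(sqint mu D f) -nrm2_sqrE. Qed.

Lemma bounded_in_L2 f (K : R) : cmeasurable D f ->
  (forall x, D x -> normc (f x) <= K) -> in_L2 mu D f.
Proof.
move=> mf h; apply: in_L2P => //.
apply: (@le_lt_trans _ _ (\int[mu]_(x in D) (K ^+ 2)%:E)%E).
  apply: ge0_le_integral => //.
  - by move=> x _; rewrite lee_fin sqr_ge0.
  - exact/measurable_EFinP/cmeasurable_sqr.
  - move=> x Dx; rewrite lee_fin; have := h x Dx; have := normc_ge0 (f x).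
    by move=> ? ?; rewrite !expr2 ler_pM.
by rewrite integral_cst// lte_mul_pinfty// ?lee_fin ?sqr_ge0.
Qed.

End ComplexIntegral.

Lemma big_fset_split {V : nmodType} {I : choiceType} (a : I -> V)
    (F G : {fset I}) : (F `<=` G)%fset ->
  \sum_(i <- G) a i = \sum_(i <- F) a i + \sum_(i <- (G `\` F)%fset) a i.
Proof.
move=> FG; rewrite -big_cat /=; apply: perm_big; apply: uniq_perm.
- exact: fset_uniq.
- rewrite cat_uniq !fset_uniq andbT /=; apply/hasPn => i.
  by rewrite inE => /andP[].
- move=> i; rewrite mem_cat !inE; case: (boolP (i \in F)) => //= iF.
  by rewrite (fsubsetP FG).
Qed.

(** A finite set whose sum is within [eps] of the supremum of all finite sums leaves at most [eps]
    for any finite set disjoint from it. *)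
Lemma small_tail {R : realType} {I : choiceType} (a : I -> R) (B : R) :
  (forall i, 0 <= a i) -> (forall F : {fset I}, \sum_(i <- F) a i <= B) ->
  forall eps : R, 0 < eps -> exists F0 : {fset I}, forall F : {fset I},
    [disjoint F & F0]%fset -> \sum_(i <- F) a i <= eps.
Proof.
move=> a0 aB eps eps0.
pose S := [set \sum_(i <- F) a i | F in [set: {fset I}]].
have hS : has_sup S.
  split; first by exists (\sum_(i <- (fset0 : {fset I})) a i), fset0.
  by exists B => _ [F _ <-].
have [_ [F0 _ <-] hF0] := sup_adherent eps0 hS.
exists F0 => F dF.
have : \sum_(i <- (F `|` F0)%fset) a i <= sup S.
  by apply: ub_le_sup; [case: hS|exists (F `|` F0)%fset].
rewrite (big_fset_split _ (fsubsetUr F F0)) fsetDUl fsetDv fsetU0.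
move/fsetDidPl: dF => ->; move: hF0; lra.
Qed.

(** * Almost everywhere limits in L^2 *)

Section RieszFischer.
Context d (T : measurableType d) (R : realType).
Variables (mu : {measure set T -> \bar R}) (D : set T).
Hypothesis mD : measurable D.
Hypothesis finD : (mu D < +oo)%E.
Local Notation C := (R[i]^o).
Local Notation L2 := (in_L2 mu D).
Local Notation nrm := (nrm2 mu D).
Implicit Types f g : T -> C.

(** The sum of the moduli of the increments has a finite integral, so it is finite almost
    everywhere; there the real and imaginary parts are absolutely convergent telescoping series.
    This is the part of the completeness of L^2 that produces the limit. *)
Lemma normc_ae_limit (u : nat -> T -> C) :
  (forall n, cmeasurable D (u n)) ->
  (\sum_(n <oo) \int[mu]_(x in D) (normc (u n.+1 x - u n x))%:E < +oo)%E ->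
  exists2 f, cmeasurable D f & {ae mu, forall x, D x ->
    normc (u n x - f x) @[n --> \oo] --> (0 : R)}.
Proof.
move=> mu_ hsum.
pose h n x := normc (u n.+1 x - u n x).
have h0 n x : (0 <= (h n x)%:E)%E by rewrite lee_fin normc_ge0.
have mh n : measurable_fun D (fun x => (h n x)%:E).
  apply/measurable_EFinP/cmeasurable_normc.
  exact: cmeasurableD (mu_ n.+1) (cmeasurableN (mu_ n)).
(* An upper limit is measurable whether or not the sequence converges; it is the limit wherever the
   increments are summable. *)
pose lim_part (p : C -> R) x := fine (limn_esup (fun n => (p (u n x))%:E)).
pose f x : C := lim_part (@complex.Re R) x +i* lim_part (@complex.Im R) x.
exists f.
  split; apply: (measurableT_comp (fine_measurable measurableT)) => //;
    apply: measurable_fun_limn_esup => n; apply/measurable_EFinP;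
    by case: (mu_ n).
have hae : {ae mu, forall x, D x -> (\sum_(n <oo) (h n x)%:E)%E \is a fin_num}.
  apply: integrable_ae => //; apply/integrableP; split.
    by apply: ge0_emeasurable_sum => // n x _ _.
  under eq_integral => x _.
    rewrite gee0_abs; last by apply: nneseries_ge0 => n _ _.
    over.
  by rewrite integral_nneseries.
apply: filterS hae => x hx /hx {}hx.
have ch : cvgn (series (fun n => h n x)).
  apply: nondecreasing_is_cvgn.
    by apply: nondecreasing_series => n _ _; exact: normc_ge0.
  exists (fine (\sum_(n <oo) (h n x)%:E)%E) => _ [n _ <-].
  rewrite -lee_fin fineK// seriesEnat /= -sumEFin.
  by apply: nneseries_lim_ge => k _ _.
have part_cvg (p : C -> R) : (forall z w, p (z - w) = p z - p w) ->
    (forall z, `|p z| <= normc z) ->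
    (p (u n x) - lim_part p x) @[n --> \oo] --> (0 : R).
  move=> pB ple.
  have cp : cvgn (fun n => p (u n x)).
    have : cvgn (series (telescope (fun n => p (u n x)))).
      apply: normed_cvg; apply: series_le_cvg ch => n.
      - exact: normr_ge0.
      - exact: normc_ge0.
      - by rewrite /telescope /= -pB; exact: ple.
    rewrite telescopeK => c1.
    rewrite (_ : (fun n => _) = [sequence p (u n x) - p (u 0%N x)]_n
        + (fun=> p (u 0%N x))); last first.
      by apply/funext => n; rewrite [RHS]/GRing.add /= subrK.
    exact: is_cvgD c1 (is_cvg_cst _).
  have lE : lim_part p x = limn (fun n => p (u n x)).
    rewrite /lim_part is_cvg_limn_esupE.
      by rewrite (EFin_lim cp).
    apply/cvg_ex; exists (limn (fun n => p (u n x)))%:E.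
    by apply: cvg_EFin; [exact: nearW|exact: cp].
  rewrite lE -(subrr (limn (fun n => p (u n x)))).
  by apply: cvgB => //; exact: cvg_cst.
have cR := part_cvg (@complex.Re R) (fun z w => etrans (cReD z _) (congr1 _ (cReN w)))
  (@Re_le_normc R).
have cI := part_cvg (@complex.Im R) (fun z w => etrans (cImD z _) (congr1 _ (cImN w)))
  (@Im_le_normc R).
apply: (@squeeze_cvgr _ _ _ _ (fun=> 0) (fun n =>
  `|complex.Re (u n x) - lim_part (@complex.Re R) x| +
  `|complex.Im (u n x) - lim_part (@complex.Im R) x|)).
- apply: nearW => n; rewrite normc_ge0 /= (le_trans (normc_le_ReIm _))//.
  by rewrite cReD cImD cReN cImN.
- exact: cvg_cst.
- rewrite -[X in _ --> X](addr0 0).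
  by apply: cvgD; exact/norm_cvg0P.
Qed.

(** Fatou's lemma: a bound that holds from the index [N] on passes to the almost everywhere limit.
    That [f - g] is square integrable comes with the bound. *)
Lemma nrm2_ae_limit_le (u : nat -> T -> C) f g (N : nat) (b : R) :
  (forall n, L2 (u n)) -> cmeasurable D f -> L2 g -> 0 <= b ->
  {ae mu, forall x, D x -> normc (u n x - f x) @[n --> \oo] --> (0 : R)} ->
  (forall n, (N <= n)%N -> nrm (fun x => u n x - g x) <= b) ->
  L2 (fun x => f x - g x) /\ nrm (fun x => f x - g x) <= b.
Proof.
move=> Lu mf Lg b0 uf hb.
have mg := in_L2_cmeasurable Lg.
pose w n x := (normc (u n x - g x) ^+ 2)%:E.
have mw n : measurable_fun D (w n).
  apply/measurable_EFinP/cmeasurable_sqr/cmeasurableD; last exact: cmeasurableN.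
  exact: in_L2_cmeasurable (Lu n).
have mfg : cmeasurable D (fun x => f x - g x).
  by apply: cmeasurableD => //; exact: cmeasurableN.
have w0 n x : (0 <= w n x)%E by rewrite lee_fin sqr_ge0.
have wb n : (N <= n)%N -> (\int[mu]_(x in D) w n x <= (b ^+ 2)%:E)%E.
  move=> Nn; have LB := in_L2B mD (Lu n) Lg.
  rewrite -/(sqint mu D (fun x => u n x - g x)) -(nrm2_sqrE LB) lee_fin.
  by rewrite ler_sqr ?nnegrE ?nrm2_ge0// hb.
have le : (sqint mu D (fun x => (f x - g x)%R) <= (b ^+ 2)%:E)%E.
  apply: (@le_trans _ _ (\int[mu]_(x in D) limn_einf (w^~ x))%E); last first.
    apply: le_trans (fatou mu mD mw (fun n x _ => w0 n x)) _.
    rewrite limn_einf_lim; apply: lime_le; first exact: is_cvg_einfs.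
    exists N => // n /= Nn; apply: le_trans (wb n Nn).
    by apply: ereal_inf_lbound; exists n => //=.
  rewrite le_eqVlt; apply/orP; left; apply/eqP.
  apply: ae_eq_integral => //.
  - exact/measurable_EFinP/cmeasurable_sqr.
  - rewrite /limn_einf; apply: measurableT_comp => //.
    apply: measurable_fun_limn_esup => n.
    by apply: measurableT_comp => //.
  apply: filterS uf => x ufx Dx; apply/esym.
  suff : w n x @[n --> \oo] --> (normc (f x - g x) ^+ 2)%:E.
    by move=> /cvg_limn_einf_sup[].
  apply: cvg_EFin; first by apply: nearW.
  have : normc (u n x - g x) @[n --> \oo] --> normc (f x - g x).
    apply/cvgrPdist_le => e e0.
    move/cvgrPdist_le : (ufx Dx) => /(_ e e0); apply: filterS => n.
    rewrite sub0r normrN ger0_norm ?normc_ge0// distrC; apply: le_trans.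
    apply: le_trans (normc_dist _ _) _.
    by rewrite opprB addrA subrK.
  move=> c; rewrite expr2.
  rewrite (_ : fine \o w^~ x
    = (fun n => normc (u n x - g x)) * (fun n => normc (u n x - g x))).
    by apply: cvgM; exact: c.
  by apply/funext => n; rewrite /w /= expr2.
have LL : L2 (fun x => f x - g x) by apply: in_L2P => //; exact: le_lt_trans le (ltry _).
split=> //; rewrite -ler_sqr ?nnegrE ?nrm2_ge0//.
by rewrite -lee_fin nrm2_sqrE.
Qed.

End RieszFischer.

(** * Expansions in an orthonormal system of bounded functions *)

Section OrthonormalSystem.
Context d (T : measurableType d) (R : realType).
Variables (mu : {measure set T -> \bar R}) (D : set T).
Hypothesis mD : measurable D.
Hypothesis finD : (mu D < +oo)%E.
Local Notation C := (R[i]^o).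
Variables (I : choiceType) (e : I -> T -> C) (K : R).
Hypothesis me : forall i, cmeasurable D (e i).
Hypothesis eK : forall i x, D x -> normc (e i x) <= K.
Hypothesis ortho : forall i j,
  cint mu D (fun x => (e i x : R[i]) * ((e j x)^*)%C) = (i == j)%:R.
Implicit Types (f g : T -> C) (c : I -> C) (F : {fset I}).

Local Notation L2 := (in_L2 mu D).
Local Notation nrm := (nrm2 mu D).

(** The inner product with [e i]; the uniform bound on the system and the finite measure of [D] make
    its integrand integrable. *)
Definition coef i f : C := cint mu D (fun x => (f x : R[i]) * ((e i x)^*)%C).

Definition psum c F x : C := \sum_(i <- F) (c i : R[i]) * e i x.

Lemma in_L2_e i : L2 (e i).
Proof. by apply: (bounded_in_L2 mD finD (K := K)) => // x Dx; exact: eK. Qed.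

Lemma in_L2_psum c F : L2 (psum c F).
Proof.
rewrite /psum; elim: (F : seq I) => [|i s ih].
  under eq_fun do rewrite big_nil.
  apply: (bounded_in_L2 mD finD (K := 0)); first exact: cmeasurable_cst.
  by move=> x _; rewrite normc0.
under eq_fun do rewrite big_cons.
by apply: in_L2D => //; apply: in_L2Z => //; exact: in_L2_e.
Qed.

Lemma cintegrable_coef i f : L2 f ->
  cintegrable mu D (fun x => (f x : R[i]) * ((e i x)^*)%C).
Proof.
move=> Lf; apply: (in_L2_cintegrable mD finD (K := K)) => //.
  exact: cmeasurableJ.
by move=> x Dx; rewrite normcJ; exact: eK.
Qed.

Lemma coef0 i : coef i (fun=> 0) = 0.
Proof. by rewrite /coef; under [X in cint _ _ X]eq_fun do rewrite mul0r; rewrite cint0. Qed.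

Lemma coefD i f g : L2 f -> L2 g ->
  coef i (fun x => f x + g x) = coef i f + coef i g.
Proof.
move=> Lf Lg; rewrite /coef; under eq_fun do rewrite mulrDl.
by rewrite cintD//; exact: cintegrable_coef.
Qed.

Lemma coefB i f g : L2 f -> L2 g ->
  coef i (fun x => f x - g x) = coef i f - coef i g.
Proof.
move=> Lf Lg; rewrite /coef; under eq_fun do rewrite mulrBl.
by rewrite cintB//; exact: cintegrable_coef.
Qed.

Lemma coefZ i (a : C) f : L2 f ->
  coef i (fun x => (a : R[i]) * f x) = (a : R[i]) * coef i f.
Proof.
move=> Lf; rewrite /coef; under eq_fun do rewrite -mulrA.
by rewrite cintZ//; exact: cintegrable_coef.
Qed.

Lemma coef_psum i c F : coef i (psum c F) = if i \in F then c i else 0.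
Proof.
rewrite /coef /psum; under eq_fun do rewrite mulr_suml.
rewrite cint_sum//; last first.
  move=> j; under eq_fun do rewrite -mulrA.
  by apply: cintegrableZ => //; apply: cintegrable_coef; exact: in_L2_e.
transitivity (\sum_(j <- F) if j == i then c i else 0 : R[i]).
  apply: eq_bigr => j _; under eq_fun do rewrite -mulrA.
  rewrite cintZ//; last by apply: cintegrable_coef; exact: in_L2_e.
  by rewrite ortho; case: eqP => [->|_]; rewrite ?mulr1 ?mulr0.
rewrite -big_mkcond /=; case: ifP => iF.
  rewrite (big_rem i) //= eqxx big1_seq ?addr0// => j /andP[/eqP -> ].
  by rewrite mem_rem_uniq ?fset_uniq// inE eqxx.
by rewrite big1_seq// => j /andP[/eqP ->]; rewrite iF.
Qed.

Lemma cint_conj_psum g c F : L2 g ->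
  cint mu D (fun x => (g x : R[i]) * ((psum c F x)^*)%C)
  = \sum_(i <- F) ((c i)^*)%C * coef i g.
Proof.
move=> Lg.
transitivity (cint mu D (fun x => \sum_(i <- F)
    ((c i)^*)%C * ((g x : R[i]) * ((e i x)^*)%C))).
  congr cint; apply/funext => x; rewrite /psum rmorph_sum mulr_sumr.
  by apply: eq_bigr => i _; rewrite rmorphM /= mulrCA.
rewrite cint_sum//; last by move=> i; apply: cintegrableZ => //; exact: cintegrable_coef.
by apply: eq_bigr => i _; rewrite cintZ//; exact: cintegrable_coef.
Qed.

Lemma nrm2_psum c F : nrm (psum c F) ^+ 2 = \sum_(i <- F) normc (c i) ^+ 2.
Proof.
have LP := in_L2_psum c F.
transitivity (complex.Re (cint mu D
    (fun x => (psum c F x : R[i]) * ((psum c F x)^*)%C))).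
  rewrite nrm2_sqrR// /cint /=; apply: eq_Rintegral => x _.
  by rewrite mulcJ.
rewrite cint_conj_psum//.
transitivity (complex.Re (\sum_(i <- F) (normc (c i) ^+ 2)%:C : R[i])).
  congr complex.Re; rewrite !big_seq; apply: eq_bigr => i iF.
  by rewrite coef_psum iF mulrC mulcJ.
by rewrite -rmorph_sum.
Qed.

(** Expanding the square, the real part of the cross term and the squared norm of the partial sum
    are both the sum of the squared coefficients. Bessel's inequality is the positivity of the left
    side. *)
Lemma nrm2_sub_psum f F : L2 f ->
  nrm (fun x => f x - psum (coef^~ f) F x) ^+ 2
  = nrm f ^+ 2 - \sum_(i <- F) normc (coef i f) ^+ 2.
Proof.
move=> Lf; set P := psum (coef^~ f) F; have LP : L2 P by exact: in_L2_psum.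
have cfP : cintegrable mu D (fun x => (f x : R[i]) * ((P x)^*)%C).
  apply: (in_L2_cintegrable mD finD
    (K := \sum_(i <- F) normc (coef i f) * K)) => //.
    by apply: cmeasurableJ; exact: in_L2_cmeasurable LP.
  move=> x Dx; rewrite normcJ (le_trans (normc_sum _ _))//.
  by apply: ler_sum => i _; rewrite normcM ler_wpM2l ?normc_ge0// eK.
have isq g : L2 g -> mu.-integrable D (EFin \o (fun x => normc (g x) ^+ 2)).
  move=> Lg; apply/integrableP; split.
    by apply/measurable_EFinP/cmeasurable_sqr; exact: in_L2_cmeasurable Lg.
  case: Lg => _ _; apply: le_lt_trans; rewrite le_eqVlt; apply/orP; left.
  by apply/eqP; apply: eq_integral => x _; rewrite gee0_abs// lee_fin sqr_ge0.
have e1 : complex.Re (cint mu D (fun x => (f x : R[i]) * ((P x)^*)%C))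
    = \sum_(i <- F) normc (coef i f) ^+ 2.
  rewrite cint_conj_psum//.
  transitivity (complex.Re (\sum_(i <- F) (normc (coef i f) ^+ 2)%:C : R[i])).
    by congr complex.Re; apply: eq_bigr => i _; rewrite mulrC mulcJ.
  by rewrite -rmorph_sum.
have LfP := in_L2B mD Lf LP.
rewrite !nrm2_sqrR//.
transitivity (\int[mu]_(x in D) (normc (f x) ^+ 2 + normc (P x) ^+ 2
    - 2 * complex.Re ((f x : R[i]) * ((P x)^*)%C))).
  apply: eq_Rintegral => x _; rewrite !normc_sqr cReD cReN cImD cImN cReM cReJ cImJ.
  by ring.
have i2 : mu.-integrable D
    (EFin \o (fun x => 2 * complex.Re ((f x : R[i]) * ((P x)^*)%C))).
  have := integrableZl mD 2 (proj1 cfP).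
  by congr (mu.-integrable D _); apply/funext => x; rewrite /= EFinM.
rewrite RintegralB//; last first.
  apply: (@integrableD _ _ _ _ _ mD (fun x => (normc (f x) ^+ 2)%:E)
    (fun x => (normc (P x) ^+ 2)%:E)); exact: isq.
rewrite RintegralD//; try exact: isq.
rewrite RintegralZl//; last by case: cfP.
rewrite -[X in _ + X - _]nrm2_sqrR// nrm2_psum.
by move: e1; rewrite /cint /= => ->; ring.
Qed.

Lemma bessel f F : L2 f -> \sum_(i <- F) normc (coef i f) ^+ 2 <= nrm f ^+ 2.
Proof.
move=> Lf; rewrite -subr_ge0 -nrm2_sub_psum//; exact: sqr_ge0.
Qed.

Lemma normc_coef_le i f : L2 f -> normc (coef i f) <= nrm f.
Proof.
move=> Lf; have := bessel [fset i]%fset Lf; rewrite big_seq_fset1.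
by rewrite ler_sqr ?nnegrE ?normc_ge0 ?nrm2_ge0.
Qed.

Definition L2_sum_cvg f c := forall eps : R, 0 < eps ->
  exists F0, forall F, (F0 `<=` F)%fset -> nrm (fun x => f x - psum c F x) <= eps.

Lemma psum_sub c F G : (F `<=` G)%fset ->
  (fun x => psum c G x - psum c F x) = psum c (G `\` F)%fset.
Proof.
by move=> FG; apply/funext => x; rewrite /psum (big_fset_split _ FG) addrAC subrr add0r.
Qed.

Lemma nrm2_psum_tail c F0 F G (b : R) : 0 <= b ->
  (forall F, [disjoint F & F0]%fset -> \sum_(i <- F) normc (c i) ^+ 2 <= b ^+ 2) ->
  (F0 `<=` F)%fset -> (F0 `<=` G)%fset ->
  nrm (fun x => psum c F x - psum c G x) <= b + b.
Proof.
move=> b0 h FF GG.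
have sub X : (F0 `<=` X)%fset -> nrm (fun x => psum c X x - psum c F0 x) <= b.
  move=> XX; rewrite (psum_sub _ XX) -ler_sqr ?nnegrE ?nrm2_ge0// nrm2_psum.
  by apply: h; apply/fdisjointP => i; rewrite inE => /andP[].
have LP X := in_L2_psum c X.
apply: le_trans (nrm2_sub_trans mD (LP F) (LP F0) (LP G)) _.
by apply: lerD; [exact: sub|rewrite nrm2_subC; exact: sub].
Qed.

(** Partial sums along finite sets [G_ n] that exhaust the tails form a Cauchy sequence fast enough
    to converge almost everywhere; Fatou's lemma then bounds the distance from the limit to every
    partial sum containing [G_ n]. *)
Lemma riesz_fischer c (B : R) :
  (forall F, \sum_(i <- F) normc (c i) ^+ 2 <= B) ->
  exists2 f, L2 f & L2_sum_cvg f c.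
Proof.
move=> cB.
(* The tail is to have norm at most 4^-n; squares are summed, hence the outer square. *)
have tail (n : nat) : exists F0, forall F, [disjoint F & F0]%fset ->
    \sum_(i <- F) normc (c i) ^+ 2 <= (4 ^- n) ^+ 2.
  apply: (small_tail _ cB) => [i|]; first exact: sqr_ge0.
  by rewrite exprn_gt0// invr_gt0 exprn_gt0.
have [F_ hF_] := choice tail.
(* Cumulative unions, so that the tail bounds of all indices up to [n] hold beyond [G_ n]. *)
pose G_ := fix G n := if n is m.+1 then (G m `|` F_ m.+1)%fset else F_ 0%N.
have GS n : (G_ n `<=` G_ n.+1)%fset by exact: fsubsetUl.
have FG n : (F_ n `<=` G_ n)%fset by case: n => [|n]//=; exact: fsubsetUr.
have GG m n : (m <= n)%N -> (G_ m `<=` G_ n)%fset.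
  elim: n => [|n ih]; first by rewrite leqn0 => /eqP ->.
  rewrite leq_eqVlt => /predU1P[->//|]; rewrite ltnS => /ih h.
  exact: fsubset_trans h (GS n).
have hG n F : (G_ n `<=` F)%fset ->
    forall m, (n <= m)%N -> nrm (fun x => psum c (G_ m) x - psum c F x) <= 4 ^- n + 4 ^- n.
  move=> nF m nm; apply: (nrm2_psum_tail _ (hF_ n)).
  - by rewrite invr_ge0 exprn_ge0.
  - exact: fsubset_trans (FG n) (GG _ _ nm).
  - exact: fsubset_trans (FG n) nF.
pose u n := psum c (G_ n).
have Lu n : L2 (u n) by exact: in_L2_psum.
(* The L^1 norm is at most [t] times the squared L^2 norm plus the measure divided by [t]; for the
   n-th increment [t] will be 2^n. *)
have L1 g (t : R) : L2 g -> 0 < t ->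
    (\int[mu]_(x in D) (normc (g x))%:E <= t%:E * sqint mu D g + t^-1%:E * mu D)%E.
  move=> Lg t0; have mg := in_L2_cmeasurable Lg.
  have ti0 : 0 < t^-1 by rewrite invr_gt0.
  rewrite -integral_cst// -[X in (_ + X)%E]/(\int[mu]_(x in D) (fun=> t^-1%:E) x)%E.
  rewrite /sqint -ge0_integralZl_EFin ?(ltW t0)//; last 2 first.
  - by move=> x _; rewrite lee_fin sqr_ge0.
  - exact/measurable_EFinP/cmeasurable_sqr.
  rewrite -ge0_integralD//; last 3 first.
  - by move=> x _; rewrite -EFinM lee_fin mulr_ge0 ?sqr_ge0// ltW.
  - by apply: measurable_funeM; exact/measurable_EFinP/cmeasurable_sqr.
  - by move=> x _; rewrite lee_fin ltW.
  apply: ge0_le_integral => //.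
  - by move=> x _; rewrite lee_fin normc_ge0.
  - exact/measurable_EFinP/cmeasurable_normc.
  - apply: emeasurable_funD => //.
    by apply: measurable_funeM; exact/measurable_EFinP/cmeasurable_sqr.
  move=> x _; rewrite -EFinM -EFinD lee_fin.
  have -> : t * normc (g x) ^+ 2 + t^-1
    = normc (g x) + t^-1 * (((t * normc (g x)) - 1 / 2) ^+ 2 + 3 / 4).
    by field; rewrite gt_eqF.
  rewrite lerDl; apply: mulr_ge0; first exact: ltW.
  by apply: addr_ge0; [exact: sqr_ge0|rewrite divr_ge0].
have muDE : mu D = (fine (mu D))%:E by rewrite fineK// ge0_fin_numE.
have M0 : 0 <= fine (mu D) by rewrite fine_ge0.
have hsum : (\sum_(n <oo) \int[mu]_(x in D) (normc (u n.+1 x - u n x))%:E < +oo)%E.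
  (* With a = 2^-n, the n-th increment is at most 4 a^3 + a mu(D) <= a (4 + mu(D)) in L^1, and these
     bounds add up to [M]. *)
  pose M := 2 * (4 + fine (mu D)).
  have M1 : 0 < M by rewrite mulr_gt0// ltr_wpDr.
  apply: (@le_lt_trans _ _ M%:E); last exact: ltry.
  apply: le_trans (epsilon_trick0 xpredT (ltW M1)).
  apply: lee_nneseries => [n _ _|n _].
    by apply: integral_ge0 => x _; rewrite lee_fin normc_ge0.
  have LB := in_L2B mD (Lu n.+1) (Lu n).
  apply: le_trans (L1 _ (2 ^+ n) LB _) _; first by rewrite exprn_gt0.
  rewrite -(nrm2_sqrE LB) muDE -!EFinM -EFinD lee_fin.
  have -> : M / (2 ^ n.+1)%:R = 2 ^- n * (4 + fine (mu D)).
    by rewrite /M natrX exprS; field; rewrite expf_neq0.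
  rewrite mulrDr lerD2r.
  have h := hG n (G_ n) (fsubset_refl _) n.+1 (leqnSn n).
  have h4 : 0 <= 4 ^- n + 4 ^- n :> R by rewrite addr_ge0// invr_ge0 exprn_ge0.
  rewrite -ler_sqr ?nnegrE ?nrm2_ge0// in h.
  apply: le_trans (ler_wpM2l _ h) _; first by rewrite exprn_ge0.
  have -> : 4 ^- n = 2 ^- n ^+ 2 :> R.
    have e4 : 2 ^+ 2 = 4 :> R by rewrite -natrX.
    by rewrite exprVn -exprM mulnC exprM e4.
  have a0 : 0 < 2 ^- n :> R by rewrite invr_gt0 exprn_gt0.
  have a1 : 2 ^- n <= 1 :> R by rewrite invf_le1 ?exprn_gt0// exprn_ege1// ler1n.
  rewrite -[X in X * _ <= _]invrK; move: a0 a1; set a := 2 ^- n => a0 a1.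
  have -> : a^-1 * (a ^+ 2 + a ^+ 2) ^+ 2 = 4 * a ^+ 3.
    by field; rewrite gt_eqF.
  rewrite mulrC; apply: ler_wpM2r => //; rewrite exprS.
  by apply: ler_piMr; [exact: ltW|apply: exprn_ile1 => //; exact: ltW].
have [f mf uf] := normc_ae_limit mD (fun n => in_L2_cmeasurable (Lu n)) hsum.
have key n F : (G_ n `<=` F)%fset -> L2 (fun x => f x - psum c F x) /\
    nrm (fun x => f x - psum c F x) <= 4 ^- n + 4 ^- n.
  move=> nF; apply: (nrm2_ae_limit_le mD (N := n)) uf _ => //.
  - exact: in_L2_psum.
  - exact: hG.
exists f.
  have [LB _] := key 0%N (G_ 0%N) (fsubset_refl _).
  have := in_L2D mD LB (Lu 0%N).
  by congr (in_L2 _ _ _); apply/funext => x; rewrite subrK.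
move=> eps eps0.
have [n hn] : exists n, 4 ^- n + 4 ^- n <= eps :> R.
  have q1 : `|4^-1 : R| < 1 by rewrite ger0_norm ?invr_ge0// invf_lt1// ltr1n.
  have /cvgrPdist_le/(_ eps eps0)[n _ /(_ n (leqnn n))] := cvg_geometric 2 q1.
  rewrite /geometric /= sub0r normrN exprVn => h; exists n.
  apply: le_trans h; apply: le_trans (ler_norm _).
  by rewrite -mulr2n -[leLHS]mulr_natl.
by exists (G_ n) => F /key[_ h]; exact: le_trans h hn.
Qed.

(** A coefficient is bounded by the norm and equals [c i] on every partial sum that contains [i]. *)
Lemma coef_sum_cvg f c : L2 f -> L2_sum_cvg f c -> forall i, coef i f = c i.
Proof.
move=> Lf fc i; apply/eqP; rewrite -subr_eq0; apply/eqP/eq0_normc/le_anti.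
rewrite normc_ge0 andbT; apply/ler_addgt0Pr => eps eps0; rewrite add0r.
have [F0 hF0] := fc eps eps0.
pose F := (i |` F0)%fset.
apply: le_trans (hF0 F (fsubsetUr _ _)).
have LP := in_L2_psum c F.
apply: le_trans (normc_coef_le i (in_L2B mD Lf LP)).
by rewrite coefB// coef_psum !inE eqxx.
Qed.

Hypothesis complete : forall f, L2 f -> (forall i, coef i f = 0) -> nrm f = 0.

(** By Bessel's inequality, Riesz-Fischer produces some [g] with the coefficients of [f]; by
    completeness it differs from [f] by a function of norm zero. *)
Lemma L2_sum_coef f : L2 f -> L2_sum_cvg f (coef^~ f).
Proof.
move=> Lf; have [g Lg gc] := riesz_fischer (fun F => bessel F Lf).
have LB := in_L2B mD Lf Lg.
have z : nrm (fun x => f x - g x) = 0.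
  by apply: complete => // i; rewrite coefB// (coef_sum_cvg Lg gc) subrr.
move=> eps eps0; have [F0 hF0] := gc eps eps0; exists F0 => F FF.
apply: le_trans (nrm2_sub_trans mD Lf Lg (in_L2_psum _ F)) _.
by rewrite z add0r hF0.
Qed.

(** One half of Parseval's identity, in the form in which bounds on finitely many coefficients at a
    time control the norm. *)
Lemma nrm2_le_coef f (b : R) : L2 f -> 0 <= b ->
  (forall F, \sum_(i <- F) normc (coef i f) ^+ 2 <= b ^+ 2) -> nrm f <= b.
Proof.
move=> Lf b0 h; apply/ler_addgt0Pr => eps eps0.
have [F0 /(_ F0 (fsubset_refl _))] := L2_sum_coef Lf eps0.
set P := psum _ _ => hF; have LP : L2 P by exact: in_L2_psum.
have -> : nrm f = nrm (fun x => (f x - P x) + P x).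
  by congr (nrm2 _ _); apply/funext => x; rewrite subrK.
apply: le_trans (nrm2D mD (in_L2B mD Lf LP) LP) _.
rewrite addrC lerD// -ler_sqr ?nnegrE ?nrm2_ge0//.
by rewrite nrm2_psum; exact: h.
Qed.

Lemma L2_sum_cvgP f c : L2 f -> (L2_sum_cvg f c <-> forall i, coef i f = c i).
Proof.
move=> Lf; split; first exact: coef_sum_cvg.
by move=> h; rewrite -(funext h); exact: L2_sum_coef.
Qed.

End OrthonormalSystem.


(** * Lebesgue measure of the plane and cells of a lattice *)

Section MeasurePreserving.
Context d (T : measurableType d) (R : realType) (mu : {measure set T -> \bar R}).
Variable phi : T -> T.
Hypothesis mphi : measurable_fun [set: T] phi.
Hypothesis phi_mu : forall A, measurable A -> mu (phi @^-1` A) = mu A.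

Lemma ge0_integral_preserving (D : set T) (f : T -> \bar R) :
  measurable D -> measurable_fun D f -> (forall x, D x -> (0 <= f x)%E) ->
  (\int[mu]_(x in D) f x = \int[mu]_(x in phi @^-1` D) f (phi x))%E.
Proof.
move=> mD mf f0; rewrite -[RHS](ge0_integral_pushforward mphi mu)//.
  apply: eq_measure_integral => A mA _; apply/esym; exact: phi_mu.
by move=> x; rewrite inE; exact: f0.
Qed.

Lemma integral_preserving (D : set T) (f : T -> \bar R) :
  measurable D -> measurable_fun D f ->
  (\int[mu]_(x in D) f x = \int[mu]_(x in phi @^-1` D) f (phi x))%E.
Proof.
move=> mD mf; rewrite [LHS]integralE [RHS]integralE; congr (_ - _)%E.
  etransitivity.
    exact: (ge0_integral_preserving mD (measurable_funepos mf) (fun x _ => funepos_ge0 f x)).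
  have e : ((fun x => f (phi x))^\+ = f^\+ \o phi)%E := funepos_comp f phi.
  by rewrite e.
etransitivity.
  exact: (ge0_integral_preserving mD (measurable_funeneg mf) (fun x _ => funeneg_ge0 f x)).
have e : ((fun x => f (phi x))^\- = f^\- \o phi)%E := funeneg_comp f phi.
by rewrite e.
Qed.

End MeasurePreserving.

Section PlaneMeasure.
Context {R : realType}.
Local Notation plane := (R * R)%type.
Local Notation mplane := (measurableTypeR R * measurableTypeR R)%type.
Local Notation mu2 := (@mu2 R).

Lemma measurable_addr (a : R) :
  measurable_fun [set: measurableTypeR R] (fun x : measurableTypeR R => (x + a : measurableTypeR R)).
Proof.
apply: (@measurable_funD _ _ R [set: measurableTypeR R] (fun x => x) (fun=> a)).
  exact: measurable_id.
exact: measurable_cst.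
Qed.

Lemma lebesgue_measure_shift (a : R) (A : set (measurableTypeR R)) :
  measurable A ->
  lebesgue_measure ((fun x : measurableTypeR R => (x + a : measurableTypeR R)) @^-1` A)
  = lebesgue_measure A.
Proof.
move=> mA; rewrite -[LHS]/(pushforward lebesgue_measure
  (fun x : measurableTypeR R => (x + a : measurableTypeR R)) A).
apply/esym/lebesgue_measure_unique => //=; first exact: measurable_addr.
move=> _ _ [[b c]] _ <-; rewrite /pushforward.
have -> : (fun x => x + a) @^-1` [set` `]b, c]] = [set` `](b - a), (c - a)]].
  by apply/seteqP; split => x /=; rewrite !in_itv /= ltrBlDr lerBrDr.
rewrite !lebesgue_measure_itv /= !lte_fin ltrD2r; case: ifP => // _.
by rewrite -!EFinB opprB addrA subrK.
Qed.

Lemma measurable_shift (v : plane) :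
  measurable_fun [set: mplane] (fun x : mplane => (x + v : mplane)).
Proof.
apply/measurable_fun_pairP; split.
  exact: measurable_funD measurable_fst (measurable_cst _).
exact: measurable_funD measurable_snd (measurable_cst _).
Qed.

Lemma mu2E (A : set mplane) :
  mu2 A = (@lebesgue_measure R \x @lebesgue_measure R)%E A.
Proof. by []. Qed.

Lemma mu2X (A B : set (measurableTypeR R)) : measurable A -> measurable B ->
  mu2 (A `*` B) = (lebesgue_measure A * lebesgue_measure B)%E.
Proof. by move=> mA mB; rewrite mu2E product_measure1E. Qed.

Lemma mu2_shift (v : plane) (A : set mplane) : measurable A ->
  mu2 ((fun x : mplane => (x + v : mplane)) @^-1` A) = mu2 A.
Proof.
move=> mA; apply/esym; rewrite -[RHS]/(pushforward mu2 (fun x : mplane => (x + v : mplane)) A).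
have mv := measurable_shift v.
rewrite mu2E; apply: (@product_measure_unique _ _ _ _ R (@lebesgue_measure R)
  (@lebesgue_measure R) (pushforward mu2 (fun x : mplane => (x + v : mplane)))) mA.
move=> B C mB mC.
have ms (a : R) (E : set (measurableTypeR R)) : measurable E -> measurable
    ((fun x : measurableTypeR R => (x + a : measurableTypeR R)) @^-1` E).
  by move=> mE; rewrite -[X in measurable X]setTI; exact: measurable_addr.
transitivity (lebesgue_measure ((fun x : measurableTypeR R => (x + v.1 : measurableTypeR R)%R) @^-1` B)
  * lebesgue_measure ((fun x : measurableTypeR R => (x + v.2 : measurableTypeR R)%R) @^-1` C))%E.
  exact: mu2X (ms _ _ mB) (ms _ _ mC).
by rewrite !lebesgue_measure_shift.
Qed.

Lemma ge0_integral_shift (v : plane) (D : set mplane) (f : mplane -> \bar R) :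
  measurable D -> measurable_fun D f -> (forall x, D x -> (0 <= f x)%E) ->
  (\int[mu2]_(x in D) f x
   = \int[mu2]_(x in (fun x => (x + v)%R) @^-1` D) f (x + v)%R)%E.
Proof.
exact: (@ge0_integral_preserving _ mplane R mu2 (fun x : mplane => (x + v : mplane))
  (measurable_shift v) (mu2_shift v) D f).
Qed.

Lemma integral_shift (v : plane) (D : set mplane) (f : mplane -> \bar R) :
  measurable D -> measurable_fun D f ->
  (\int[mu2]_(x in D) f x
   = \int[mu2]_(x in (fun x => (x + v)%R) @^-1` D) f (x + v)%R)%E.
Proof.
exact: (@integral_preserving _ mplane R mu2 (fun x : mplane => (x + v : mplane))
  (measurable_shift v) (mu2_shift v) D f).
Qed.

Lemma measurable_apply2 (M : 'M[R]_2) :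
  measurable_fun [set: mplane] (fun x : mplane => (apply2 M x : mplane)).
Proof.
have h (a b : R) : measurable_fun [set: mplane] (fun x : mplane => a * x.1 + b * x.2).
  by apply: measurable_funD; apply: measurable_funM;
    by [exact: measurable_cst|exact: measurable_fst|exact: measurable_snd].
by apply/measurable_fun_pairP; split; exact: h.
Qed.

Lemma measurable_dot2 (v : plane) :
  measurable_fun [set: mplane] (fun x : mplane => dot2 x v).
Proof.
by apply: measurable_funD; apply: measurable_funM;
    by [exact: measurable_cst|exact: measurable_fst|exact: measurable_snd].
Qed.

Lemma apply2D (M : 'M[R]_2) x y : apply2 M (x + y) = apply2 M x + apply2 M y.
Proof. by congr pair; rewrite /= !mulrDr addrACA. Qed.

Lemma apply2N (M : 'M[R]_2) x : apply2 M (- x) = - apply2 M x.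
Proof. by congr pair; rewrite /= !mulrN -opprD. Qed.

Lemma apply2_mul (M N : 'M[R]_2) x : apply2 (M *m N) x = apply2 M (apply2 N x).
Proof.
have sum2 (F : 'I_2 -> R) : \sum_i F i = F 0 + F 1.
  by rewrite !big_ord_recl big_ord0 addr0; congr (_ + F _); exact: val_inj.
by congr pair; rewrite /apply2 /= !mxE !sum2; ring.
Qed.

Lemma apply2_1 x : apply2 (1%:M : 'M[R]_2) x = x.
Proof.
case: x => x1 x2; rewrite /apply2 /= !mxE /=.
by rewrite !mulr1n !mulr0n !mul1r !mul0r addr0 add0r.
Qed.

Lemma apply2K (M : 'M[R]_2) : M \in unitmx ->
  cancel (apply2 M) (apply2 (invmx M)).
Proof. by move=> uM x; rewrite -apply2_mul mulVmx// apply2_1. Qed.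

Lemma apply2KV (M : 'M[R]_2) : M \in unitmx ->
  cancel (apply2 (invmx M)) (apply2 M).
Proof. by move=> uM x; rewrite -apply2_mul mulmxV// apply2_1. Qed.

Lemma measurable_shift_preimage (v : plane) (A : set mplane) : measurable A ->
  measurable ((fun x : mplane => (x + v : mplane)) @^-1` A).
Proof.
by move=> mA; rewrite -[X in measurable X]setTI; exact: measurable_shift.
Qed.

End PlaneMeasure.

(** * Tilings of the plane by the translates of a cell *)

Section Cell.
Context {R : realType}.
Local Notation plane := (R * R)%type.
Local Notation mplane := (measurableTypeR R * measurableTypeR R)%type.
Local Notation mu2 := (@mu2 R).
Variable M : 'M[R]_2.
Hypothesis uM : M \in unitmx.

Definition zpt (n : int * int) : plane := (n.1%:~R, n.2%:~R).

Lemma zptD m n : zpt (m + n) = zpt m + zpt n.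
Proof. by rewrite /zpt; congr pair => /=; rewrite rmorphD. Qed.

Lemma zptN n : zpt (- n) = - zpt n.
Proof. by rewrite /zpt; congr pair => /=; rewrite rmorphN. Qed.

Lemma cellP x : cell M x <->
  (0 <= (apply2 (invmx M) x).1 < 1) /\ (0 <= (apply2 (invmx M) x).2 < 1).
Proof.
split=> [[t [t1 t2] <-]|[t1 t2]].
  by rewrite apply2K//; move: t1 t2; rewrite /= !in_itv.
by exists (apply2 (invmx M) x); [split; rewrite /= in_itv|exact: apply2KV].
Qed.

Lemma measurable_cell : measurable (cell M : set mplane).
Proof.
have -> : (cell M : set mplane) =
    setT `&` (fun x : mplane => (apply2 (invmx M) x : mplane)) @^-1` (`[0, 1[ `*` `[0, 1[).
  rewrite setTI; apply/seteqP; split => x.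
    by move/cellP => [? ?]; split; rewrite /= in_itv.
  by move=> [/= h1 h2]; apply/cellP; move: h1 h2; rewrite !in_itv.
by apply: measurable_apply2 => //; apply: measurableX; exact: measurable_itv.
Qed.

(** The lattice vector is given by the integer parts of the coordinates of [y] in the basis [M]. *)
Lemma cell_ex_unique y : exists n, cell M (y - apply2 M (zpt n)) /\
  forall m, cell M (y - apply2 M (zpt m)) -> m = n.
Proof.
have h n : cell M (y - apply2 M (zpt n)) <->
    Num.floor (apply2 (invmx M) y).1 = n.1 /\ Num.floor (apply2 (invmx M) y).2 = n.2.
  rewrite cellP -apply2N apply2D apply2K// /= -/(apply2 _ _).
  have flr (t : R) (k : int) : 0 <= t + - k%:~R < 1 <-> Num.floor t = k.
    rewrite subr_ge0 ltrBlDr addrC -(intrD1 k) -floor_eq.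
    by split=> [/eqP|->].
  by split=> -[h1 h2]; split; apply/flr.
exists (Num.floor (apply2 (invmx M) y).1, Num.floor (apply2 (invmx M) y).2).
split; first by apply/h.
by case=> m1 m2 /h[/= -> ->].
Qed.

Lemma cell_ex_uniqueN y : exists n, cell M (y + apply2 M (zpt n)) /\
  forall m, cell M (y + apply2 M (zpt m)) -> m = n.
Proof.
have [n [h1 h2]] := cell_ex_unique y; exists (- n); split.
  by rewrite zptN apply2N.
by move=> m hm; apply/eqP; rewrite -eqr_oppLR; apply/eqP/h2; rewrite zptN apply2N opprK.
Qed.

(** The translates are indexed by natural numbers through a code of Z^2, for countable additivity; a
    number that codes nothing gives the empty set. *)
Definition tile (g : int * int -> plane) (k : nat) : set mplane :=
  oapp (fun n => [set y | cell M (y + g n)]) set0 (pickle_inv k).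

(** Stated for any family [g], because cells are displaced by plus or minus the lattice vectors and
    by an arbitrary offset. *)
Definition tiling (g : int * int -> plane) := forall y, exists n, cell M (y + g n) /\
  forall m, cell M (y + g m) -> m = n.

Lemma tilingB v : tiling (fun n => - apply2 M (zpt n) + v).
Proof.
move=> y; have [n [h1 h2]] := cell_ex_unique (y + v); exists n.
by rewrite addrA addrAC; split=> // m; rewrite addrA addrAC => /h2.
Qed.

Lemma tilingD v : tiling (fun n => apply2 M (zpt n) + v).
Proof.
move=> y; have [n [h1 h2]] := cell_ex_uniqueN (y + v); exists n.
by rewrite addrA addrAC; split=> // m; rewrite addrA addrAC => /h2.
Qed.

Lemma measurable_tile g k : measurable (tile g k).
Proof.
rewrite /tile; case: (pickle_inv k) => [n|] /=; last exact: measurable0.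
exact: (measurable_shift_preimage (g n) measurable_cell).
Qed.

Lemma trivIset_tile g : tiling g -> trivIset setT (tile g).
Proof.
move=> tg; apply/trivIsetP => i j _ _ ij; rewrite -subset0 => x [].
rewrite /tile; case ei : (pickle_inv i) => [n|//]; case ej : (pickle_inv j) => [m|//] /=.
have [k [_ uk]] := tg x; move=> /uk en /uk em.
have := @pickle_invK (int * int)%type i; have := @pickle_invK (int * int)%type j.
by rewrite ei ej /= en em => jk ik; move: ij; rewrite -jk -ik eqxx.
Qed.

Lemma bigcup_tile g : tiling g -> \bigcup_k tile g k = setT.
Proof.
move=> tg; apply/seteqP; split => // x _; have [n [cn _]] := tg x.
exists (choice.pickle n); first exact: Logic.I.
by rewrite /tile pickleK_inv; exact: cn.
Qed.

Lemma ge0_integral_tile g (E : set mplane) (f : mplane -> \bar R) : tiling g ->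
  measurable E -> measurable_fun E f -> (forall x, E x -> (0 <= f x)%E) ->
  (\int[mu2]_(x in E) f x = \sum_(k <oo) \int[mu2]_(x in E `&` tile g k) f x)%E.
Proof.
move=> tg mE mf f0.
have EE : E = \bigcup_k (E `&` tile g k) by rewrite -setI_bigcupr bigcup_tile// setIT.
rewrite {1}EE ge0_integral_bigcup//.
- by move=> k; apply: measurableI => //; exact: measurable_tile.
- by rewrite -EE.
- by rewrite -EE.
- by apply: trivIset_setIl; exact: trivIset_tile.
Qed.

Lemma measurable_fun_tile d (U : measurableType d) g (f : mplane -> U) : tiling g ->
  (forall n, measurable_fun [set y : mplane | cell M (y + g n)] f) ->
  measurable_fun [set: mplane] f.
Proof.
move=> tg mf; rewrite -(bigcup_tile tg); apply/measurable_fun_bigcup.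
  exact: measurable_tile.
move=> k; rewrite /tile; case: (pickle_inv k) => [n|] /=; first exact: mf.
exact: measurable_fun_set0.
Qed.

Definition lattice_periodic (T : Type) (u : plane -> T) :=
  forall x n, u (x + apply2 M (zpt n)) = u x.

(** Cut the displaced cell along the lattice translates of the cell, and the cell along those of the
    displaced one: the pieces correspond by lattice translations, which do not change a periodic
    integrand. *)
Lemma ge0_integral_cell_shift (u : mplane -> \bar R) (v : plane) :
  measurable_fun [set: mplane] u -> (forall x, (0 <= u x)%E) -> lattice_periodic u ->
  (\int[mu2]_(x in [set x : mplane | cell M (x + v)%R]) u x
   = \int[mu2]_(x in cell M) u x)%E.
Proof.
move=> mu_ u0 pu.
have mC := measurable_cell.
have mCv : measurable [set x : mplane | cell M (x + v)].
  exact: measurable_shift_preimage.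
have mS (E : set mplane) : measurable_fun E u by apply: measurable_funS mu_.
rewrite (ge0_integral_tile (tilingB 0) mCv (mS _) (fun x _ => u0 x)).
rewrite (ge0_integral_tile (tilingD v) mC (mS _) (fun x _ => u0 x)).
apply: eq_eseriesr => k _; rewrite /tile; case: (pickle_inv k) => [n|] /=; last first.
  by rewrite !setI0.
rewrite (ge0_integral_shift (apply2 M (zpt n)))//; last first.
  by apply: measurableI => //; apply: (measurable_shift_preimage _ mC).
rewrite (_ : _ @^-1` _ = cell M `&` [set y | cell M (y + (apply2 M (zpt n) + v))]).
  by apply: eq_integral => x _; exact: pu.
apply/seteqP; split => x; rewrite /preimage /setI /mkset.
  by rewrite !addrA addr0 addrK => -[].
by rewrite !addrA addr0 addrK => -[].
Qed.

End Cell.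


(** * Completeness of the exponentials on a cell *)

Section Expi.
Context {R : realType}.
Implicit Types s t : R.

Lemma expiD s t : expi (s + t) = (expi s : R[i]) * expi t.
Proof.
by apply: complexP; rewrite ?cReM ?cImM /= ?cosD ?sinD//; ring.
Qed.

Lemma expi0 : expi 0 = 1 :> R[i].
Proof. by apply: complexP; rewrite /= ?cos0 ?sin0. Qed.

Lemma normc_expi t : normc (expi t) = 1.
Proof. by rewrite /= cos2Dsin2 sqrtr1. Qed.

Lemma expi2pi (k : int) : expi (2 * pi * k%:~R) = 1 :> R[i].
Proof.
have cosn (n : nat) : cos (2 * pi * n%:R : R) = 1.
  have h := periodicn (@cosD2pi R) n 0; rewrite add0r cos0 in h; rewrite -[RHS]h.
  by congr cos; rewrite -mulrnA -[RHS]mulr_natr natrM; ring.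
have sinn (n : nat) : sin (2 * pi * n%:R : R) = 0.
  have h := periodicn (@sinD2pi R) n 0; rewrite add0r sin0 in h; rewrite -[RHS]h.
  by congr sin; rewrite -mulrnA -[RHS]mulr_natr natrM; ring.
case: k => n; apply: complexP; rewrite /= ?cosn ?sinn//.
  by rewrite NegzE mulrNz mulrN cosN; exact: cosn.
by rewrite NegzE mulrNz mulrN sinN; rewrite (sinn n.+1) oppr0.
Qed.

End Expi.

(** * The area of a cell and the integrals of characters *)

Section CellMeasure.
Context {R : realType}.
Local Notation plane := (R * R)%type.
Local Notation mplane := (measurableTypeR R * measurableTypeR R)%type.
Local Notation mu2 := (@mu2 R).
Local Notation C := (R[i]^o).
Variable M : 'M[R]_2.
Hypothesis uM : M \in unitmx.

Lemma cell_bounded : exists2 K : R, 0 < K &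
  forall x, cell M x -> `|x.1| <= K /\ `|x.2| <= K.
Proof.
pose K := `|M 0 0| + `|M 0 1| + `|M 1 0| + `|M 1 1| + 1.
have K0 : 0 < K by rewrite ltr_wpDl// !addr_ge0.
exists K => // _ [t [/= t1 t2] <-].
have {}t1 : `|t.1| <= 1 by move: t1; rewrite in_itv => /andP[? /ltW ?]; rewrite ger0_norm.
have {}t2 : `|t.2| <= 1 by move: t2; rewrite in_itv => /andP[? /ltW ?]; rewrite ger0_norm.
have h (a b : R) : `|a * t.1 + b * t.2| <= `|a| + `|b|.
  rewrite (le_trans (ler_normD _ _))// !normrM.
  by apply: lerD; apply: ler_piMr.
rewrite /=; split; apply: le_trans (h _ _) _; rewrite /K.
- by rewrite -!addrA lerD2l lerDl !addr_ge0.
- by have := normr_ge0 (M 0 0); have := normr_ge0 (M 0 1); lra.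
Qed.

Lemma mu2_cell_lty : (mu2 (cell M) < +oo)%E.
Proof.
have [K K0 hK] := cell_bounded.
pose E : set mplane := `[- K, K] `*` `[- K, K].
have le : (mu2 (cell M) <= mu2 E)%E.
  apply: le_measure; rewrite ?inE.
  - exact: measurable_cell.
  - by apply: measurableX; exact: measurable_itv.
  - by move=> x /hK[h1 h2]; split; rewrite /= in_itv /= -ler_norml.
apply: le_lt_trans le _; rewrite /E mu2X ?lebesgue_measure_itv//=; try exact: measurable_itv.
by case: ifP => _; rewrite -?EFinB -?EFinM ?mul0e ltry.
Qed.

(** If the cell were null, so would be all its translates, and countably many of them cover the unit
    square. *)
Lemma mu2_cell_gt0 : (0 < mu2 (cell M))%E.
Proof.
rewrite lt0e measure_ge0 andbT; apply/negP => /eqP z.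
pose E : set mplane := `[0, 1] `*` `[0, 1].
have mE : measurable E by apply: measurableX; exact: measurable_itv.
have := @ge0_integral_tile _ M uM (fun n => apply2 M (zpt n) + 0) E (cst 1%E)
  (tilingD uM 0) mE (measurable_cst _) (fun x _ => lee01).
rewrite integral_cst// mul1e eseries0; last first.
  move=> k _ _; rewrite integral_cst ?mul1e; last first.
    by apply: measurableI => //; exact: measurable_tile.
  apply/eqP; rewrite -measure_le0.
  apply: (@le_trans _ _ (mu2 (tile M (fun n => apply2 M (zpt n) + 0) k))).
    apply: le_measure; rewrite ?inE; try exact: measurable_tile; last by move=> x [].
    by apply: measurableI => //; exact: measurable_tile.
  rewrite /tile; case: (pickle_inv k) => [n|] /=; last by rewrite measure0.
  by rewrite (mu2_shift _ (measurable_cell uM)) z.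
rewrite mu2X; try exact: measurable_itv.
rewrite !lebesgue_measure_itv /= lte_fin ltr01 sube0 mule1 => /eqP.
by rewrite eqe oner_eq0.
Qed.

(** The exponentials of these phases are the characters of the plane modulo the lattice of [M]. *)
Definition phase (n : int * int) (x : plane) : R :=
  2 * pi * dot2 (zpt n) (apply2 (invmx M) x).

Lemma phaseD m n x : phase (m + n) x = phase m x + phase n x.
Proof. by rewrite /phase zptD /dot2 /=; ring. Qed.

Lemma phaseN n x : phase (- n) x = - phase n x.
Proof. by rewrite /phase zptN /dot2 /=; ring. Qed.

Lemma phase0 x : phase 0 x = 0.
Proof. by rewrite /phase /zpt /dot2 /= !mul0r addr0 mulr0. Qed.

Lemma phase_shift n x w :
  phase n (x + apply2 M w) = phase n x + 2 * pi * dot2 (zpt n) w.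
Proof. by rewrite /phase apply2D apply2K// /dot2 /=; ring. Qed.

Lemma expi_phase_periodic n x m :
  expi (phase n (x + apply2 M (zpt m))) = expi (phase n x).
Proof.
rewrite phase_shift expiD.
have -> : dot2 (zpt n) (zpt m) = (n.1 * m.1 + n.2 * m.2)%:~R :> R.
  by rewrite /dot2 /zpt /= rmorphD !rmorphM.
by rewrite expi2pi mulr1.
Qed.

Lemma measurable_phase n : measurable_fun [set: mplane] (phase n : mplane -> R).
Proof.
apply: measurable_funM; first exact: measurable_cst.
have h : (fun x : mplane => dot2 (zpt n) (apply2 (invmx M) x)) =
    (fun y : mplane => dot2 y (zpt n)) \o (fun x : mplane => (apply2 (invmx M) x : mplane)).
  by apply/funext => x /=; rewrite /dot2 /=; ring.
by rewrite h; apply: measurableT_comp; [exact: measurable_dot2|exact: measurable_apply2].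
Qed.

Lemma measurable_cos_phase n (a : R) :
  measurable_fun [set: mplane] (fun x : mplane => cos (phase n x + a)).
Proof.
apply: (measurableT_comp (f := @cos R)).
  by apply: continuous_measurable_fun; exact: continuous_cos.
by apply: measurable_funD; [exact: measurable_phase|exact: measurable_cst].
Qed.

Lemma integrable_cell_bounded (u : mplane -> R) (K : R) :
  measurable_fun (cell M : set mplane) u -> (forall x, cell M x -> `|u x| <= K) ->
  mu2.-integrable (cell M) (EFin \o u).
Proof.
move=> mu_ uK; apply: (@le_integrable _ mplane R mu2 _ _ _ (fun=> K%:E)).
- exact: measurable_cell.
- exact/measurable_EFinP.
- by move=> x /uK h; rewrite /= lee_fin (le_trans h)// ler_norm.
- by apply: integrable_cst_lty => //; [exact: measurable_cell|exact: mu2_cell_lty].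
Qed.

(** A translation that advances the phase by pi changes the sign of the cosine but, by periodicity,
    not its integral over the cell. The offset [a] lets the same statement cover the sine. *)
Lemma Rintegral_cos_phase n (a : R) : n != 0 ->
  \int[mu2]_(x in cell M) cos (phase n x + a) = 0.
Proof.
move=> n0.
(* In lattice coordinates, n / (2 |n|^2) advances the phase by exactly pi. *)
pose w : plane := let d := dot2 (zpt n) (zpt n) in
  ((zpt n).1 / (2 * d), (zpt n).2 / (2 * d)).
have d0 : dot2 (zpt n) (zpt n) != 0 :> R.
  rewrite /dot2 /zpt /= -!expr2 paddr_eq0 ?sqr_ge0// !sqrf_eq0 !intr_eq0.
  by rewrite -[X in ~~ X]/(n == (0, 0)).
have dw : 2 * pi * dot2 (zpt n) w = pi.
  by rewrite /w /dot2 /=; field; move: d0; rewrite /dot2 /=.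
(* The constant 1 makes the function nonnegative, as the comparison of a cell with its translate
   requires; it cancels in the end. *)
pose u (x : mplane) : \bar R := (1 + cos (phase n x + a))%:E.
have mu_ : measurable_fun [set: mplane] u.
  apply/measurable_EFinP/measurable_funD; first exact: measurable_cst.
  exact: measurable_cos_phase.
have u0 x : (0 <= u x)%E by rewrite lee_fin -lerBlDl sub0r cos_geN1.
have pu : lattice_periodic M u.
  move=> x m; rewrite /u; congr (1 + _)%:E.
  have /(congr1 (@complex.Re R)) h := expi_phase_periodic n x m.
  have /(congr1 (@complex.Im R)) h' := expi_phase_periodic n x m.
  by rewrite !cosD; rewrite /= in h h'; rewrite h h'.
have mC := measurable_cell uM.
have e1 := ge0_integral_cell_shift uM (apply2 M w) mu_ u0 pu.
have mus : measurable_fun (cell M : set mplane) (fun x : mplane => (1 - cos (phase n x + a))%:E).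
  apply/measurable_EFinP/measurable_funB; first exact: measurable_cst.
  exact: measurable_funS (measurable_cos_phase n a).
have e2 := ge0_integral_shift (apply2 M w) mC mus.
have ic : mu2.-integrable (cell M) (EFin \o (fun x : mplane => cos (phase n x + a))).
  apply: (integrable_cell_bounded (K := 1)) => [|x _]; last exact: cos_max.
  exact: measurable_funS (measurable_cos_phase n a).
have i1 : mu2.-integrable (cell M) (EFin \o (fun _ : mplane => 1 : R)).
  by apply: (integrable_cell_bounded (K := 1)) => [|x _]; rewrite ?normr1.
have : (\int[mu2]_(x in cell M) (1 - cos (phase n x + a)) =
  \int[mu2]_(x in cell M) (1 + cos (phase n x + a)))%R.
  rewrite /Rintegral; congr fine; rewrite e2; last first.
    by move=> x _; rewrite lee_fin subr_ge0 cos_le1.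
  rewrite -e1; apply: eq_integral => x _; rewrite /u; congr EFin.
  by rewrite phase_shift dw addrAC cosDpi opprK.
rewrite RintegralB// RintegralD// => /eqP; rewrite -subr_eq0.
rewrite opprD addrACA subrr add0r -opprD oppr_eq0 -mulr2n mulrn_eq0 /=.
by move=> /eqP.
Qed.

Lemma cint_expi_phase n (a : R) :
  cint mu2 (cell M) (fun x => expi (phase n x + a))
  = if n == 0 then (fine (mu2 (cell M)))%:C * expi a else 0 :> R[i].
Proof.
have mC := measurable_cell uM.
apply: complexP; rewrite /cint /=; case: eqP => [->|/eqP n0].
- under eq_Rintegral do rewrite phase0 add0r.
  by rewrite Rintegral_cst// /= mul0r subr0 mulrC.
- exact: Rintegral_cos_phase.
- under eq_Rintegral do rewrite phase0 add0r.
  by rewrite Rintegral_cst// /= mul0r addr0 mulrC.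
- under eq_Rintegral do rewrite -cosBpihalf -addrA.
  exact: Rintegral_cos_phase.
Qed.

End CellMeasure.

(* [1 - (1 - y ^ (n ^ 2)) ^ (2 ^ (n ^ 2 - n))] tends to the indicator function of
   [y > 1 / 2]: by Bernoulli's inequality it is within [((2 y) ^ n / 2) ^ n] of
   [0], and within the inverse of this number of [1]. *)
Definition step {R : realType} (n : nat) (y : R) : R :=
  1 - (1 - y ^+ (n ^ 2)) ^+ (2 ^ (n ^ 2 - n)).

Section Step.
Context {R : realType}.
Implicit Types y : R.

Lemma step01 n y : 0 <= y <= 1 -> 0 <= step n y <= 1.
Proof.
move=> /andP[y0 y1]; have yn0 : 0 <= y ^+ (n ^ 2) by rewrite exprn_ge0.
have yn1 : y ^+ (n ^ 2) <= 1 by rewrite exprn_ile1.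
have z0 : 0 <= 1 - y ^+ (n ^ 2) by rewrite subr_ge0.
have z1 : 1 - y ^+ (n ^ 2) <= 1 by rewrite gerBl.
rewrite /step subr_ge0 exprn_ile1//= gerBl; exact: exprn_ge0.
Qed.

Lemma bernoulli_ge (x : R) n : -1 <= x -> 1 + n%:R * x <= (1 + x) ^+ n.
Proof.
move=> x1; elim: n => [|n ih]; first by rewrite mul0r addr0 expr0.
have h : 0 <= 1 + x by rewrite -lerBlDl sub0r.
rewrite exprS; apply: le_trans (ler_wpM2l h ih).
rewrite -[n.+1%:R]natr1; have := sqr_ge0 x; have : 0 <= n%:R :> R by [].
by nra.
Qed.

Lemma step_exponent n y : (2 ^ (n ^ 2 - n))%:R * y ^+ (n ^ 2)
  = ((2 * y) ^+ n / 2) ^+ n.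
Proof.
have nn : (n <= n ^ 2)%N by case: n => // n; rewrite expnS expn1 leq_pmulr.
rewrite expr_div_n -exprM mulnn exprMn natrX.
have -> : 2 ^+ (n ^ 2) = 2 ^+ (n ^ 2 - n) * 2 ^+ n :> R.
  by rewrite -exprD subnK.
by field; rewrite expf_neq0.
Qed.

Lemma step_le n y : 0 <= y <= 1 -> step n y <= ((2 * y) ^+ n / 2) ^+ n.
Proof.
move=> /andP[y0 y1].
have yn1 : y ^+ (n ^ 2) <= 1 by rewrite exprn_ile1.
have := @bernoulli_ge (- y ^+ (n ^ 2)) (2 ^ (n ^ 2 - n)).
by rewrite lerN2 -step_exponent /step => /(_ yn1); rewrite mulrN; lra.
Qed.

(** Since (1 - a) (1 + a) <= 1, the number (1 - a)^N is at most the inverse of (1 + a)^N, to which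
    Bernoulli's inequality applies. *)
Lemma step_ge n y : 0 <= y <= 1 -> 1 - step n y <= (1 + ((2 * y) ^+ n / 2) ^+ n)^-1.
Proof.
move=> /andP[y0 y1].
have yn0 : 0 <= y ^+ (n ^ 2) by rewrite exprn_ge0.
have yn1 : y ^+ (n ^ 2) <= 1 by rewrite exprn_ile1.
rewrite /step opprB addrC subrK.
set N := (2 ^ (n ^ 2 - n))%N; set a := y ^+ (n ^ 2) in yn0 yn1 *.
have h : 1 + N%:R * a <= (1 + a) ^+ N.
  by apply: bernoulli_ge; apply: le_trans yn0; rewrite lerN10.
have p0 : 0 < 1 + N%:R * a by rewrite ltr_pwDl// mulr_ge0.
rewrite -step_exponent -/N -/a -[leRHS]mul1r ler_pdivlMr//.
apply: le_trans (ler_wpM2l _ h) _; first by rewrite exprn_ge0// subr_ge0.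
rewrite -exprMn exprn_ile1//.
  by rewrite mulr_ge0 ?subr_ge0// addr_ge0.
by rewrite mulrBl mul1r mulrDr mulr1; nra.
Qed.

(** Up to 1/2 the upper bound is at most (1/2)^n, end point included, thanks to the division of (2
    y)^n by 2. Above 1/2 that quotient is eventually at least 2, and its n-th power at least 2^n. *)
Lemma cvg_step y : 0 <= y <= 1 ->
  step n y @[n --> \oo] --> ((1 / 2 < y)%R%:R : R).
Proof.
move=> y01; have /andP[y0 y1] := y01; have [yh|yh] := ltP (1 / 2) y.
- have q1 : 1 < 2 * y by lra.
  have [m hm] : exists m, forall n, (m <= n)%N -> 4 <= (2 * y) ^+ n.
    have q0 : `|(2 * y)^-1| < 1 by rewrite ger0_norm ?invr_ge0 ?invf_lt1//; lra.
    have e0 : 0 < 4^-1 :> R by [].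
    have /cvgrPdist_le/(_ _ e0)[m _ hm] := cvg_expr q0.
    exists m => n mn; have := hm n mn; rewrite sub0r normrN /=.
    have p0 : 0 < (2 * y) ^+ n by rewrite exprn_gt0//; lra.
    rewrite exprVn ger0_norm ?invr_ge0 ?(ltW p0)//.
    by rewrite lef_pV2 ?posrE.
  have h2 : `|2^-1 : R| < 1 by rewrite ger0_norm ?invr_ge0// invf_lt1// ltr1n.
  apply/cvgrPdist_le => e e0.
  have /cvgrPdist_le/(_ _ e0)[k _ hk] := cvg_expr h2.
  exists (maxn m k) => // n /=; rewrite geq_max => /andP[mn kn].
  have /andP[s0 s1] := step01 n y01.
  rewrite ger0_norm ?subr_ge0//; apply: le_trans (step_ge n y01) _.
  apply: le_trans (hk n kn); rewrite sub0r normrN /= exprVn.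
  have p2 : 0 < 2 ^+ n :> R by rewrite exprn_gt0.
  rewrite ger0_norm ?invr_ge0 ?(ltW p2)//.
  have le2 : 2 ^+ n <= ((2 * y) ^+ n / 2) ^+ n.
    rewrite lerXn2r ?nnegrE//; first by rewrite divr_ge0// exprn_ge0//; lra.
    by rewrite ler_pdivlMr// -natrM; exact: hm.
  rewrite lef_pV2 ?posrE//; first by lra.
  by rewrite ltr_pwDl//; apply: le_trans le2; exact: ltW.
- have h2 : `|2^-1 : R| < 1 by rewrite ger0_norm ?invr_ge0// invf_lt1// ltr1n.
  apply/cvgrPdist_le => e e0.
  have /cvgrPdist_le/(_ _ e0)[k _ hk] := cvg_expr h2.
  exists k => // n kn; have := hk n kn; rewrite !sub0r !normrN /=.
  have /andP[s0 s1] := step01 n y01.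
  rewrite ger0_norm ?exprn_ge0// ger0_norm//; apply: le_trans.
  apply: le_trans (step_le n y01) _; rewrite lerXn2r ?nnegrE//.
    by rewrite divr_ge0// exprn_ge0//; lra.
  rewrite -[leRHS]mul1r ler_wpM2r ?invr_ge0// exprn_ile1//; lra.
Qed.

(* The arc [a < t < 1] of the circle is where the cosine centred at [(1 + a) / 2]
   exceeds its value at the end points. *)
Definition arc (a t : R) : R :=
  1 / 2 + (cos (2 * pi * t - pi * (1 + a)) - cos (pi * (1 - a))) / 4.

Lemma arc01 a t : 0 <= arc a t <= 1.
Proof.
rewrite /arc; have := cos_le1 (2 * pi * t - pi * (1 + a)).
have := cos_geN1 (2 * pi * t - pi * (1 + a)).
by have := cos_le1 (pi * (1 - a)); have := cos_geN1 (pi * (1 - a)); lra.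
Qed.

(** The cosine decreases on [0, pi], so comparing its values means comparing distances to the
    midpoint of the arc. When the distance is more than half a turn, cos (pi u) = cos (pi (2 - u))
    brings the argument back. *)
Lemma arc_gt a t : 0 <= a < 1 -> 0 <= t < 1 -> (1 / 2 < arc a t) = (a < t).
Proof.
move=> /andP[a0 a1] /andP[t0 t1].
have p0 := pi_gt0 R.
have cosE : cos (2 * pi * t - pi * (1 + a)) = cos (pi * `|2 * t - 1 - a|).
  rewrite -[LHS]cos_norm; congr cos.
  by rewrite -[pi in RHS](gtr0_norm p0) -normrM; congr (`|_|); ring.
have -> : (1 / 2 < arc a t) = (cos (pi * (1 - a)) < cos (pi * `|2 * t - 1 - a|)).
  by rewrite -cosE /arc ltrDl pmulr_lgt0// subr_gt0.
have ip (s : R) : 0 <= s <= 1 -> pi * s \in `[0, pi].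
  move=> /andP[s0 s1]; rewrite in_itv /= mulr_ge0 ?(ltW p0)//=.
  by rewrite ler_piMr// ltW.
have a01 : 0 <= 1 - a <= 1 by lra.
have [le1|gt1] := lerP `|2 * t - 1 - a| 1.
  rewrite ltr_cos ?ip ?normr_ge0 ?le1// ltr_pM2l//.
  have [ge0|lt0] := leP 0 (2 * t - 1 - a).
    rewrite ger0_norm//; apply/idP/idP; lra.
  rewrite ltr0_norm//; apply/idP/idP; lra.
have lt0 : 2 * t - 1 - a < 0.
  by rewrite ltNge; apply/negP => ge0; move: gt1; rewrite ger0_norm//; lra.
rewrite ltr0_norm// in gt1 *.
have -> : cos (pi * - (2 * t - 1 - a)) = cos (pi * (1 - a + 2 * t)).
  rewrite -[LHS]cosN -(cosD2pi (- _)); congr cos.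
  by rewrite -mulr_natr; ring.
rewrite ltr_cos ?ip//; last by apply/andP; split; lra.
by rewrite ltr_pM2l//; apply/idP/idP; lra.
Qed.

End Step.

(** * Trigonometric polynomials for a lattice *)

Section TrigPolynomials.
Context {R : realType}.
Local Notation plane := (R * R)%type.
Local Notation C := (R[i]^o).
Variable M : 'M[R]_2.

Definition trig_poly (p : plane -> C) := exists s : seq (C * (int * int)),
  p = fun x => \sum_(z <- s) (z.1 : R[i]) * expi (phase M z.2 x).

Lemma trig_polyD p q : trig_poly p -> trig_poly q ->
  trig_poly (fun x => p x + q x).
Proof.
by move=> [s ->] [t ->]; exists (s ++ t); apply/funext => x; rewrite big_cat.
Qed.

Lemma trig_polyM p q : trig_poly p -> trig_poly q ->
  trig_poly (fun x => (p x : R[i]) * q x).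
Proof.
move=> [s ->] [t ->].
exists [seq ((z.1 : R[i]) * w.1 : C, z.2 + w.2) | z <- s, w <- t].
apply/funext => x; rewrite big_allpairs_dep mulr_suml; apply: eq_bigr => z _.
rewrite mulr_sumr; apply: eq_bigr => w _.
by rewrite /= phaseD expiD mulrACA.
Qed.

Lemma trig_poly_monomial (a : C) n :
  trig_poly (fun x => (a : R[i]) * expi (phase M n x)).
Proof. by exists [:: (a, n)]; apply/funext => x; rewrite big_seq1. Qed.

Lemma trig_poly_cst (a : C) : trig_poly (fun=> a).
Proof.
have := trig_poly_monomial a 0; congr trig_poly; apply/funext => x.
by rewrite phase0 expi0 mulr1.
Qed.

Definition real_trig_poly (q : plane -> R) := trig_poly (fun x => (q x)%:C).

Lemma real_trig_polyD p q : real_trig_poly p -> real_trig_poly q ->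
  real_trig_poly (fun x => p x + q x).
Proof.
move=> hp hq; have := trig_polyD hp hq; congr trig_poly.
by apply/funext => x; rewrite rmorphD.
Qed.

Lemma real_trig_polyM p q : real_trig_poly p -> real_trig_poly q ->
  real_trig_poly (fun x => p x * q x).
Proof.
move=> hp hq; have := trig_polyM hp hq; congr trig_poly.
by apply/funext => x; rewrite rmorphM.
Qed.

Lemma real_trig_poly_cst (a : R) : real_trig_poly (fun=> a).
Proof. exact: trig_poly_cst. Qed.

Lemma real_trig_polyB p q : real_trig_poly p -> real_trig_poly q ->
  real_trig_poly (fun x => p x - q x).
Proof.
move=> hp hq; have := real_trig_polyD hp (real_trig_polyM (real_trig_poly_cst (-1)) hq).
by congr real_trig_poly; apply/funext => x; rewrite mulN1r.
Qed.

Lemma real_trig_polyX p n : real_trig_poly p -> real_trig_poly (fun x => p x ^+ n).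
Proof.
move=> hp; elim: n => [|n ih].
  by under eq_fun do rewrite expr0; exact: real_trig_poly_cst.
by under eq_fun do rewrite exprS; exact: real_trig_polyM.
Qed.

Lemma real_trig_poly_cos n (a : R) :
  real_trig_poly (fun x => cos (phase M n x + a)).
Proof.
have := trig_polyD (trig_poly_monomial ((2^-1)%:C * expi a) n)
  (trig_poly_monomial ((2^-1)%:C * expi (- a)) (- n)).
congr trig_poly; apply/funext => x.
rewrite -!mulrA -!expiD phaseN -opprD.
apply: complexP; rewrite ?cReD ?cImD ?cReM ?cImM /= ?cosN ?sinN.
  by rewrite [a + _]addrC; field.
by rewrite [a + _]addrC; ring.
Qed.

Lemma real_trig_poly_step p n : real_trig_poly p ->
  real_trig_poly (fun x => step n (p x)).
Proof.
move=> hp; apply: real_trig_polyB; first exact: real_trig_poly_cst.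
apply/real_trig_polyX/real_trig_polyB; first exact: real_trig_poly_cst.
exact: real_trig_polyX.
Qed.

(** As [step] is a polynomial and [arc] an affine function of a cosine, their composite is a
    trigonometric polynomial. For a threshold outside [0, 1) the ray contains all or nothing of the
    unit interval, and a constant serves. *)
Lemma real_trig_poly_ray (n : int * int) (t : plane -> R) (a : R) :
  (forall x, phase M n x = 2 * pi * t x) -> exists q : nat -> plane -> R,
  [/\ forall k, real_trig_poly (q k), forall k x, 0 <= q k x <= 1 &
    forall x, 0 <= t x < 1 -> q k x @[k --> \oo] --> ((a < t x)%R%:R : R)].
Proof.
move=> nt; have [a0|a0] := ltP a 0.
  exists (fun _ _ => 1); split.
  - by move=> _; exact: real_trig_poly_cst.
  - by move=> _ _; rewrite ler01 lexx.
  - by move=> x /andP[t0 _]; rewrite (lt_le_trans a0 t0); exact: cvg_cst.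
have [a1|a1] := ltP a 1; last first.
  exists (fun _ _ => 0); split.
  - by move=> _; exact: real_trig_poly_cst.
  - by move=> _ _; rewrite ler01 lexx.
  - by move=> x /andP[_ t1]; rewrite ltNge (le_trans (ltW t1) a1); exact: cvg_cst.
exists (fun k x => step k (arc a (t x))); split.
- move=> k; apply: real_trig_poly_step.
  have := real_trig_polyD (real_trig_poly_cst (1 / 2 - cos (pi * (1 - a)) / 4))
    (real_trig_polyM (real_trig_poly_cst 4^-1) (real_trig_poly_cos n (- (pi * (1 + a))))).
  congr real_trig_poly; apply/funext => x; rewrite nt /arc.
  by field.
- by move=> k x; apply: step01; exact: arc01.
- by move=> x t01; rewrite -(@arc_gt _ a) ?a0//; apply: cvg_step; exact: arc01.
Qed.

End TrigPolynomials.

(** * Functions orthogonal to all trigonometric polynomials *)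

Section Completeness.
Context {R : realType}.
Local Notation plane := (R * R)%type.
Local Notation mplane := (measurableTypeR R * measurableTypeR R)%type.
Local Notation mu2 := (@mu2 R).
Local Notation C := (R[i]^o).
Variable M : 'M[R]_2.
Hypothesis uM : M \in unitmx.
Local Notation D := (cell M : set mplane).

Lemma measurable_trig_poly (p : mplane -> C) : trig_poly M p -> cmeasurable setT p.
Proof.
move=> [s ->]; apply: cmeasurable_sum => // z.
apply: cmeasurableM; first exact: cmeasurable_cst.
split; rewrite /=.
  have := measurable_cos_phase M z.2 0.
  by under eq_fun do rewrite addr0.
have := measurable_cos_phase M z.2 (- (pi / 2)).
by under eq_fun do rewrite cosBpihalf.
Qed.

Variable u : mplane -> R.
Hypothesis iu : mu2.-integrable D (EFin \o u).
Hypothesis u0 : forall q, real_trig_poly M q ->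
  (\int[mu2]_(x in D) (u x * q x)%:E = 0)%E.

(** The sets over which [u] integrates to zero. They are closed under proper differences and
    countable disjoint unions, as Dynkin's theorem requires. *)
Let null (E : set mplane) := (\int[mu2]_(x in D `&` E) (u x)%:E = 0)%E.
Let mD : measurable D := measurable_cell uM.
Let mu_ : measurable_fun D u.
Proof. by move/measurable_int : iu => /measurable_EFinP. Qed.

Let nullD E F : measurable E -> measurable F -> E `<=` F ->
  null E -> null F -> null (F `\` E).
Proof.
move=> mE mF EF nE; rewrite /null.
have e : D `&` F = (D `&` E) `|` (D `&` (F `\` E)).
  rewrite -setIUr; congr (_ `&` _); apply/seteqP; split => x.
    by move=> Fx; have [Ex|nEx] := pselect (E x); [left|right].
  by move=> [/EF//|[]].
rewrite {1}e integral_setU.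
- by rewrite -/(null E) in nE; rewrite nE add0e.
- exact: measurableI.
- by apply: measurableI => //; exact: measurableD.
- rewrite -e; apply: measurable_funS; [exact: mD|by move=> x []|].
  exact/measurable_EFinP.
- by apply/disj_setPS => x [[_ Ex] [_ [_ nEx]]].
Qed.

Let null_bigcup (F : (set mplane)^nat) : (forall k, measurable (F k)) ->
  trivIset setT F -> (forall k, null (F k)) -> null (\bigcup_k F k).
Proof.
move=> mF tF nF; rewrite /null setI_bigcupr integral_bigcup.
- by apply: eseries0 => k _ _; exact: nF.
- exact: trivIset_setIl.
- by move=> k; exact: measurableI.
- rewrite -setI_bigcupr; apply: (integrableS mD _ _ iu); last by move=> x [].
  by apply: measurableI => //; exact: bigcup_measurable.
Qed.

Let tt (x : mplane) : mplane := apply2 (invmx M) x.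
Let mtt : measurable_fun [set: mplane] tt.
Proof. exact: measurable_apply2. Qed.

Let mtt_preimage A : measurable A -> measurable (tt @^-1` A).
Proof. by move=> mA; rewrite -[X in measurable X]setTI; exact: mtt. Qed.

(** The product of two approximate steps, one in each coordinate, tends to the indicator of the
    quadrant and stays between 0 and 1, so that |u| dominates. *)
Let null_rays (a c : R) : null (tt @^-1` (`]a, +oo[ `*` `]c, +oo[)).
Proof.
have [q [hq q01 qc]] := @real_trig_poly_ray R M (1, 0) (fun x => (tt x).1) a
  (fun x => ltac:(by rewrite /phase /dot2 /= mul1r mul0r addr0)).
have [r [hr r01 rc]] := @real_trig_poly_ray R M (0, 1) (fun x => (tt x).2) c
  (fun x => ltac:(by rewrite /phase /dot2 /= mul1r mul0r add0r)).
set E := tt @^-1` _.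
have mE : measurable E by apply: mtt_preimage; apply: measurableX; exact: measurable_itv.
pose f_ n (x : mplane) := (u x * (q n x * r n x))%:E.
pose f (x : mplane) := (u x * \1_E x)%:E.
have mf_ n : measurable_fun D (f_ n).
  apply/measurable_EFinP/measurable_funM => //.
  have [h _] := measurable_trig_poly (real_trig_polyM (hq n) (hr n)).
  exact: measurable_funS h.
have mf : measurable_fun D f.
  by apply/measurable_EFinP/measurable_funM.
have cf : {ae mu2, forall x, D x -> f_ ^~ x @ \oo --> f x}.
  apply: aeW => x Dx; apply: cvg_EFin; first exact: nearW.
  have [t1 t2] := proj1 (cellP uM x) Dx.
  apply: cvgM; first exact: cvg_cst.
  have -> : \1_E x = (a < (tt x).1)%R%:R * (c < (tt x).2)%R%:R :> R.
    rewrite -natrM mulnb indicE; congr ((nat_of_bool _)%:R); apply/idP/idP.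
      by rewrite inE => -[]; rewrite /= !in_itv /= !andbT => -> ->.
    by move=> /andP[h1 h2]; rewrite inE; split; rewrite /= in_itv /= andbT.
  by apply: cvgM; [exact: qc|exact: rc].
have bf : {ae mu2, forall x n, D x -> (`|f_ n x| <= `|(u x)%:E|)%E}.
  apply: aeW => x n Dx; rewrite /f_ lee_fin normrM ler_piMr//.
  have /andP[q0 q1] := q01 n x; have /andP[r0 r1] := r01 n x.
  by rewrite ger0_norm ?mulr_ge0// mulr_ile1.
have [_ _] := dominated_convergence mD mf_ mf cf (integrable_abse iu) bf.
rewrite (_ : [sequence _]_n = fun=> 0%E); last first.
  by apply/funext => n; apply: u0; exact: real_trig_polyM.
move=> /cvg_lim; rewrite lim_cst// => /(_ (@ereal_hausdorff _)) fz.
rewrite /null integral_mkcondr [RHS]fz; apply: eq_integral => x _.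
by rewrite /f patchE indicE; case: ifP => _; rewrite ?mulr1 ?mulr0.
Qed.

(* On [cell M] the coordinates are nonnegative, so that a ray starting at [-1] is as
   good as the whole line. *)
Let null_setTl (B : set (measurableTypeR R)) :
  null (tt @^-1` (`](-1), +oo[ `*` B)) -> null (tt @^-1` (setT `*` B)).
Proof.
rewrite /null => <-; congr integral; apply/seteqP; split => x [Dx [h1 h2]]; split => //.
split => //; have [/andP[t1 _] _] := proj1 (cellP uM x) Dx.
by rewrite /= in_itv /= andbT; apply: lt_le_trans t1; rewrite ltrN10.
Qed.

Let null_setTr (A : set (measurableTypeR R)) :
  null (tt @^-1` (A `*` `](-1), +oo[)) -> null (tt @^-1` (A `*` setT)).
Proof.
rewrite /null => <-; congr integral; apply/seteqP; split => x [Dx [h1 h2]]; split => //.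
split => //; have [_ /andP[t1 _]] := proj1 (cellP uM x) Dx.
by rewrite /= in_itv /= andbT; apply: lt_le_trans t1; rewrite ltrN10.
Qed.

(** Dynkin's theorem is applied three times: in the first side of a rectangle whose second side is a
    ray, then in the second side, and from rectangles to all measurable sets. The conclusion comes
    from testing on the part of the cell where [u] is nonnegative and on the rest. *)
Lemma trig_poly_orthogonal_eq0 : (\int[mu2]_(x in D) `|(u x)%:E| = 0)%E.
Proof.
have mray c : measurable (`]c, +oo[ : set (measurableTypeR R)) by exact: measurable_itv.
have mX (A B : set (measurableTypeR R)) : measurable A -> measurable B ->
    measurable (tt @^-1` (A `*` B)).
  by move=> mA mB; apply: mtt_preimage; exact: measurableX.
have genE : (@measurable _ (measurableTypeR R)) = <<s @RGenOInfty.G R >>.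
  exact: RGenOInfty.measurableE.
have rayI : setI_closed (@RGenOInfty.G R).
  move=> _ _ [a ->] [b ->]; exists (Num.max a b).
  by apply/seteqP; split => x; rewrite /= !in_itv /= !andbT gt_max;
    [move=> [-> ->]|move=> /andP[]].
have s1 c (A : set (measurableTypeR R)) : measurable A -> null (tt @^-1` (A `*` `]c, +oo[)).
  move=> mA.
  apply: (@dynkin_induction _ (measurableTypeR R) (@RGenOInfty.G R)
    (fun A => null (tt @^-1` (A `*` `]c, +oo[)))) => //.
  - exact/null_setTl/null_rays.
  - by move=> _ [a ->]; exact: null_rays.
  - move=> S mS nS.
    rewrite (_ : tt @^-1` _ = tt @^-1` (setT `*` `]c, +oo[) `\` tt @^-1` (S `*` `]c, +oo[)).
      apply: nullD => //; [exact: mX|exact: mX| |exact/null_setTl/null_rays].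
      by move=> x [h1 h2]; split.
    apply/seteqP; split => x; first by move=> [h1 h2]; split; [split|move=> []].
    by move=> [[_ h2] h1]; split => // Sx; apply: h1; split.
  - move=> F mF tF nF.
    rewrite (_ : tt @^-1` _ = \bigcup_k (tt @^-1` (F k `*` `]c, +oo[))).
      apply: null_bigcup => //; first by move=> k; exact: mX.
      apply/trivIsetP => i j _ _ ij; rewrite -subset0 => x [[h1 _] [h2 _]].
      by have /trivIsetP/(_ i j Logic.I Logic.I ij) := tF; rewrite -subset0 => /(_ (tt x).1); apply.
    apply/seteqP; split => x; first by move=> [[k _ Fk] h2]; exists k.
    by move=> [k _ [Fk h2]]; split => //; exists k.
  - by rewrite -genE.
have s2 (A B : set (measurableTypeR R)) : measurable A -> measurable B ->
    null (tt @^-1` (A `*` B)).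
  move=> mA mB.
  apply: (@dynkin_induction _ (measurableTypeR R) (@RGenOInfty.G R)
    (fun B => null (tt @^-1` (A `*` B)))) => //.
  - exact/null_setTr/s1.
  - by move=> _ [a ->]; exact: s1.
  - move=> S mS nS.
    rewrite (_ : tt @^-1` _ = tt @^-1` (A `*` setT) `\` tt @^-1` (A `*` S)).
      apply: nullD => //; [exact: mX|exact: mX| |exact/null_setTr/s1].
      by move=> x [h1 h2]; split.
    apply/seteqP; split => x; first by move=> [h1 h2]; split; [split|move=> []].
    by move=> [[h2 _] h1]; split => // Sx; apply: h1; split.
  - move=> F mF tF nF.
    rewrite (_ : tt @^-1` _ = \bigcup_k (tt @^-1` (A `*` F k))).
      apply: null_bigcup => //; first by move=> k; exact: mX.
      apply/trivIsetP => i j _ _ ij; rewrite -subset0 => x [[_ h1] [_ h2]].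
      by have /trivIsetP/(_ i j Logic.I Logic.I ij) := tF; rewrite -subset0 => /(_ (tt x).2); apply.
    apply/seteqP; split => x; first by move=> [h2 [k _ Fk]]; exists k.
    by move=> [k _ [h2 Fk]]; split => //; exists k.
  - by rewrite -genE.
have nT : null setT.
  by have := s2 setT setT measurableT measurableT; rewrite setXTT preimage_setT.
have s3 (E : set mplane) : measurable E -> null (tt @^-1` E).
  move=> mE.
  apply: (@dynkin_induction _ mplane
    [set A `*` B | A in (@measurable _ (measurableTypeR R)) & B in (@measurable _ (measurableTypeR R))]
    (fun E => null (tt @^-1` E))) => //.
  - exact: measurable_prod_measurableType.
  - move=> _ _ [A mA [B mB <-]] [A' mA' [B' mB' <-]].
    by exists (A `&` A'); [exact: measurableI|exists (B `&` B'); [exact: measurableI|rewrite setXI]].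
  - by move=> _ [A mA [B mB <-]]; exact: s2.
  - move=> S mS nS; rewrite (_ : tt @^-1` _ = setT `\` (tt @^-1` S)); last by rewrite setTD.
    by apply: nullD nT => //; exact: mtt_preimage.
  - move=> F mF tF nF; rewrite preimage_bigcup; apply: null_bigcup => //.
      by move=> k; exact: mtt_preimage.
    apply/trivIsetP => i j _ _ ij; rewrite -subset0 => x [h1 h2].
    by have /trivIsetP/(_ i j Logic.I Logic.I ij) := tF; rewrite -subset0 => /(_ (tt x)); apply.
  - by rewrite -measurable_prod_measurableType.
(* Back from lattice coordinates to the plane: every set is the inverse image, under the coordinate
   map, of its inverse image by [M]. *)
have nullE (E : set mplane) : measurable E -> null E.
  move=> mE; rewrite (_ : E = tt @^-1` ((fun x : mplane => (apply2 M x : mplane)) @^-1` E)).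
    apply: s3; rewrite -[X in measurable X]setTI; exact: measurable_apply2.
  by apply/seteqP; split => x; rewrite /preimage /mkset /tt apply2KV.
pose E := D `&` [set x | 0 <= u x].
have mE : measurable E.
  have := emeasurable_fun_c_infty mD (proj2 (measurable_EFinP _ _) mu_) 0.
  by congr measurable; apply/seteqP; split => x [Dx]; rewrite /= lee_fin.
have mDE : measurable (D `\` E) by exact: measurableD.
have mabs : measurable_fun D (fun x => `|(u x)%:E|%E).
  by apply: measurableT_comp => //; exact/measurable_EFinP.
have eD : D = E `|` (D `\` E).
  apply/seteqP; split => x; last by move=> [[]|[]].
  by move=> Dx; have [Ex|nEx] := pselect (E x); [left|right].
rewrite eD ge0_integral_setU//; last 2 first.
- by rewrite -eD.
- by apply/disj_setPS => x [Ex [_]].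
have := nullE E mE; rewrite /null (_ : D `&` E = E); last by rewrite /E setIA setIid.
have := nullE (~` E) (measurableC mE); rewrite /null -setDE => n2 n1.
have e1 : (\int[mu2]_(x in E) `|(u x)%:E| = \int[mu2]_(x in E) (u x)%:E)%E.
  by apply: eq_integral => x; rewrite inE => -[_ /= h]; rewrite ger0_norm.
have e2 : (\int[mu2]_(x in D `\` E) `|(u x)%:E|
    = \int[mu2]_(x in D `\` E) - (u x)%:E)%E.
  apply: eq_integral => x; rewrite inE => -[Dx nE]; rewrite lee0_abs// lee_fin leNgt.
  by apply/negP => /ltW h; apply: nE.
rewrite e1 e2 n1 add0e integralN; last first.
  by apply: integrable_add_def => //; apply: (integrableS mD _ _ iu) => // x [].
by rewrite n2 oppe0.
Qed.

End Completeness.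

Section CellCompleteness.
Context {R : realType}.
Local Notation plane := (R * R)%type.
Local Notation mplane := (measurableTypeR R * measurableTypeR R)%type.
Local Notation mu2 := (@mu2 R).
Local Notation C := (R[i]^o).
Variable M : 'M[R]_2.
Hypothesis uM : M \in unitmx.

(** Against a real trigonometric polynomial the real and imaginary parts of the integral separate,
    so each part of [f] is orthogonal to all of these and vanishes almost everywhere. *)
Lemma phase_complete (f : mplane -> C) : in_L2 mu2 (cell M) f ->
  (forall n, cint mu2 (cell M) (fun x => (f x : R[i]) * expi (phase M n x)) = 0) ->
  nrm2 mu2 (cell M) f = 0.
Proof.
move=> Lf f0.
have mD : measurable (cell M : set mplane) by exact: measurable_cell.
have finD := mu2_cell_lty uM.
have ce n : cintegrable mu2 (cell M) (fun x => (f x : R[i]) * expi (phase M n x)).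
  apply: (in_L2_cintegrable mD finD (K := 1)) => //; last first.
    by move=> x _; rewrite normc_expi.
  have [h1 h2] := measurable_trig_poly (trig_poly_monomial M 1 n).
  have -> : (fun x : mplane => expi (phase M n x))
      = (fun x : mplane => (1 : R[i]) * expi (phase M n x)).
    by apply/funext => x; rewrite mul1r.
  by split; [exact: measurable_funS h1|exact: measurable_funS h2].
have fE (p : mplane -> C) : trig_poly M p ->
    cintegrable mu2 (cell M) (fun x => (f x : R[i]) * p x) /\
    cint mu2 (cell M) (fun x => (f x : R[i]) * p x) = 0.
  move=> [s ->].
  have -> : (fun x : mplane => (f x : R[i]) * \sum_(z <- s) (z.1 : R[i]) * expi (phase M z.2 x))
    = (fun x => \sum_(z <- s) (z.1 : R[i]) * ((f x : R[i]) * expi (phase M z.2 x))).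
    by apply/funext => x; rewrite mulr_sumr; apply: eq_bigr => z _; rewrite mulrCA.
  have cz z : cintegrable mu2 (cell M) (fun x : mplane =>
      (z.1 : R[i]) * ((f x : R[i]) * expi (phase M z.2 x))).
    by apply: cintegrableZ.
  split; first exact: cintegrable_sum.
  rewrite cint_sum//; apply: big1 => z _; rewrite cintZ//.
  by rewrite f0 mulr0.
have [i1 i2] : cintegrable mu2 (cell M) f.
  have [h _] := fE _ (trig_poly_cst M 1); move: h.
  by congr cintegrable; apply/funext => x; rewrite mulr1.
have part (p : C -> R) :
    (forall z (a : R), p ((z : R[i]) * a%:C) = p z * a) ->
    mu2.-integrable (cell M) (fun x => (p (f x))%:E) ->
    (forall q, real_trig_poly M q -> mu2.-integrable (cell M) (fun x => (p ((f x : R[i]) * (q x)%:C))%:E) /\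
       \int[mu2]_(x in cell M) p ((f x : R[i]) * (q x)%:C) = 0) ->
    ae_eq mu2 (cell M) (fun x => p (f x)) (fun=> 0).
  move=> pM ip hp.
  have h := @trig_poly_orthogonal_eq0 R M uM (fun x => p (f x)) ip _.
  have : ae_eq mu2 (cell M) (EFin \o (fun x => p (f x))) (cst 0%E).
    apply/(ae_eq_integral_abs mu2 mD); first exact: measurable_int ip.
    apply: h => q hq; have [iq q0] := hp q hq.
    under eq_integral do rewrite -pM.
    by rewrite -[LHS]fineK ?integrable_fin_num//; congr EFin.
  by apply: filterS => x hx Dx; have [] := hx Dx.
have aR : ae_eq mu2 (cell M) (fun x => complex.Re (f x)) (fun=> 0).
  apply: part => //; first by move=> z a; rewrite cReM /= mulr0 subr0.
  by move=> q /fE[[h _] /(congr1 (@complex.Re R))].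
have aI : ae_eq mu2 (cell M) (fun x => complex.Im (f x)) (fun=> 0).
  apply: part => //; first by move=> z a; rewrite cImM /= mulr0 add0r.
  by move=> q /fE[[_ h] /(congr1 (@complex.Im R))].
apply/(nrm2_eq0P mD Lf); apply: filterS2 aR aI => x hR hI Dx.
by apply: complexP; [exact: hR|exact: hI].
Qed.

End CellCompleteness.


(** * Fourier inversion in the plane *)

Section LineIntegrals.
Context {R : realType}.
Local Notation lambda := (@lebesgue_measure R).

(** On the half line [f] agrees with [f0], its version free of absolute values, which has the
    antiderivative [F] on the whole line; evenness doubles the integral. *)
Lemma integral_even (f f0 F : R -> R) (l : R) :
  (forall x, 0 <= f x) -> continuous f -> (forall x, f (- x) = f x) ->
  (forall x, 0 <= x -> f x = f0 x) ->
  (forall x, derivable F x 1 /\ 'D_1 F x = f0 x) -> F x @[x --> +oo] --> l ->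
  (\int[lambda]_x (f x)%:E = (2 * (l - F 0))%:E)%E.
Proof.
move=> fge0 cf fN ff0 dF Fl.
rewrite ge0_symfun_integralT//; last by move=> x /=; rewrite fN.
rewrite (_ : [set x | 0 <= x] = `[0, +oo[%classic); last first.
  by apply/seteqP; split => x; rewrite /= in_itv /= andbT.
have dF' x : derivable F x 1 by case: (dF x).
rewrite (@ge0_continuous_FTC2y _ f F 0 l)//.
- by apply: continuous_subspaceT.
- by apply: cvg_at_right_filter; apply: differentiable_continuous; apply/derivable1_diffP.
- move=> x; rewrite in_itv /= andbT => x0.
  by rewrite derive1E (ff0 _ (ltW x0)); case: (dF x).
Qed.

(** The cosine transform of [laplace e]: it is 2 pi times the Poisson kernel of the half plane,
    hence of total mass 2 pi. *)
Definition cauchy_kernel (e s : R) : R := 2 * e / (e ^+ 2 + s ^+ 2).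

Lemma cauchy_kernel_den (e s : R) : 0 < e -> 0 < e ^+ 2 + s ^+ 2.
Proof. by move=> e0; rewrite ltr_pwDl ?sqr_ge0// exprn_gt0. Qed.

Lemma cauchy_kernel_ge0 (e s : R) : 0 < e -> 0 <= cauchy_kernel e s.
Proof.
by move=> e0; apply: divr_ge0; [rewrite mulr_ge0// ltW|rewrite ltW// cauchy_kernel_den].
Qed.

Lemma continuous_cauchy_kernel (e : R) : 0 < e -> continuous (cauchy_kernel e).
Proof.
move=> e0 x; apply: cvgM; first exact: cvg_cst.
apply: cvgV; first by rewrite gt_eqF// cauchy_kernel_den.
by apply: cvgD; [exact: cvg_cst|exact: exprn_continuous].
Qed.

Lemma integral_cauchy_kernel (e : R) : 0 < e ->
  (\int[lambda]_s (cauchy_kernel e s)%:E = (2 * pi)%:E)%E.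
Proof.
move=> e0.
have e1 : e != 0 by rewrite gt_eqF.
rewrite (@integral_even _ (cauchy_kernel e) (fun s => 2 * atan (s / e)) pi).
- by rewrite mul0r atan0 mulr0 subr0.
- by move=> x; exact: cauchy_kernel_ge0.
- exact: continuous_cauchy_kernel.
- by move=> x; rewrite /cauchy_kernel sqrrN.
- by [].
- move=> x.
  have d1 : is_derive x (1 : R) (fun s : R => s / e) e^-1.
    have := is_deriveM (is_derive_id x (1 : R)) (is_derive_cst e^-1 x (1 : R)).
    by move=> h; apply: is_derive_eq; rewrite scaler0 add0r /GRing.scale /= mulr1.
  have d2 := @is_derive1_comp _ (@atan R) (fun s => s / e) x _ _ (is_derive1_atan (x / e)) d1.
  have [h1 h2] := is_deriveZ 2 d2; split; first exact: h1.
  rewrite h2 /GRing.scale /= /cauchy_kernel; field.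
  by rewrite e1 /= gt_eqF ?cauchy_kernel_den.
- have -> : (pi : R) = 2 * (pi / 2) by field.
  apply: cvgM; first exact: cvg_cst.
  apply: (@cvg_comp _ _ _ (fun s => s / e) (@atan R) _ (pinfty_nbhs R)); last exact: cvgy_atan.
  by apply: gt0_cvgMly; rewrite ?invr_gt0.
Qed.

(** The convergence factor of Abel summation. *)
Definition laplace (e t : R) : R := expR (- (e * `|t|)).

Lemma laplace_gt0 e t : 0 < laplace e t. Proof. exact: expR_gt0. Qed.

Lemma continuous_laplace e : continuous (laplace e).
Proof.
move=> x; apply: continuous_comp; last exact: continuous_expR.
by apply: cvgN; apply: cvgM; [exact: cvg_cst|exact: norm_continuous].
Qed.

Lemma measurable_laplace e : measurable_fun [set: R] (laplace e).
Proof. by apply: continuous_measurable_fun; exact: continuous_laplace. Qed.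

(** Adding 1 to the cosine makes the integrand nonnegative, so that integrability and value come
    together. The case s = 0 gives the integral of [laplace e] alone, to be subtracted later. *)
Lemma integral_laplace1cos (e s : R) : 0 < e ->
  (\int[lambda]_t (laplace e t * (1 + cos (t * s)))%:E
   = (2 / e + cauchy_kernel e s)%:E)%E.
Proof.
move=> e0.
have e1 : e != 0 by rewrite gt_eqF.
have d0 : e ^+ 2 + s ^+ 2 != 0 by rewrite gt_eqF// cauchy_kernel_den.
(* The antiderivative is exp(-e t) b(t), where [b] collects -1/e and the real part of exp(i s t) /
   (i s - e). *)
pose b t := - e^-1 + (s * sin (t * s) - e * cos (t * s)) / (e ^+ 2 + s ^+ 2).
rewrite (@integral_even _ (fun t => expR (- (e * t)) * (1 + cos (t * s)))
  (fun t => expR (- (e * t)) * b t) 0).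
- rewrite mulr0 oppr0 expR0 mul1r /b mul0r sin0 cos0 /cauchy_kernel; congr EFin.
  by field; rewrite d0 e1.
- move=> x; apply: mulr_ge0; first exact: ltW (laplace_gt0 _ _).
  by rewrite -lerBlDl sub0r cos_geN1.
- move=> x; apply: cvgM; first exact: continuous_laplace.
  apply: cvgD; first exact: cvg_cst.
  apply: continuous_comp; last exact: continuous_cos.
  by apply: cvgM; [exact: cvg_id|exact: cvg_cst].
- by move=> x; rewrite /laplace normrN mulNr cosN.
- by move=> x x0; rewrite /laplace ger0_norm.
- move=> x.
  have d1 : is_derive x (1 : R) (fun t : R => t * s) s.
    have := is_deriveM (is_derive_id x (1 : R)) (is_derive_cst s x (1 : R)).
    by move=> h; apply: is_derive_eq; rewrite scaler0 add0r /GRing.scale /= mulr1.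
  have d2 : is_derive x (1 : R) (fun t : R => - (e * t)) (- e).
    have := is_deriveN (is_deriveZ e (is_derive_id x (1 : R))).
    by move=> h; apply: is_derive_eq; rewrite /GRing.scale /= mulr1.
  have dE := @is_derive1_comp _ (@expR R) (fun t => - (e * t)) x _ _
    (is_derive_expR (- (e * x))) d2.
  have dS := @is_derive1_comp _ (@sin R) (fun t => t * s) x _ _
    (is_derive_sin (x * s)) d1.
  have dC := @is_derive1_comp _ (@cos R) (fun t => t * s) x _ _
    (is_derive_cos (x * s)) d1.
  have dB := is_deriveD (is_derive_cst (- e^-1) x (1 : R))
    (is_deriveZ (e ^+ 2 + s ^+ 2)^-1 (is_deriveB (is_deriveZ s dS) (is_deriveZ e dC))).
  have [] := is_deriveM dE dB.
  rewrite (_ : (_ : R -> R) * _ = (fun t => expR (- (e * t)) * b t)); last first.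
    apply/funext => t; rewrite -[LHS]/(expR (- (e * t)) * (- e^-1
      + (e ^+ 2 + s ^+ 2)^-1 * (s * sin (t * s) - e * cos (t * s)))).
    by rewrite /b [_ / (e ^+ 2 + _)]mulrC.
  move=> h1 h2; split=> //; rewrite h2 /GRing.scale /=.
  rewrite -[(cst _ + _) x]/(- e^-1
    + (e ^+ 2 + s ^+ 2)^-1 * (s * sin (x * s) - e * cos (x * s))).
  by field; rewrite d0 e1.
- have [B0 bB] : exists B, forall t, `|b t| <= B.
    exists (`|- e^-1| + (`|s| + `|e|) / (e ^+ 2 + s ^+ 2)) => t.
    rewrite (le_trans (ler_normD _ _))// lerD2l normrM.
    have i0 : 0 <= (e ^+ 2 + s ^+ 2)^-1 by rewrite invr_ge0 ltW// cauchy_kernel_den.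
    rewrite (ger0_norm i0); apply: ler_wpM2r => //.
    rewrite (le_trans (ler_normB _ _))// !normrM.
    by apply: lerD; apply: ler_piMr => //; [exact: sin_max|exact: cos_max].
  have cE : expR (- (e * x)) @[x --> +oo] --> (0 : R).
    apply: (@cvg_comp _ _ _ (fun z => e * z) (fun z => expR (- z)) _ (pinfty_nbhs R)).
      exact: gt0_cvgMry.
    exact: cvgr_expR.
  apply/norm_cvg0P.
  apply: (@squeeze_cvgr _ _ _ _ (fun=> 0) (fun x => expR (- (e * x)) * B0)).
  - apply: nearW => x; rewrite normr_ge0 /= normrM ger0_norm ?expR_ge0//.
    by apply: ler_wpM2l; rewrite ?expR_ge0.
  - exact: cvg_cst.
  - by rewrite -(mul0r B0); apply: cvgM => //; exact: cvg_cst.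
Qed.

Lemma continuous_cosM (s : R) : continuous (fun t : R => cos (t * s)).
Proof.
move=> x; apply: continuous_comp; last exact: continuous_cos.
by apply: cvgM; [exact: cvg_id|exact: cvg_cst].
Qed.

Lemma integrable_laplace (e : R) : 0 < e -> lambda.-integrable setT (EFin \o laplace e).
Proof.
move=> e0; have ml := @measurable_laplace e.
apply/integrableP; split; first exact/measurable_EFinP.
apply: (@le_lt_trans _ _ (\int[lambda]_t (laplace e t * (1 + cos (t * 0)))%:E)%E).
  apply: ge0_le_integral => //.
  - by apply: measurableT_comp => //; exact/measurable_EFinP.
  - apply/measurable_EFinP/measurable_funM => //.
    apply: measurable_funD; first exact: measurable_cst.
    by apply: continuous_measurable_fun; exact: continuous_cosM.
  - move=> t _; rewrite mulr0 cos0 /= lee_fin ger0_norm; last exact: ltW (laplace_gt0 _ _).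
    by rewrite mulrDr mulr1 lerDl ltW// laplace_gt0.
by rewrite integral_laplace1cos// ltry.
Qed.

Lemma integrable_laplaceM (e : R) (c : R -> R) : 0 < e ->
  measurable_fun setT c -> (forall t, `|c t| <= 1) ->
  lambda.-integrable setT (EFin \o (fun t => laplace e t * c t)).
Proof.
move=> e0 mc c1; apply: le_integrable (integrable_laplace e0) => //.
  by apply/measurable_EFinP/measurable_funM => //; exact: measurable_laplace.
move=> t _ /=; rewrite lee_fin normrM; apply: ler_piMr => //; exact: c1.
Qed.

Lemma measurable_cosM (s : R) : measurable_fun [set: R] (fun t : R => cos (t * s)).
Proof. by apply: continuous_measurable_fun; exact: continuous_cosM. Qed.

Lemma measurable_sinM (s : R) : measurable_fun [set: R] (fun t : R => sin (t * s)).
Proof.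
apply: continuous_measurable_fun => x.
apply: continuous_comp; last exact: continuous_sin.
by apply: cvgM; [exact: cvg_id|exact: cvg_cst].
Qed.

Lemma Rintegral_laplace (e : R) : 0 < e ->
  \int[lambda]_t laplace e t = 2 / e.
Proof.
move=> e0; have := congr1 fine (integral_laplace1cos 0 e0).
rewrite -/(Rintegral _ _ _) /= => h.
have il := integrable_laplace e0.
have : \int[lambda]_t (laplace e t * (1 + cos (t * 0))) = 2 * \int[lambda]_t laplace e t.
  rewrite -RintegralZl//; apply: eq_Rintegral => t _.
  by rewrite mulr0 cos0 mulrC.
rewrite h => h2; apply: (mulfI (_ : 2 != 0 :> R)) => //.
by rewrite -h2 /cauchy_kernel; field; rewrite gt_eqF.
Qed.

Lemma Rintegral_laplace_cos (e s : R) : 0 < e ->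
  \int[lambda]_t (laplace e t * cos (t * s)) = cauchy_kernel e s.
Proof.
move=> e0; have := congr1 fine (integral_laplace1cos s e0).
rewrite -/(Rintegral _ _ _) /= => h.
have il := integrable_laplace e0.
have ic := integrable_laplaceM e0 (measurable_cosM s) (fun t => cos_max (t * s)).
apply: (addrI (2 / e)); rewrite -h -(Rintegral_laplace e0) -RintegralD//.
by apply: eq_Rintegral => t _; rewrite mulrDr mulr1.
Qed.

Lemma Rintegral_laplace_sin (e s : R) : 0 < e ->
  \int[lambda]_t (laplace e t * sin (t * s)) = 0.
Proof.
move=> e0.
have is_ := integrable_laplaceM e0 (measurable_sinM s) (fun t => sin_max (t * s)).
have mN : measurable_fun [set: R] (-%R : R -> R) by [].
have e1 : \int[lambda]_t (laplace e t * sin (t * s))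
    = - \int[lambda]_t (laplace e t * sin (t * s)).
  rewrite -[RHS]mulN1r -RintegralZl// /Rintegral; congr fine.
  have := @integral_preserving _ (measurableTypeR R) R lambda (fun t : measurableTypeR R => - t)
    mN (@lebesgue_measureN R) setT (EFin \o (fun t => laplace e t * sin (t * s)))
    measurableT (measurable_int _ is_).
  rewrite preimage_setT /= => ->; apply: eq_integral => t _.
  by rewrite /laplace normrN mulNr sinN mulrN mulN1r.
by apply/eqP; rewrite -[_ == 0](mulrn_eq0 _ 2) /= mulr2n {2}e1 subrr.
Qed.

Lemma integrable_cauchy_kernel (e : R) : 0 < e ->
  lambda.-integrable setT (EFin \o cauchy_kernel e).
Proof.
move=> e0; apply/integrableP; split.
  apply/measurable_EFinP; apply: continuous_measurable_fun.
  exact: continuous_cauchy_kernel.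
under eq_integral do rewrite /= ger0_norm ?cauchy_kernel_ge0//.
by rewrite integral_cauchy_kernel// ltry.
Qed.

Lemma Rintegral_cauchy_kernel (e : R) : 0 < e ->
  \int[lambda]_s cauchy_kernel e s = 2 * pi.
Proof. by move=> e0; rewrite /Rintegral integral_cauchy_kernel. Qed.

(** Away from the origin the kernel is of order [e] relative to one fixed integrable kernel: 2 e /
    s^2 = e (s^-2 + 1) 2 / (1 + s^2). *)
Lemma cauchy_kernel_tail (e delta s : R) : 0 < e -> 0 < delta -> delta <= `|s| ->
  cauchy_kernel e s <= e * (1 + delta ^- 2) * cauchy_kernel 1 s.
Proof.
move=> e0 d0 ds.
have s2 : delta ^+ 2 <= s ^+ 2 by rewrite -[s ^+ 2]real_normK ?num_real// lerXn2r ?nnegrE// ltW.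
have dd : 0 < delta ^+ 2 by rewrite exprn_gt0.
have s0 : 0 < s ^+ 2 := lt_le_trans dd s2.
rewrite /cauchy_kernel expr1n mulr1.
apply: (@le_trans _ _ (2 * e / s ^+ 2)).
  apply: ler_wpM2l; first by rewrite mulr_ge0// ltW.
  by rewrite lef_pV2 ?posrE ?cauchy_kernel_den// lerDr sqr_ge0.
have -> : 2 * e / s ^+ 2 = e * ((s ^+ 2)^-1 + 1) * (2 / (1 + s ^+ 2)).
  have s1 : s != 0 by rewrite -sqrf_eq0 gt_eqF.
  have s3 : 1 + s ^+ 2 != 0 by rewrite gt_eqF// ltr_pwDl// ltW.
  by field; rewrite s1 s3.
apply: ler_wpM2r; first by rewrite divr_ge0// addr_ge0// ltW.
apply: ler_wpM2l; first exact: ltW.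
by rewrite addrC lerD2l lef_pV2.
Qed.

End LineIntegrals.

(** * Product kernels in the plane and Fubini's theorem *)

Section PlaneKernel.
Context {R : realType}.
Local Notation plane := (R * R)%type.
Local Notation mplane := (measurableTypeR R * measurableTypeR R)%type.
Local Notation lambda := (@lebesgue_measure R).
Local Notation mu2 := (@mu2 R).

Lemma sigma_finite_mu2 : sigma_finite [set: mplane] mu2.
Proof.
exists (fun n => `[- n%:R, n%:R] `*` `[- n%:R, n%:R]).
  apply/seteqP; split => // x _; pose n := Num.bound (`|x.1| + `|x.2|).
  have h : `|x.1| + `|x.2| < n%:R.
    by have := archi_boundP (_ : 0 <= `|x.1| + `|x.2|); apply; rewrite addr_ge0.
  by exists n => //; split; rewrite /= in_itv /= -ler_norml (le_trans _ (ltW h))// (lerDl, lerDr).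
move=> n; split; first by apply: measurableX; exact: measurable_itv.
rewrite mu2X; try exact: measurable_itv.
rewrite !lebesgue_measure_itv /=.
by case: ifP => _; rewrite -?EFinB -?EFinM ?mul0e ltry.
Qed.

(* [mu2] carries no sigma-finite structure, which Fubini's theorem needs. *)
Definition lebesgue2 : set mplane -> \bar R := (lambda \x lambda)%E.
HB.instance Definition _ := Measure.copy lebesgue2 (lambda \x lambda)%E.
HB.instance Definition _ := @Measure_isSigmaFinite.Build _ mplane R lebesgue2 sigma_finite_mu2.

Let smu2 : {sigma_finite_measure set mplane -> \bar R} := lebesgue2.

Lemma integrable_tensor (a b : R -> R) :
  lambda.-integrable setT (EFin \o a) -> lambda.-integrable setT (EFin \o b) ->
  mu2.-integrable setT (fun x : mplane => (a x.1 * b x.2)%:E).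
Proof.
move=> ia ib.
have /measurable_EFinP ma := measurable_int _ ia.
have /measurable_EFinP mb := measurable_int _ ib.
have mf : measurable_fun [set: mplane] (fun x : mplane => (a x.1 * b x.2)%:E).
  apply/measurable_EFinP/measurable_funM.
    exact: measurableT_comp ma measurable_fst.
  exact: measurableT_comp mb measurable_snd.
apply/(@integrable12ltyP _ _ _ _ R lambda lambda _ mf).
have /integrableP[_ ia'] := ia; have /integrableP[_ ib'] := ib.
have bE : (\int[lambda]_y `|(EFin \o b) y| \is a fin_num)%E.
  by rewrite ge0_fin_numE// integral_ge0.
under eq_integral => x _.
  under eq_integral do rewrite /= normrM EFinM.
  rewrite ge0_integralZl_EFin//; last first.
    by apply/measurable_EFinP; exact: measurableT_comp.
  rewrite muleC; over.
rewrite /= ge0_integralZl//=.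
- apply: lte_mul_pinfty => //; exact: integral_ge0.
- by apply/measurable_EFinP; exact: measurableT_comp.
- exact: integral_ge0.
Qed.

Lemma Rintegral_tensor (a b : R -> R) :
  lambda.-integrable setT (EFin \o a) -> lambda.-integrable setT (EFin \o b) ->
  \int[mu2]_x (a x.1 * b x.2) = (\int[lambda]_s a s) * (\int[lambda]_s b s).
Proof.
move=> ia ib; have it := integrable_tensor ia ib.
have := @integral12_prod_meas1 _ _ _ _ R lambda lambda _ it.
rewrite /fubini_F /=.
under eq_integral => x _.
  rewrite (_ : (fun y => _) = (fun y => (a x)%:E * (b y)%:E)%E); last first.
    by apply/funext => y; rewrite EFinM.
  rewrite integralZl// -(fineK (integrable_fin_num measurableT ib)) muleC; over.
rewrite /= integralZl// -(fineK (integrable_fin_num measurableT ia)) => h.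
by rewrite mulrC; exact: (esym (congr1 fine h)).
Qed.

Definition laplace2 (e : R) (x : plane) : R := laplace e x.1 * laplace e x.2.

Lemma laplace2_gt0 e x : 0 < laplace2 e x.
Proof. by rewrite mulr_gt0 ?laplace_gt0. Qed.

Lemma integrable_laplace2 e : 0 < e ->
  mu2.-integrable setT (fun x : mplane => (laplace2 e x)%:E).
Proof. by move=> e0; apply: integrable_tensor; exact: integrable_laplace. Qed.

Lemma measurable_laplace2 e : measurable_fun [set: mplane] (laplace2 e : mplane -> R).
Proof.
apply: measurable_funM.
  exact: measurableT_comp (@measurable_laplace R e) measurable_fst.
exact: measurableT_comp (@measurable_laplace R e) measurable_snd.
Qed.

Lemma Rintegral_laplace2_cos (e : R) (x : plane) : 0 < e ->
  \int[mu2]_xi (laplace2 e xi * cos (dot2 xi x))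
  = cauchy_kernel e x.1 * cauchy_kernel e x.2.
Proof.
move=> e0.
have ic s := integrable_laplaceM e0 (measurable_cosM s) (fun t => cos_max (t * s)).
have is_ s := integrable_laplaceM e0 (measurable_sinM s) (fun t => sin_max (t * s)).
transitivity (\int[mu2]_xi (
   (laplace e xi.1 * cos (xi.1 * x.1)) * (laplace e xi.2 * cos (xi.2 * x.2))
   - (laplace e xi.1 * sin (xi.1 * x.1)) * (laplace e xi.2 * sin (xi.2 * x.2)))).
  by apply: eq_Rintegral => xi _; rewrite /laplace2 /dot2 cosD; ring.
rewrite RintegralB//; [|exact: (integrable_tensor (ic _) (ic _))|exact: (integrable_tensor (is_ _) (is_ _))].
rewrite (Rintegral_tensor (ic _) (ic _)) (Rintegral_tensor (is_ _) (is_ _)).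
by rewrite !Rintegral_laplace_cos// !Rintegral_laplace_sin// mulr0 subr0.
Qed.

Lemma Rintegral_laplace2_sin (e : R) (x : plane) : 0 < e ->
  \int[mu2]_xi (laplace2 e xi * sin (dot2 xi x)) = 0.
Proof.
move=> e0.
have ic s := integrable_laplaceM e0 (measurable_cosM s) (fun t => cos_max (t * s)).
have is_ s := integrable_laplaceM e0 (measurable_sinM s) (fun t => sin_max (t * s)).
transitivity (\int[mu2]_xi (
   (laplace e xi.1 * sin (xi.1 * x.1)) * (laplace e xi.2 * cos (xi.2 * x.2))
   + (laplace e xi.1 * cos (xi.1 * x.1)) * (laplace e xi.2 * sin (xi.2 * x.2)))).
  by apply: eq_Rintegral => xi _; rewrite /laplace2 /dot2 sinD; ring.
rewrite RintegralD//; [|exact: (integrable_tensor (is_ _) (ic _))|exact: (integrable_tensor (ic _) (is_ _))].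
rewrite (Rintegral_tensor (is_ _) (ic _)) (Rintegral_tensor (ic _) (is_ _)).
by rewrite !Rintegral_laplace_cos// !Rintegral_laplace_sin// mul0r mulr0 addr0.
Qed.

Section FubiniDot.
(** Here [c] stands for the cosine or the sine. *)
Variables (u : mplane -> R) (c : R -> R).
Hypothesis iu : mu2.-integrable setT (EFin \o u).
Hypothesis mc : measurable_fun setT c.
Hypothesis c1 : forall t, `|c t| <= 1.

Let measurable_dot : measurable_fun [set: mplane * mplane]
  (fun z : mplane * mplane => c (dot2 z.1 z.2)).
Proof.
apply: (measurableT_comp mc).
have m1 : measurable_fun [set: mplane * mplane] (fun z : mplane * mplane => z.1.1 : R).
  exact: measurableT_comp measurable_fst measurable_fst.
have m2 : measurable_fun [set: mplane * mplane] (fun z : mplane * mplane => z.1.2 : R).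
  exact: measurableT_comp measurable_snd measurable_fst.
have m3 : measurable_fun [set: mplane * mplane] (fun z : mplane * mplane => z.2.1 : R).
  exact: measurableT_comp measurable_fst measurable_snd.
have m4 : measurable_fun [set: mplane * mplane] (fun z : mplane * mplane => z.2.2 : R).
  exact: measurableT_comp measurable_snd measurable_snd.
exact: measurable_funD (measurable_funM m1 m3) (measurable_funM m2 m4).
Qed.

Let mu_ : measurable_fun [set: mplane] u.
Proof. by move/measurable_int : iu => /measurable_EFinP. Qed.

Lemma integrable_dot (xi : mplane) :
  mu2.-integrable setT (fun x => (u x * c (dot2 xi x))%:E).
Proof.
apply: le_integrable iu => //.
  apply/measurable_EFinP/measurable_funM => //.
  exact: (measurableT_comp measurable_dot (pair1_measurable xi)).
move=> x _ /=; rewrite lee_fin normrM; apply: ler_piMr => //; exact: c1.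
Qed.

Variable e : R.
Hypothesis e0 : 0 < e.

Let k := laplace2 e.

Let integrable_kdot (x : mplane) :
  mu2.-integrable setT (fun xi => (k xi * c (dot2 xi x))%:E).
Proof.
apply: le_integrable (integrable_laplace2 e0) => //.
  apply/measurable_EFinP/measurable_funM; first exact: measurable_laplace2.
  exact: (measurableT_comp measurable_dot (pair2_measurable x)).
move=> xi _ /=; rewrite lee_fin normrM; apply: ler_piMr => //; exact: c1.
Qed.

Let f (z : mplane * mplane) : \bar R := (k z.1 * (u z.2 * c (dot2 z.1 z.2)))%:E.

(** The convergence factor makes the double integral absolutely convergent: it is at most the
    integral of [k] times that of |u|. *)
Let integrable_f : (smu2 \x smu2)%E.-integrable setT f.
Proof.
have mk : measurable_fun [set: mplane] (k : mplane -> R) by exact: measurable_laplace2.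
have mf : measurable_fun [set: mplane * mplane] f.
  apply/measurable_EFinP/measurable_funM.
    exact: measurableT_comp mk measurable_fst.
  apply: measurable_funM => //; exact: measurableT_comp mu_ measurable_snd.
apply/(@integrable12ltyP _ _ _ _ R smu2 smu2 _ mf).
have /integrableP[_ iu'] := iu.
have /integrableP[_ ik'] := integrable_laplace2 e0.
have mau : measurable_fun [set: mplane] (fun x => `|u x|%:E).
  by apply/measurable_EFinP; exact: measurableT_comp.
apply: (@le_lt_trans _ _ (\int[smu2]_xi ((k xi)%:E * \int[smu2]_x `|u x|%:E))%E).
  apply: ge0_le_integral => //.
  - by move=> xi _; exact: integral_ge0.
  - apply: (@measurable_fun_fubini_tonelli_F _ _ _ _ R smu2 (abse \o f)) => //.
      exact: measurableT_comp.
    by move=> z; exact: abse_ge0.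
  - by apply: emeasurable_funM => //; exact/measurable_EFinP.
  move=> xi _; rewrite -ge0_integralZl_EFin ?(ltW (laplace2_gt0 _ _))//.
  apply: ge0_le_integral => //.
  - apply: measurableT_comp => //.
    exact: (measurableT_comp mf (pair1_measurable xi)).
  - exact: measurable_funeM.
  move=> x _; rewrite -EFinM lee_fin normrM ger0_norm ?(ltW (laplace2_gt0 _ _))//.
  apply: ler_wpM2l; first exact: ltW (laplace2_gt0 _ _).
  by rewrite normrM; apply: ler_piMr.
rewrite ge0_integralZr//; last 3 first.
- exact/measurable_EFinP.
- by move=> xi _; rewrite lee_fin ltW// laplace2_gt0.
- exact: integral_ge0.
apply: lte_mul_pinfty.
- by apply: integral_ge0 => xi _; rewrite lee_fin ltW// laplace2_gt0.
- rewrite ge0_fin_numE; last by apply: integral_ge0 => xi _; rewrite lee_fin ltW// laplace2_gt0.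
  apply: le_lt_trans ik'; rewrite le_eqVlt; apply/orP; left; apply/eqP.
  by apply: eq_integral => xi _; rewrite /= ger0_norm// ltW// laplace2_gt0.
- exact: iu'.
Qed.

Let F xi := \int[mu2]_x (u x * c (dot2 xi x)).

Let fubini_FE xi : fubini_F smu2 f xi = (k xi * F xi)%:E.
Proof.
rewrite /fubini_F /f /=.
rewrite (_ : (fun y => _) = (fun y => (k xi)%:E * (u y * c (dot2 xi y))%:E)%E); last first.
  by apply/funext => y; rewrite EFinM.
rewrite (integralZl measurableT (integrable_dot xi)).
by rewrite -(fineK (integrable_fin_num measurableT (integrable_dot xi))).
Qed.

Let fubini_GE x : fubini_G smu2 f x = (u x * \int[mu2]_xi (k xi * c (dot2 xi x)))%:E.
Proof.
rewrite /fubini_G /f /=.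
rewrite (_ : (fun y => _) = (fun y => (u x)%:E * (k y * c (dot2 y x))%:E)%E); last first.
  by apply/funext => y; rewrite -EFinM; congr EFin; ring.
rewrite (integralZl measurableT (integrable_kdot x)).
by rewrite -(fineK (integrable_fin_num measurableT (integrable_kdot x))).
Qed.

Lemma integrable_laplace2_transform : mu2.-integrable setT
  (fun xi : mplane => (laplace2 e xi * \int[mu2]_x (u x * c (dot2 xi x)))%:E).
Proof.
have := integrable_fubini_F integrable_f.
by rewrite (_ : fubini_F smu2 f = fun xi => (k xi * F xi)%:E)//; apply/funext => xi.
Qed.

(** Fubini's theorem gives the measurability of the transform multiplied by [laplace2 e]; dividing
    by this positive factor removes it. *)
Lemma measurable_dot_transform : measurable_fun [set: mplane]
  (fun xi : mplane => \int[mu2]_x (u x * c (dot2 xi x))).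
Proof.
have /measurable_int/measurable_EFinP mkF := integrable_laplace2_transform.
have mV : measurable_fun [set: mplane] (fun xi : mplane => (laplace2 e xi)^-1).
  have -> : (fun xi : mplane => (laplace2 e xi)^-1)
      = (fun xi : mplane => expR (e * `|xi.1| + e * `|xi.2|)).
    apply/funext => xi; rewrite /laplace2 /laplace -expRD -opprD -expRN opprK//.
  apply: measurableT_comp; first exact: measurable_expR.
  apply: measurable_funD; apply: measurable_funM; try exact: measurable_cst.
    exact: measurableT_comp measurable_fst.
  exact: measurableT_comp measurable_snd.
have := measurable_funM mV mkF; congr (measurable_fun _ _).
by apply/funext => xi; rewrite /= mulrA mulVf ?mul1r// gt_eqF// laplace2_gt0.
Qed.

(** The exchange of integrals moves the convergence factor from the transform of [u] to the
    oscillating factor alone, where the integral is explicit. *)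
Lemma Rintegral_laplace2_transform :
  \int[mu2]_xi (laplace2 e xi * \int[mu2]_x (u x * c (dot2 xi x)))
  = \int[mu2]_x (u x * \int[mu2]_xi (laplace2 e xi * c (dot2 xi x))).
Proof.
rewrite /Rintegral; congr fine.
transitivity (\int[smu2]_xi fubini_F smu2 f xi)%E.
  by apply: eq_integral => xi _; rewrite fubini_FE.
transitivity (\int[smu2]_x fubini_G smu2 f x)%E; first exact: Fubini integrable_f.
by apply: eq_integral => x _; rewrite fubini_GE.
Qed.

End FubiniDot.

Lemma integrable_prod_cauchy (e e' : R) : 0 < e -> 0 < e' ->
  mu2.-integrable setT (fun x : mplane => (cauchy_kernel e x.1 * cauchy_kernel e' x.2)%:E).
Proof. by move=> e0 e0'; apply: integrable_tensor; exact: integrable_cauchy_kernel. Qed.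

Lemma Rintegral_prod_cauchy (e e' : R) : 0 < e -> 0 < e' ->
  \int[mu2]_x (cauchy_kernel e x.1 * cauchy_kernel e' x.2) = (2 * pi) ^+ 2.
Proof.
move=> e0 e0'; rewrite Rintegral_tensor; try exact: integrable_cauchy_kernel.
by rewrite !Rintegral_cauchy_kernel.
Qed.

(** The kernels form an approximate identity. Near the origin the oscillation of [u] is at most
    [eta]; elsewhere some coordinate is at least [delta] in modulus, and the kernel in that
    coordinate is at most a multiple of [e] times the fixed kernel of parameter 1. *)
Lemma cvg_prod_cauchy (u : mplane -> R) (B : R) :
  measurable_fun [set: mplane] u -> (forall x, `|u x| <= B) ->
  (forall eta : R, 0 < eta -> exists2 delta : R, 0 < delta &
     forall x, `|x.1| < delta -> `|x.2| < delta -> `|u x - u 0| <= eta) ->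
  \int[mu2]_x (u x * (cauchy_kernel n.+1%:R^-1 x.1 * cauchy_kernel n.+1%:R^-1 x.2))
    @[n --> \oo] --> ((2 * pi) ^+ 2 * u 0 : R).
Proof.
move=> mu_ uB cu.
have B0 : 0 <= B := le_trans (normr_ge0 _) (uB 0).
have iK e : 0 < e -> mu2.-integrable setT
    (EFin \o (fun x : mplane => cauchy_kernel e x.1 * cauchy_kernel e x.2)).
  by move=> e0; exact: integrable_prod_cauchy.
have K0 e (x : mplane) : 0 < e -> 0 <= cauchy_kernel e x.1 * cauchy_kernel e x.2.
  by move=> e0; rewrite mulr_ge0 ?cauchy_kernel_ge0.
have iu e (v : mplane -> R) (b : R) : 0 < e -> measurable_fun [set: mplane] v ->
    (forall x, `|v x| <= b) -> mu2.-integrable setT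
    (EFin \o (fun x : mplane => v x * (cauchy_kernel e x.1 * cauchy_kernel e x.2))).
  move=> e0 mv vb; have b0 : 0 <= b := le_trans (normr_ge0 _) (vb 0).
  have iKb := integrableZl measurableT b (iK e e0).
  apply: le_integrable iKb => //.
    apply/measurable_EFinP/measurable_funM => //.
    by apply/measurable_EFinP; exact: measurable_int (iK e e0).
  move=> x _ /=; rewrite lee_fin !normrM (ger0_norm b0).
  by apply: ler_wpM2r => //; rewrite mulr_ge0.
apply/cvgrPdist_le => eps eps0.
have pi0 : 0 < (2 * pi) ^+ 2 :> R by rewrite exprn_gt0// mulr_gt0// pi_gt0.
(* The kernels have total mass (2 pi)^2, so the near term integrates to eps / 2. *)
pose eta := eps / 2 / (2 * pi) ^+ 2.
have eta0 : 0 < eta by rewrite !divr_gt0.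
have [delta d0 hd] := cu eta eta0.
(* The two far terms together integrate to [e * A]. *)
pose A := 4 * B * (1 + delta ^- 2) * (2 * pi) ^+ 2.
have A0 : 0 <= A.
  apply: mulr_ge0; last exact: ltW.
  apply: mulr_ge0; first exact: mulr_ge0.
  by apply: addr_ge0 => //; rewrite invr_ge0 exprn_ge0// ltW.
have e2 : 0 < eps / 2 / (A + 1) by rewrite !divr_gt0// ltr_wpDl.
have /cvgrPdist_le/(_ _ e2)[N _ hN] := @cvg_harmonic R.
exists N => // n /hN; rewrite sub0r normrN /= ger0_norm ?invr_ge0//.
set e := n.+1%:R^-1 => he.
have e0 : 0 < e by rewrite invr_gt0.
rewrite -(Rintegral_prod_cauchy e0 e0) mulrC -RintegralZl//; last exact: iK.
have iu0 := iu e (fun=> u 0) B e0 (measurable_cst _) (fun=> uB 0).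
have iux := iu e u B e0 mu_ uB.
rewrite -RintegralB//.
have iM (a b : R) : 0 < a -> 0 < b -> mu2.-integrable setT (EFin \o
    (fun x : mplane => 2 * B * (e * (1 + delta ^- 2)) * (cauchy_kernel a x.1 * cauchy_kernel b x.2))).
  move=> a0 b0; have := integrableZl measurableT (2 * B * (e * (1 + delta ^- 2)))
    (integrable_prod_cauchy a0 b0).
  by congr (_.-integrable _ _); apply/funext => x /=; rewrite EFinM.
have iE : mu2.-integrable setT (EFin \o (fun x : mplane =>
    eta * (cauchy_kernel e x.1 * cauchy_kernel e x.2))).
  have := integrableZl measurableT eta (iK e e0).
  by congr (_.-integrable _ _); apply/funext => x /=; rewrite EFinM.
have l01 : 0 < 1 :> R by [].
have pw (x : mplane) : `|u 0 * (cauchy_kernel e x.1 * cauchy_kernel e x.2)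
    - u x * (cauchy_kernel e x.1 * cauchy_kernel e x.2)|
  <= eta * (cauchy_kernel e x.1 * cauchy_kernel e x.2)
   + (2 * B * (e * (1 + delta ^- 2)) * (cauchy_kernel 1 x.1 * cauchy_kernel e x.2)
    + 2 * B * (e * (1 + delta ^- 2)) * (cauchy_kernel e x.1 * cauchy_kernel 1 x.2)).
  rewrite -mulrBl normrM (ger0_norm (K0 e x e0)).
  have k1 a s : 0 < a -> 0 <= cauchy_kernel a s :> R by exact: cauchy_kernel_ge0.
  have E0 : 0 <= e * (1 + delta ^- 2).
    by rewrite mulr_ge0 ?(ltW e0)// addr_ge0// invr_ge0 exprn_ge0// ltW.
  have B2 : `|u 0 - u x| <= 2 * B.
    by rewrite (le_trans (ler_normB _ _))// mulr2n mulrDl mul1r lerD.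
  have BE : 0 <= 2 * B * (e * (1 + delta ^- 2)) by apply: mulr_ge0 => //; exact: mulr_ge0.
  have t1 : 0 <= eta * (cauchy_kernel e x.1 * cauchy_kernel e x.2).
    by rewrite mulr_ge0 ?K0// ltW.
  have t2 : 0 <= 2 * B * (e * (1 + delta ^- 2)) * (cauchy_kernel 1 x.1 * cauchy_kernel e x.2).
    by apply: mulr_ge0 => //; apply: mulr_ge0; exact: k1.
  have t3 : 0 <= 2 * B * (e * (1 + delta ^- 2)) * (cauchy_kernel e x.1 * cauchy_kernel 1 x.2).
    by apply: mulr_ge0 => //; apply: mulr_ge0; exact: k1.
  have [x1|x1] := ltP `|x.1| delta; last first.
    apply: (@le_trans _ _ (2 * B * (e * (1 + delta ^- 2)) * (cauchy_kernel 1 x.1 * cauchy_kernel e x.2))); last lra.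
    rewrite -[leRHS]mulrA; apply: ler_pM => //; first exact: K0.
    by rewrite [leRHS]mulrA; apply: ler_wpM2r; [exact: k1|exact: cauchy_kernel_tail].
  have [x2|x2] := ltP `|x.2| delta; last first.
    apply: (@le_trans _ _ (2 * B * (e * (1 + delta ^- 2)) * (cauchy_kernel e x.1 * cauchy_kernel 1 x.2))); last lra.
    rewrite -[leRHS]mulrA; apply: ler_pM => //; first exact: K0.
    by rewrite [leRHS]mulrCA; apply: ler_wpM2l; [exact: k1|exact: cauchy_kernel_tail].
  apply: (@le_trans _ _ (eta * (cauchy_kernel e x.1 * cauchy_kernel e x.2))); last lra.
  by apply: ler_wpM2r; [exact: K0|rewrite distrC; exact: hd].
apply: le_trans (le_normr_Rintegral _ _) _ => //.
  exact: (integrableB measurableT iu0 iux).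
apply: (@le_trans _ _ (\int[mu2]_x (eta * (cauchy_kernel e x.1 * cauchy_kernel e x.2)
   + (2 * B * (e * (1 + delta ^- 2)) * (cauchy_kernel 1 x.1 * cauchy_kernel e x.2)
    + 2 * B * (e * (1 + delta ^- 2)) * (cauchy_kernel e x.1 * cauchy_kernel 1 x.2))))).
  apply: le_Rintegral => //.
  - apply: integrable_norm; exact: (integrableB measurableT iu0 iux).
  - exact: (integrableD measurableT iE (integrableD measurableT (iM 1 e l01 e0) (iM e 1 e0 l01))).
rewrite RintegralD//; last exact: (integrableD measurableT (iM 1 e l01 e0) (iM e 1 e0 l01)).
rewrite RintegralD//; [|exact: iM|exact: iM].
rewrite !RintegralZl//; try exact: integrable_prod_cauchy.
rewrite !Rintegral_prod_cauchy//.
have -> : eta * (2 * pi) ^+ 2 = eps / 2 by rewrite /eta divfK// gt_eqF.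
have -> : 2 * B * (e * (1 + delta ^- 2)) * (2 * pi) ^+ 2
    + 2 * B * (e * (1 + delta ^- 2)) * (2 * pi) ^+ 2 = e * A.
  by rewrite /A; ring.
have : e * A <= eps / 2.
  apply: le_trans (ler_wpM2r A0 he) _; rewrite mulrAC -mulrA ler_piMr ?divr_ge0 ?(ltW eps0)//.
  by rewrite ler_pdivrMr ?mul1r ?lerDl// ltr_wpDl.
lra.
Qed.

End PlaneKernel.


(** * Measurability of continuous functions on the plane *)

Section PlaneContinuity.
Context {R : realType}.
Local Notation plane := (R * R)%type.
Local Notation mplane := (measurableTypeR R * measurableTypeR R)%type.
Local Notation C := (R[i]^o).

(** The sigma-algebra is that of the product; an open set is the union of the countably many
    rational boxes that it contains. *)
Lemma open_measurable2 (A : set plane) : open A -> measurable (A : set mplane).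
Proof.
move=> oA.
pose box (q : (rat * rat) * (rat * rat)) : set mplane :=
  `]ratr q.1.1, ratr q.1.2[ `*` `]ratr q.2.1, ratr q.2.2[.
pose F q := if `[< box q `<=` A >] then box q else set0.
have -> : A = \bigcup_q F q.
  apply/seteqP; split=> x; last first.
    by move=> [q _]; rewrite /F; case: ifPn => [/asboolP + Fx|//]; exact.
  move=> Ax; have /nbhs_ballP[e /= e0 he] : nbhs x A by exact: open_nbhs_nbhs.
  have [a ha] := @rat_in_itvoo R (x.1 - e) x.1 ltac:(by rewrite ltrBlDr ltrDl).
  have [b hb] := @rat_in_itvoo R x.1 (x.1 + e) ltac:(by rewrite ltrDl).
  have [c hc] := @rat_in_itvoo R (x.2 - e) x.2 ltac:(by rewrite ltrBlDr ltrDl).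
  have [d hd] := @rat_in_itvoo R x.2 (x.2 + e) ltac:(by rewrite ltrDl).
  move: ha hb hc hd; rewrite !in_itv /= => /andP[a1 a2] /andP[b1 b2] /andP[c1 c2] /andP[d1 d2].
  exists ((a, b), (c, d)); first exact: Logic.I.
  rewrite /F ifT; first by split; rewrite /= in_itv /= ?a2 ?b1 ?c2 ?d1.
  apply/asboolP => y [/= ]; rewrite !in_itv /= => /andP[y1 y2] /andP[y3 y4].
  by apply: he; split; rewrite /ball /= ltr_norml ltrBrDl ltrBlDr; apply/andP; split; lra.
apply: countable_bigcupT_measurable => [|q]; first exact: countableP.
rewrite /F; case: ifP => _; last exact: measurable0.
by apply: measurableX; exact: measurable_itv.
Qed.

Lemma continuous_measurable2 (u : plane -> R) : continuous u ->
  measurable_fun [set: mplane] (u : mplane -> R).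
Proof.
move=> /continuousP cu; apply: (measurability _ (RGenOpens.measurableE R)).
move=> _ [_ [a [b ->] <-]]; rewrite setTI.
by apply: open_measurable2; apply: cu; exact: interval_open.
Qed.

Lemma continuous_complexP (h : plane -> C) (y : plane) : continuous h ->
  forall eta : R, 0 < eta -> exists2 delta : R, 0 < delta & forall x,
    `|x.1 - y.1| < delta -> `|x.2 - y.2| < delta -> normc (h x - h y) <= eta.
Proof.
move=> ch eta eta0; have /cvgrPdist_le /(_ eta%:C) := ch y.
rewrite ltcR => /(_ eta0) /nbhs_ballP[e /= e0 he]; exists e => // x x1 x2.
have /he : ball y e x by split; rewrite /ball /= distrC.
by rewrite /= distrC lecR.
Qed.

Lemma dist_continuous2 (u : plane -> R) :
  (forall y eta, 0 < eta -> exists2 delta : R, 0 < delta & forall x,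
    `|x.1 - y.1| < delta -> `|x.2 - y.2| < delta -> `|u x - u y| <= eta) ->
  continuous u.
Proof.
move=> hu y; apply/cvgrPdist_le => eta eta0; have [d d0 hd] := hu y eta eta0.
apply/(nbhs_ballP y); exists d => //= x [x1 x2] /=.
by rewrite distrC; apply: hd; rewrite distrC.
Qed.

Lemma continuous_cmeasurable (h : plane -> C) : continuous h ->
  cmeasurable setT (h : mplane -> C).
Proof.
move=> ch; split; apply: continuous_measurable2; apply: dist_continuous2 => y eta eta0;
  have [d d0 hd] := continuous_complexP y ch eta0; exists d => // x x1 x2.
  by rewrite -cReN -cReD; apply: le_trans (Re_le_normc _) _; exact: hd.
by rewrite -cImN -cImD; apply: le_trans (Im_le_normc _) _; exact: hd.
Qed.

End PlaneContinuity.

(** * The inversion formula *)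

Section FourierInversion.
Context {R : realType}.
Local Notation plane := (R * R)%type.
Local Notation mplane := (measurableTypeR R * measurableTypeR R)%type.
Local Notation mu2 := (@mu2 R).
Local Notation C := (R[i]^o).

Lemma laplace2_le1 (e : R) x : 0 <= e -> laplace2 e x <= 1.
Proof.
move=> e0; rewrite /laplace2 /laplace -expRD -expR0 ler_expR -opprD oppr_le0.
by rewrite addr_ge0// mulr_ge0.
Qed.

Lemma cvg_laplace2 (v : mplane -> R) : mu2.-integrable setT (EFin \o v) ->
  \int[mu2]_x (laplace2 n.+1%:R^-1 x * v x) @[n --> \oo] --> (\int[mu2]_x v x : R).
Proof.
move=> iv; have /measurable_EFinP mv := measurable_int _ iv.
have e0 n : 0 < n.+1%:R^-1 :> R by rewrite invr_gt0.
apply: fine_cvg; rewrite fineK; last exact: integrable_fin_num.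
apply: (@dominated_cvg _ mplane R mu2 setT measurableT
  (fun n x => (laplace2 n.+1%:R^-1 x * v x)%:E) (EFin \o v) (abse \o (EFin \o v))).
- move=> n; apply/measurable_EFinP/measurable_funM => //.
  exact: measurable_laplace2.
- move=> x _; apply: cvg_EFin; first exact: nearW.
  rewrite -[X in _ --> X]mul1r; apply: cvgM; last exact: cvg_cst.
  have l1 (t : R) : laplace n.+1%:R^-1 t @[n --> \oo] --> (1 : R).
    rewrite -[X in _ --> X]expR0; apply: continuous_cvg; first exact: continuous_expR.
    rewrite -oppr0; apply: cvgN; rewrite -(mul0r `|t|).
    by apply: cvgM; [exact: cvg_harmonic|exact: cvg_cst].
  by rewrite -[X in _ --> X]mul1r; apply: cvgM; exact: l1.
- by [].
- exact: integrable_abse.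
- move=> n x _ /=; rewrite lee_fin normrM ler_piMl// ger0_norm ?laplace2_le1//.
  exact: ltW (laplace2_gt0 _ _).
Qed.

Section AtOrigin.
Variables (h : plane -> C) (B : R).
Hypothesis ch : continuous h.
Hypothesis hB : forall x, normc (h x) <= B.
Hypothesis ih : cintegrable mu2 setT h.

Let p (x : mplane) := complex.Re (h x).
Let q (x : mplane) := complex.Im (h x).
Let ip : mu2.-integrable setT (EFin \o p). Proof. by case: ih. Qed.
Let iq : mu2.-integrable setT (EFin \o q). Proof. by case: ih. Qed.

Let Tc (u : mplane -> R) (xi : mplane) := \int[mu2]_x (u x * cos (dot2 xi x)).
Let Ts (u : mplane -> R) (xi : mplane) := \int[mu2]_x (u x * sin (dot2 xi x)).

Let mcos : measurable_fun [set: R] (@cos R).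
Proof. by apply: continuous_measurable_fun; exact: continuous_cos. Qed.
Let msin : measurable_fun [set: R] (@sin R).
Proof. by apply: continuous_measurable_fun; exact: continuous_sin. Qed.

Lemma Re_fourier xi : complex.Re (fourier h xi) = (2 * pi) ^- 2 * (Tc p xi + Ts q xi).
Proof.
rewrite /fourier /cintegral cReM /= mul0r subr0; congr (_ * _).
rewrite -RintegralD//; first last.
- exact: integrable_dot iq msin (@sin_max R) xi.
- exact: integrable_dot ip mcos (@cos_max R) xi.
by apply: eq_Rintegral => x _; rewrite cReM /expi /= cosN sinN mulrN opprK.
Qed.

Lemma Im_fourier xi : complex.Im (fourier h xi) = (2 * pi) ^- 2 * (Tc q xi - Ts p xi).
Proof.
rewrite /fourier /cintegral cImM /= mul0r addr0; congr (_ * _).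
rewrite -RintegralB//; first last.
- exact: integrable_dot ip msin (@sin_max R) xi.
- exact: integrable_dot iq mcos (@cos_max R) xi.
by apply: eq_Rintegral => x _; rewrite cImM /expi /= cosN sinN mulrN addrC.
Qed.

Lemma cmeasurable_fourier : cmeasurable setT (fourier h : mplane -> C).
Proof.
have m1 u : mu2.-integrable setT (EFin \o u) -> measurable_fun setT (Tc u).
  by move=> iu; exact: (measurable_dot_transform iu mcos (@cos_max R) ltr01).
have m2 u : mu2.-integrable setT (EFin \o u) -> measurable_fun setT (Ts u).
  by move=> iu; exact: (measurable_dot_transform iu msin (@sin_max R) ltr01).
split.
  rewrite (_ : (fun x => _) = (fun xi => (2 * pi) ^- 2 * (Tc p xi + Ts q xi))).
    by apply: measurable_funM => //; apply: measurable_funD; [exact: m1|exact: m2].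
  by apply/funext => xi; exact: Re_fourier.
rewrite (_ : (fun x => _) = (fun xi => (2 * pi) ^- 2 * (Tc q xi - Ts p xi))).
  by apply: measurable_funM => //; apply: measurable_funB; [exact: m1|exact: m2].
by apply/funext => xi; exact: Im_fourier.
Qed.

Hypothesis iF : cintegrable mu2 setT (fourier h).

(* Abel summation: multiplying a transform by [laplace2 e] and integrating amounts
   to integrating [u] against the product of two Cauchy kernels, an approximation of
   [(2 * pi) ^ 2] times the Dirac mass at [0]. *)
Let smoothed (u v w : mplane -> R) (s : R) :
  mu2.-integrable setT (EFin \o u) -> mu2.-integrable setT (EFin \o w) ->
  (forall x, `|u x| <= B) ->
  (forall eta : R, 0 < eta -> exists2 delta : R, 0 < delta &
     forall x, `|x.1| < delta -> `|x.2| < delta -> `|u x - u 0| <= eta) ->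
  mu2.-integrable setT (EFin \o v) ->
  (forall xi, v xi = (2 * pi) ^- 2 * (Tc u xi + s * Ts w xi)) ->
  \int[mu2]_xi v xi = u 0.
Proof.
move=> iu iw uB cu iv vE.
have /measurable_EFinP mu_ := measurable_int _ iu.
have pi0 : (2 * pi) ^+ 2 != 0 :> R by rewrite expf_eq0/= mulf_eq0 pnatr_eq0/= gt_eqF// pi_gt0.
suff : \int[mu2]_x (laplace2 n.+1%:R^-1 x * v x) @[n --> \oo] --> (u 0 : R).
  by move=> h2; exact: cvg_unique (cvg_laplace2 iv) h2.
rewrite -[u 0](mulKf pi0).
rewrite (_ : (fun n => _) = (fun n => (2 * pi) ^- 2 *
  \int[mu2]_x (u x * (cauchy_kernel n.+1%:R^-1 x.1 * cauchy_kernel n.+1%:R^-1 x.2)))).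
  by apply: cvgM; [exact: cvg_cst|exact: cvg_prod_cauchy].
apply/funext => n; have e0 : 0 < n.+1%:R^-1 :> R by rewrite invr_gt0.
set e := n.+1%:R^-1.
have ic := integrable_laplace2_transform iu mcos (@cos_max R) e0.
have is_ := integrable_laplace2_transform iw msin (@sin_max R) e0.
transitivity (\int[mu2]_xi ((2 * pi) ^- 2 * (laplace2 e xi * Tc u xi)
    + (2 * pi) ^- 2 * s * (laplace2 e xi * Ts w xi))).
  by apply: eq_Rintegral => xi _; rewrite vE; ring.
have ic' := integrableZl measurableT ((2 * pi) ^- 2) ic.
have is' := integrableZl measurableT ((2 * pi) ^- 2 * s) is_.
rewrite RintegralD//; try (under eq_fun do rewrite /= EFinM; assumption).
rewrite !RintegralZl//.
rewrite (Rintegral_laplace2_transform iu mcos (@cos_max R) e0).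
rewrite (Rintegral_laplace2_transform iw msin (@sin_max R) e0).
under eq_Rintegral do rewrite Rintegral_laplace2_cos//.
under [X in _ + _ * X]eq_Rintegral do rewrite Rintegral_laplace2_sin// mulr0.
by rewrite Rintegral_cst//= mul0r mulr0 addr0.
Qed.

(** Both parts are instances of [smoothed]. The sine transform of the other part enters with the
    sign [s] and drops out, because the convergence factor is even. *)
Lemma fourier_inversion0 : cint mu2 setT (fourier h) = h 0.
Proof.
apply: complexP; rewrite /cint.
  rewrite -[LHS]/(\int[mu2]_x complex.Re (fourier h x)).
  apply: (smoothed (s := 1) ip iq).
  - by move=> x; exact: le_trans (Re_le_normc _) (hB _).
  - move=> eta eta0; have [d d0 hd] := continuous_complexP 0 ch eta0.
    exists d => // x x1 x2; rewrite -cReN -cReD; apply: le_trans (Re_le_normc _) _.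
    by apply: hd; rewrite subr0.
  - by case: iF.
  - by move=> xi; rewrite Re_fourier mul1r.
rewrite -[LHS]/(\int[mu2]_x complex.Im (fourier h x)).
apply: (smoothed (s := -1) iq ip).
- by move=> x; exact: le_trans (Im_le_normc _) (hB _).
- move=> eta eta0; have [d d0 hd] := continuous_complexP 0 ch eta0.
  exists d => // x x1 x2; rewrite -cImN -cImD; apply: le_trans (Im_le_normc _) _.
  by apply: hd; rewrite subr0.
- by case: iF.
- by move=> xi; rewrite Im_fourier mulN1r.
Qed.

End AtOrigin.

Lemma integralT_shift (v : plane) (u : mplane -> R) : measurable_fun setT u ->
  \int[mu2]_x u (x + v) = \int[mu2]_x u x.
Proof.
move=> mu_; rewrite /Rintegral; congr fine.
rewrite (@integral_shift R v setT (EFin \o u))//; last exact/measurable_EFinP.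
Qed.

Lemma integrableT_shift (v : plane) (u : mplane -> R) :
  mu2.-integrable setT (EFin \o u) -> mu2.-integrable setT (fun x => (u (x + v))%:E).
Proof.
move=> /integrableP[mu_ iu]; apply/integrableP; split.
  exact: measurableT_comp mu_ (measurable_shift v).
have ma : measurable_fun setT (abse \o (EFin \o u)) by exact: measurableT_comp.
move: iu; rewrite -[X in (X < _)%E -> _]/(integral mu2 setT (abse \o (EFin \o u))).
by rewrite (ge0_integral_shift v measurableT ma (fun x _ => abse_ge0 _)) preimage_setT.
Qed.

Lemma fourier_shift (h : plane -> C) (v xi : plane) : cmeasurable setT (h : mplane -> C) ->
  cintegrable mu2 setT h ->
  fourier (fun x => h (x + v)) xi = (expi (dot2 xi v) : R[i]) * fourier h xi.
Proof.
move=> mh ih.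
have md : measurable_fun [set: mplane] (fun x : mplane => dot2 xi x).
  have := measurable_dot2 xi; congr (measurable_fun _ _).
  by apply/funext => x; rewrite /dot2 mulrC [x.2 * _]mulrC.
have me : cmeasurable setT (fun x : mplane => expi (- dot2 xi x) : C).
  split; rewrite /expi /=.
    apply: measurableT_comp; last exact: measurableT_comp.
    by apply: continuous_measurable_fun; exact: continuous_cos.
  apply: measurableT_comp; last exact: measurableT_comp.
  by apply: continuous_measurable_fun; exact: continuous_sin.
have mhe := cmeasurableM mh me.
have ihe : cintegrable mu2 setT (fun x => (h x : R[i]) * expi (- dot2 xi x)).
  have [i1 i2] := ih.
  have := integrableD measurableT (integrable_abse i1) (integrable_abse i2).
  move/(@cintegrable_le _ mplane R mu2 setT measurableT _
    (fun x => `|complex.Re (h x)| + `|complex.Im (h x)|) mhe); apply => x _.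
  by rewrite normcM normc_expi mulr1 normc_le_ReIm.
rewrite /fourier mulrCA; congr (_ * _).
transitivity (cint mu2 setT (fun x => (expi (dot2 xi v) : R[i]) *
   ((h (x + v) : R[i]) * expi (- dot2 xi (x + v))))).
  congr cint; apply/funext => x; rewrite mulrCA -expiD; congr (_ * expi _).
  rewrite /dot2 /=; ring.
rewrite cintZ//; last first.
  by split; [exact: (integrableT_shift _ ihe.1)|exact: (integrableT_shift _ ihe.2)].
congr (_ * _); apply: complexP => /=.
  exact: (integralT_shift v mhe.1).
exact: (integralT_shift v mhe.2).
Qed.

(** Inversion at the origin for the translate of [h] by [y], whose transform is that of [h] times
    exp(i xi.y). *)
Lemma fourier_inversion (h : plane -> C) (B : R) (y : plane) : continuous h ->
  (forall x, normc (h x) <= B) -> cintegrable mu2 setT h ->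
  cintegrable mu2 setT (fourier h) ->
  cint mu2 setT (fun xi => (fourier h xi : R[i]) * expi (dot2 xi y)) = h y.
Proof.
move=> ch hB ih iF; have mh := continuous_cmeasurable ch.
pose g x := h (x + y).
have FE xi : fourier g xi = (expi (dot2 xi y) : R[i]) * fourier h xi.
  exact: fourier_shift.
have cg : continuous g.
  move=> x; apply: (@continuous_comp plane plane C (fun x => x + y) h); last exact: ch.
  by apply: cvgD; [exact: cvg_id|exact: cvg_cst].
have ig : cintegrable mu2 setT g.
  by split; [exact: (integrableT_shift y ih.1)|exact: (integrableT_shift y ih.2)].
have gB x : normc (g x) <= B by exact: hB.
have igF : cintegrable mu2 setT (fourier g).
  have [i1 i2] := iF.
  have := integrableD measurableT (integrable_abse i1) (integrable_abse i2).
  move/(@cintegrable_le _ mplane R mu2 setT measurableT _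
    (fun x => `|complex.Re (fourier h x)| + `|complex.Im (fourier h x)|)
    (cmeasurable_fourier ig)); apply => x _.
  by rewrite FE normcM normc_expi mul1r normc_le_ReIm.
have := fourier_inversion0 cg gB ig igF; rewrite {2}/g add0r => <-.
by congr cint; apply/funext => xi; rewrite FE mulrC.
Qed.

Lemma norm2_ge (x : plane) : (`|x.1| + `|x.2|) / 2 <= norm2 x.
Proof.
have h (a b : R) : `|a| <= Num.sqrt (a * a + b * b).
  by rewrite -sqrtr_sqr ler_sqrt -?expr2 ?lerDl ?sqr_ge0// addr_ge0// sqr_ge0.
have h1 : `|x.1| <= norm2 x by exact: h.
have h2 : `|x.2| <= norm2 x by rewrite /norm2 /dot2 addrC; exact: h.
lra.
Qed.

(** The Euclidean norm is at least the mean of the moduli of the coordinates. Halving the rate thus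
    turns the decay into a product of one-variable exponentials, which can be integrated over the
    plane and summed over a lattice. *)
Lemma exp_decay_laplace2 (A g : R) (x : plane) (z : C) : 0 < g ->
  normc z * expR (g * norm2 x) <= A -> normc z <= A * laplace2 (g / 2) x.
Proof.
move=> g0 zA; have z0 := normc_ge0 z.
have -> : laplace2 (g / 2) x = (expR (g * ((`|x.1| + `|x.2|) / 2)))^-1.
  rewrite /laplace2 /laplace -expRD -expRN; congr expR; lra.
rewrite ler_pdivlMr ?expR_gt0//; apply: le_trans zA; apply: ler_wpM2l => //.
by rewrite ler_expR ler_pM2l// norm2_ge.
Qed.

Lemma exp_decay_cintegrable (f : plane -> C) (A g : R) : 0 < g ->
  cmeasurable setT (f : mplane -> C) ->
  (forall x, normc (f x) * expR (g * norm2 x) <= A) -> cintegrable mu2 setT f.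
Proof.
move=> g0 mf fA.
have i2 : mu2.-integrable setT (EFin \o (fun x : mplane => A * laplace2 (g / 2) x)).
  have := @integrableZl _ mplane R mu2 setT measurableT A _
    (@integrable_laplace2 R (g / 2) ltac:(lra)).
  by congr (_.-integrable _ _); apply/funext => x /=; rewrite EFinM.
by apply: (cintegrable_le measurableT mf i2) => x _; exact: exp_decay_laplace2.
Qed.

End FourierInversion.


(** * Sums over the translates of a cell *)

Section LatticePoints.
Context {R : realType}.
Local Notation plane := (R * R)%type.
Local Notation mplane := (measurableTypeR R * measurableTypeR R)%type.
Local Notation mu2 := (@mu2 R).
Variable M : 'M[R]_2.

Lemma in_lattice_zpt n : in_lattice M (apply2 M (zpt n)).
Proof. by apply/asboolP; exists n. Qed.

Definition lattice_pt n : lattice M := exist _ (apply2 M (zpt n)) (in_lattice_zpt n).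

Lemma lattice_ptP (r : lattice M) : exists n, r = lattice_pt n.
Proof.
have /asboolP[n rn] := valP r; exists n; apply: val_inj; exact: rn.
Qed.

Hypothesis uM : M \in unitmx.

Lemma lattice_pt_inj : injective lattice_pt.
Proof.
move=> m n /(congr1 val) /= /(can_inj (apply2K uM)) [/intr_inj h1 /intr_inj h2].
by case: m n h1 h2 => m1 m2 [n1 n2] /= -> ->.
Qed.

Lemma lattice_cell_ex (y : plane) : exists G : lattice M, cell M (y - val G).
Proof. by have [n [hn _]] := cell_ex_unique uM y; exists (lattice_pt n). Qed.

Lemma lattice_cell_unique (y : plane) (G G' : lattice M) :
  cell M (y - val G) -> cell M (y - val G') -> G = G'.
Proof.
have [n [_ hn]] := cell_ex_unique uM y.
have [m ->] := lattice_ptP G; have [m' ->] := lattice_ptP G'.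
by move=> /hn -> /hn ->.
Qed.

Definition cell_at (v : plane) : set mplane := [set y : mplane | cell M (y - v)].

Lemma measurable_cell_at (v : plane) : measurable (cell_at v).
Proof. exact: measurable_shift_preimage (measurable_cell uM). Qed.

Section TileSums.
Variable u : mplane -> R.
Hypothesis u0 : forall x, 0 <= u x.
Hypothesis iu : mu2.-integrable setT (EFin \o u).

Let mu_ : measurable_fun [set: mplane] u.
Proof. by move/measurable_int : iu => /measurable_EFinP. Qed.

Lemma cell_shift_integral (v : plane) :
  (\int[mu2]_(x in cell M) (u (x + v))%:E
   = \int[mu2]_(y in cell_at v) (u y)%:E)%E.
Proof.
rewrite (@ge0_integral_shift R v (cell_at v) (EFin \o u)).
- congr (integral _ _ _); apply/seteqP; split => x; by rewrite /cell_at /= addrK.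
- exact: measurable_cell_at.
- by apply/measurable_EFinP; exact: measurable_funS mu_.
- by move=> x _; rewrite lee_fin.
Qed.

Lemma integrable_cell_shift (v : plane) :
  mu2.-integrable (cell M) (fun x : mplane => (u (x + v))%:E).
Proof.
have := integrableT_shift v iu; apply: integrableS => //; exact: measurable_cell.
Qed.

Definition cell_mass (v : plane) : R := \int[mu2]_(x in cell M) u (x + v).

Lemma cell_mass_ge0 v : 0 <= cell_mass v.
Proof. by apply: Rintegral_ge0 => x _. Qed.

Lemma cell_massE v : (cell_mass v)%:E
  = (\int[mu2]_(y in cell_at v) (u y)%:E)%E.
Proof.
rewrite -cell_shift_integral /cell_mass /Rintegral fineK//.
apply: integrable_fin_num; first exact: measurable_cell.
exact: integrable_cell_shift.
Qed.

Lemma cell_mass_le (F : {fset lattice M}) :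
  \sum_(G <- F) cell_mass (val G) <= \int[mu2]_x u x.
Proof.
rewrite -lee_fin -sumEFin fineK; last exact: integrable_fin_num.
under eq_bigr do rewrite cell_massE.
rewrite -ge0_integral_bigsetU//.
- apply: ge0_subset_integral => //.
  + by apply: bigsetU_measurable => G _; exact: measurable_cell_at.
  + exact: measurable_int iu.
  + by move=> x _; rewrite lee_fin.
- by move=> G; exact: measurable_cell_at.
- by apply/trivIsetP => G G' _ _ GG'; apply/seteqP; split => // x [/= h1 h2];
    move/eqP: GG'; apply; exact: lattice_cell_unique h1 h2.
- by apply: measurable_funTS; exact: measurable_int iu.
- by move=> x _; rewrite lee_fin.
Qed.

(** Countable additivity over the coded tiles gives a finite stage within [eps], whose lattice
    points make up [F0]. Larger finite sets only come closer, since the masses are nonnegative and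
    their sums stay below the integral. *)
Lemma cell_mass_cvg (eps : R) : 0 < eps -> exists F0 : {fset lattice M},
  forall F, (F0 `<=` F)%fset ->
  `|\int[mu2]_x u x - \sum_(G <- F) cell_mass (val G)| <= eps.
Proof.
move=> eps0.
pose g (n : int * int) : plane := - apply2 M (zpt n) + 0.
pose a k := (\int[mu2]_(x in setT `&` tile M g k) (u x)%:E)%E.
have aE : (\int[mu2]_x (u x)%:E = \sum_(k <oo) a k)%E.
  apply: (ge0_integral_tile uM (tilingB uM 0)) => //; first exact: measurable_int iu.
  by move=> x _; rewrite lee_fin.
have a0 k : (0 <= a k)%E by apply: integral_ge0 => x _; rewrite lee_fin.
have fu : (\int[mu2]_x (u x)%:E)%E \is a fin_num by exact: integrable_fin_num.
have : \sum_(0 <= k < n) a k @[n --> \oo] --> (\int[mu2]_x u x)%:E.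
  by rewrite fineK// aE; apply: is_cvg_nneseries => k _ _; exact: a0.
move/fine_cvgP => [_ /cvgrPdist_le /(_ _ eps0) [N _ /(_ N (leqnn N)) /= hN]].
pose E := pmap (@pickle_inv (int * int)%type) (iota 0 N).
have uE : uniq (map lattice_pt E).
  rewrite map_inj_uniq; last exact: lattice_pt_inj.
  exact: (pmap_uniq (@pickle_invK (int * int)%type) (iota_uniq 0 N)).
have sE : (\sum_(0 <= k < N) a k = (\sum_(n <- E) cell_mass (apply2 M (zpt n)))%:E)%E.
  rewrite -sumEFin /E big_pmap /index_iota subn0; apply: eq_bigr => k _.
  rewrite /a /tile setTI; case: pickle_inv => [n|] /=; last by rewrite integral_set0.
  rewrite cell_massE; congr (integral _ _ _).
  by apply/seteqP; split => x; rewrite /cell_at /g /= addr0.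
pose F0 : {fset lattice M} := seq_fset tt (map lattice_pt E).
have F0E : \sum_(G <- F0) cell_mass (val G) = \sum_(n <- E) cell_mass (apply2 M (zpt n)).
  by rewrite (perm_big _ (seq_fset_perm tt _)) undup_id// big_map.
exists F0 => F FF.
rewrite ger0_norm ?subr_ge0 ?cell_mass_le//.
apply: le_trans (le_trans (ler_norm _) hN); apply: lerB => //.
rewrite sE /= -F0E (big_fset_split _ FF) lerDl.
by apply: sumr_ge0 => G _; exact: cell_mass_ge0.
Qed.

End TileSums.

(** A signed function is the difference of v + |v| and |v|, both nonnegative and integrable. *)
Lemma cell_integral_cvg (v : mplane -> R) (eps : R) :
  mu2.-integrable setT (EFin \o v) -> 0 < eps -> exists F0 : {fset lattice M},
  forall F, (F0 `<=` F)%fset ->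
  `|\int[mu2]_x v x - \sum_(G <- F) \int[mu2]_(x in cell M) v (x + val G)| <= eps.
Proof.
move=> iv eps0.
pose w (x : mplane) := `|v x|; pose s (x : mplane) := v x + `|v x|.
have iw : mu2.-integrable setT (EFin \o w) by exact: integrable_abse iv.
have is_ : mu2.-integrable setT (EFin \o s) by exact: (integrableD measurableT iv iw).
have w0 x : 0 <= w x by exact: normr_ge0.
have s0 x : 0 <= s x by rewrite -lerBlDr sub0r lerNl -normrN ler_norm.
have e2 : 0 < eps / 2 by lra.
have [F1 hF1] := cell_mass_cvg w0 iw e2.
have [F2 hF2] := cell_mass_cvg s0 is_ e2.
exists (F1 `|` F2)%fset => F; rewrite fsubUset => /andP[/hF1 h1 /hF2 h2].
have mc := measurable_cell uM.
have -> : \int[mu2]_x v x = \int[mu2]_x s x - \int[mu2]_x w x.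
  by rewrite -RintegralB//; apply: eq_Rintegral => x _; rewrite /s addrK.
have -> : \sum_(G <- F) \int[mu2]_(x in cell M) v (x + val G)
    = \sum_(G <- F) cell_mass s (val G) - \sum_(G <- F) cell_mass w (val G).
  rewrite -sumrB; apply: eq_bigr => G _.
  rewrite /cell_mass -RintegralB//; try exact: integrable_cell_shift.
  by apply: eq_Rintegral => x _; rewrite /s addrK.
rewrite opprD opprK addrACA [- _ + _]addrC.
apply: le_trans (ler_normD _ _) _; rewrite [eps]splitr; apply: lerD => //.
by rewrite addrC -normrN opprD opprK.
Qed.

Lemma cint_cell_cvg (f : mplane -> R[i]^o) (eps : R) :
  cintegrable mu2 setT f -> 0 < eps -> exists F0 : {fset lattice M},
  forall F, (F0 `<=` F)%fset ->
  normc (cint mu2 setT f - \sum_(G <- F) cint mu2 (cell M) (fun x => f (x + val G))) <= eps.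
Proof.
move=> [i1 i2] eps0; have e2 : 0 < eps / 2 by lra.
have [F1 hF1] := cell_integral_cvg i1 e2.
have [F2 hF2] := cell_integral_cvg i2 e2.
exists (F1 `|` F2)%fset => F; rewrite fsubUset => /andP[/hF1 h1 /hF2 h2].
apply: le_trans (normc_le_ReIm _) _; rewrite [eps]splitr; apply: lerD.
  rewrite cReD cReN (big_morph _ (@cReD R) (erefl : complex.Re 0 = 0)); exact: h1.
rewrite cImD cImN (big_morph _ (@cImD R) (erefl : complex.Im 0 = 0)); exact: h2.
Qed.

Lemma laplace2_shift (c K : R) (x q : plane) : 0 <= c -> `|q.1| <= K -> `|q.2| <= K ->
  laplace2 c x <= expR (c * (2 * K)) * laplace2 c (x + q).
Proof.
move=> c0 q1 q2; rewrite /laplace2 /laplace -!expRD ler_expR /=.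
have h1 := ler_normD x.1 q.1; have h2 := ler_normD x.2 q.2.
rewrite -!opprD -!mulrDr lerNl opprD opprK -mulrN -mulrDr.
by apply: ler_wpM2l => //; lra.
Qed.

(** Each value at a lattice point is at most a constant times the mean over the translate of the
    cell based there; the translates being disjoint, the integral over the plane bounds the sum. *)
Lemma laplace2_lattice_sum (c : R) : 0 < c -> exists B : R, forall F : {fset lattice M},
  \sum_(G <- F) laplace2 c (val G) <= B.
Proof.
move=> c0; have [K K0 hK] := cell_bounded M.
have l0 x : 0 <= laplace2 c x :> R := ltW (laplace2_gt0 _ _).
have il := integrable_laplace2 c0.
set V := fine (mu2 (cell M)).
have V0 : 0 < V by rewrite fine_gt0// mu2_cell_gt0// mu2_cell_lty.
exists (expR (c * (2 * K)) * (\int[mu2]_x laplace2 c x) / V) => F.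
rewrite ler_pdivlMr// mulr_suml.
apply: le_trans (ler_wpM2l (expR_ge0 _) (cell_mass_le l0 il F)).
rewrite mulr_sumr; apply: ler_sum => G _.
have ig := integrable_cell_shift il (val G).
have mc := measurable_cell uM.
rewrite /cell_mass -RintegralZl// /V.
have -> : laplace2 c (val G) * fine (mu2 (cell M))
    = \int[mu2]_(x in cell M) (laplace2 c (val G)).
  by rewrite Rintegral_cst.
apply: le_Rintegral => //.
- exact: integrable_cst_lty (mu2_cell_lty uM) _.
- have := integrableZl mc (expR (c * (2 * K))) ig.
  by congr (_.-integrable _ _); apply/funext => x /=; rewrite EFinM.
- move=> x cx; have [x1 x2] := hK _ cx.
  by rewrite [x + _]addrC; apply: laplace2_shift => //; exact: ltW.
Qed.

End LatticePoints.


(** * Bloch modes and quasi-periodic extensions *)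

Section Dot.
Context {R : realType}.
Implicit Types x y z : (R * R)%type.

Lemma dot2C x y : dot2 x y = dot2 y x.
Proof. by rewrite /dot2 mulrC [x.2 * _]mulrC. Qed.

Lemma dot2Dr x y z : dot2 x (y + z) = dot2 x y + dot2 x z.
Proof. rewrite /dot2 /=; ring. Qed.

Lemma dot2Nr x y : dot2 x (- y) = - dot2 x y.
Proof. rewrite /dot2 /=; ring. Qed.

Lemma dot2Dl x y z : dot2 (y + z) x = dot2 y x + dot2 z x.
Proof. by rewrite ![dot2 _ x]dot2C dot2Dr. Qed.

Lemma dot2Nl x y : dot2 (- y) x = - dot2 y x.
Proof. by rewrite ![dot2 _ x]dot2C dot2Nr. Qed.

Lemma dot2_apply2 (P Q : 'M[R]_2) x y :
  dot2 (apply2 P x) (apply2 Q y) = dot2 x (apply2 (P^T *m Q) y).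
Proof.
have sum2 (F : 'I_2 -> R) : \sum_i F i = F 0 + F 1.
  by rewrite !big_ord_recl big_ord0 addr0; congr (_ + F _); exact: val_inj.
by rewrite /dot2 /apply2 /= !mxE !sum2 !mxE; ring.
Qed.

End Dot.

Lemma measurable_expi d (R : realType) (T : measurableType d) (D : set T) (u : T -> R) :
  measurable_fun D u -> cmeasurable D (fun x => expi (u x) : R[i]^o).
Proof.
move=> mu_; split; apply: measurableT_comp => //.
  by apply: continuous_measurable_fun; exact: continuous_cos.
by apply: continuous_measurable_fun; exact: continuous_sin.
Qed.

Section BlochModes.
Context {R : realType}.
Local Notation plane := (R * R)%type.
Local Notation mplane := (measurableTypeR R * measurableTypeR R)%type.
Local Notation mu2 := (@mu2 R).
Local Notation C := (R[i]^o).

(** Here [x] is a position in real space, a lattice vector plus an orbital shift, and [q] a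
    momentum; the factor normalizes the mode on the cell of [N]. *)
Definition bloch_mode (N : 'M[R]_2) (x q : plane) : C :=
  ((Num.sqrt (fine (mu2 (cell N))))^-1)%:C * expi (- dot2 q x).

Variables (M N : 'M[R]_2) (t : plane).
Hypotheses (uM : M \in unitmx) (uN : N \in unitmx).
(** The duality N^T M = 2 pi of the two lattices: the plane wave at a vector of the lattice of [M]
    is a character of the plane modulo the lattice of [N]. *)
Hypothesis dual : forall q m, dot2 q (apply2 M (zpt m)) = phase N m q.

Local Notation D := (cell N : set mplane).
Let cs : R := Num.sqrt (fine (mu2 (cell N))).
Let mD : measurable D := measurable_cell uN.
Let finD : (mu2 D < +oo)%E := mu2_cell_lty uN.

Let e (r : lattice M) := bloch_mode N (val r + t).

Lemma cell_width_gt0 : 0 < cs.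
Proof. by rewrite sqrtr_gt0 fine_gt0// mu2_cell_gt0// finD. Qed.

Lemma cell_width_sqr : cs ^+ 2 = fine (mu2 (cell N)).
Proof. by rewrite sqr_sqrtr// fine_ge0. Qed.

Lemma normc_bloch_mode x q : normc (bloch_mode N x q) = cs^-1.
Proof.
by rewrite normcM normc_expi mulr1 normc_real ger0_norm// invr_ge0 ltW// cell_width_gt0.
Qed.

Lemma bloch_modeJ x q :
  ((bloch_mode N x q)^*)%C = ((cs^-1)%:C : R[i]) * expi (dot2 q x).
Proof.
apply: complexP; rewrite ?cReJ ?cImJ !(cReM, cImM) /expi /= cosN sinN; ring.
Qed.

Lemma cmeasurable_bloch_mode x (A : set mplane) :
  measurable A -> cmeasurable A (bloch_mode N x : mplane -> C).
Proof.
move=> mA; apply: cmeasurableM; first exact: cmeasurable_cst.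
apply: measurable_expi; apply: measurable_funTS; apply: measurableT_comp => //.
exact: measurable_dot2.
Qed.

Lemma expi_dual (G : lattice N) (r : lattice M) : expi (dot2 (val G) (val r)) = 1 :> R[i].
Proof.
have [m ->] := lattice_ptP r; have [n ->] := lattice_ptP G.
rewrite /= dual -[X in phase _ _ X]add0r expi_phase_periodic//.
by rewrite /phase /apply2 /dot2 /= !(mulr0, addr0) expi0.
Qed.

(** The common shift [t] cancels between a mode and a conjugate mode, leaving a character integrated
    over the cell. *)
Lemma bloch_mode_ortho r r' :
  cint mu2 D (fun q => (e r q : R[i]) * ((e r' q)^*)%C) = (r == r')%:R.
Proof.
have [m ->] := lattice_ptP r; have [m' ->] := lattice_ptP r'.
have cs0 := cell_width_gt0.
have iphi : cintegrable mu2 D (fun q : mplane => expi (phase N (m' - m) q + 0) : C).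
  apply: (@cintegrable_le _ mplane R mu2 D mD _ (fun=> 1)).
  - apply: measurable_expi; apply: measurable_funD => //.
    by apply: measurable_funTS; exact: measurable_phase.
  - exact: integrable_cst_lty.
  - by move=> q _; rewrite normc_expi.
transitivity (cint mu2 D (fun q => ((cs ^- 2)%:C : R[i]) * expi (phase N (m' - m) q + 0))).
  apply: eq_cint => q _; rewrite /e bloch_modeJ /bloch_mode mulrACA -expiD.
  rewrite -rmorphM /= -invfM -expr2; congr (_ * expi _).
  rewrite addr0 phaseD phaseN -!dual !dot2Dr; ring.
rewrite cintZ// cint_expi_phase// subr_eq0 expi0 mulr1 eq_sym (inj_eq (lattice_pt_inj uM)).
case: eqP => _; last by rewrite mulr0.
by rewrite -rmorphM /= -cell_width_sqr mulVf ?expf_eq0 ?gt_eqF.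
Qed.

(** Multiplication of [f] by the unimodular function exp(i q.t) keeps its norm and reduces the modes
    to the characters. *)
Lemma bloch_mode_complete (f : mplane -> C) : in_L2 mu2 D f ->
  (forall r, coef mu2 D e r f = 0) -> nrm2 mu2 D f = 0.
Proof.
move=> Lf f0; have cs0 := cell_width_gt0.
have mt : cmeasurable D (fun q : mplane => expi (dot2 q t) : C).
  by apply: measurable_expi; apply: measurable_funTS; exact: measurable_dot2.
pose f' (q : mplane) : C := (f q : R[i]) * expi (dot2 q t).
have [Lf' _] : in_L2 mu2 D f' /\ nrm2 mu2 D f' <= 1 * nrm2 mu2 D f.
  apply: in_L2_le => //; first exact: cmeasurableM (in_L2_cmeasurable Lf) mt.
  by move=> q _; rewrite normcM normc_expi mulr1 mul1r.
have <- : nrm2 mu2 D f' = nrm2 mu2 D f.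
  rewrite /nrm2 /sqint; congr (Num.sqrt (fine _)); apply: eq_integral => q _.
  by rewrite normcM normc_expi mulr1.
apply: phase_complete => // n.
have ip : cintegrable mu2 D (fun q => (f' q : R[i]) * expi (phase N n q)).
  apply: (in_L2_cintegrable mD finD (K := 1)) => //.
    by apply: measurable_expi; apply: measurable_funTS; exact: measurable_phase.
  by move=> q _; rewrite normc_expi.
have := f0 (lattice_pt M n); rewrite /coef.
rewrite (_ : cint _ _ _ = ((cs^-1)%:C : R[i]) * cint mu2 D (fun q => (f' q : R[i]) * expi (phase N n q))).
  move/eqP; rewrite mulf_eq0 => /orP[/eqP/(congr1 (@complex.Re R)) /= /eqP|/eqP//].
  by rewrite invr_eq0 gt_eqF.
rewrite -cintZ//; apply: eq_cint => q _.
rewrite /e bloch_modeJ dot2Dr expiD -dual /f'; ring.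
Qed.

End BlochModes.

(** * Covering a bounded set by cells *)

Section CellCover.
Context {R : realType}.
Local Notation plane := (R * R)%type.
Local Notation mplane := (measurableTypeR R * measurableTypeR R)%type.
Local Notation mu2 := (@mu2 R).
Local Notation C := (R[i]^o).
Variable N : 'M[R]_2.
Hypothesis uN : N \in unitmx.

Lemma finite_cell_cover (A : set plane) (K : R) :
  (forall x, A x -> `|x.1| <= K /\ `|x.2| <= K) ->
  exists F : {fset lattice N}, forall x, A x -> exists2 G, G \in F & cell N (x - val G).
Proof.
move=> AK.
pose L := `|invmx N 0 0| + `|invmx N 0 1| + (`|invmx N 1 0| + `|invmx N 1 1|).
(* [L] times the modulus of [K] bounds the lattice coordinates of the points of [A]; the 1 allows
   for rounding them down. *)
pose m := Num.bound (L * `|K| + 1).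
have hm : L * `|K| + 1 < m%:R.
  by apply: archi_boundP; rewrite addr_ge0// mulr_ge0// !addr_ge0.
pose s := [seq (k%:Z - m%:Z)%R | k <- iota 0 (2 * m).+1].
have sP (z : int) (y : R) : `|y| <= L * `|K| -> 0 <= y - z%:~R < 1 -> z \in s.
  move=> yL yz; have : `|z%:~R| <= m%:R :> R.
    move: yL yz hm; rewrite !ler_norml => /andP[? ?] /andP[? ?] ?; apply/andP; split; lra.
  rewrite -intr_norm pmulrn ler_int => zm.
  apply/mapP; exists (absz (z + m%:Z)); last by lia.
  rewrite mem_iota; lia.
exists (seq_fset tt [seq lattice_pt N (i, j) | i <- s, j <- s]) => x Ax.
have [x1 x2] := AK x Ax; have [n [hn _]] := cell_ex_unique uN x.
exists (lattice_pt N n); last exact: hn.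
rewrite seq_fsetE; apply/allpairsP; exists n.
have [h1 h2] := (cellP uN _).1 hn.
have bd0 (a b : R) : `|a * x.1 + b * x.2| <= (`|a| + `|b|) * `|K|.
  apply: le_trans (ler_normD _ _) _; rewrite !normrM mulrDl.
  by apply: lerD; apply: ler_wpM2l => //; apply: le_trans (ler_norm K).
have nE : apply2 (invmx N) (x - apply2 N (zpt n)) = apply2 (invmx N) x - zpt n.
  by rewrite apply2D apply2N apply2K.
move: h1 h2; rewrite nE => h1 h2.
split; last by case: (n).
- apply: (sP _ (apply2 (invmx N) x).1) h1.
  rewrite /apply2 /=; apply: le_trans (bd0 _ _) _; apply: ler_wpM2r => //.
  by rewrite /L lerDl addr_ge0.
- apply: (sP _ (apply2 (invmx N) x).2) h2.
  rewrite /apply2 /=; apply: le_trans (bd0 _ _) _; apply: ler_wpM2r => //.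
  by rewrite /L lerDr addr_ge0.
Qed.

(** The same [n], the number of cells that cover [A], serves for all [v]: a displaced periodic
    function is still periodic, and its integral over each cell does not depend on the
    displacement. *)
Lemma ge0_integral_periodic_le (A : set mplane) (K : R) : measurable A ->
  (forall x, A x -> `|x.1| <= K /\ `|x.2| <= K) ->
  exists n : nat, forall (v : plane) (u : mplane -> \bar R),
    measurable_fun [set: mplane] u -> (forall x, (0 <= u x)%E) -> lattice_periodic N u ->
    (\int[mu2]_(x in A) u (x + v)%R <= n%:R%:E * \int[mu2]_(x in cell N) u x)%E.
Proof.
move=> mA AK; have [F hF] := finite_cell_cover AK.
exists (size F) => v u mu_ u0 pu.
have muv w : measurable_fun [set: mplane] (fun x : mplane => u (x + w)).
  exact: measurableT_comp mu_ (measurable_shift w).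
have mcell := measurable_cell_at uN.
apply: (@le_trans _ _ (\int[mu2]_(x in \big[setU/set0]_(G <- F) cell_at N (val G)) u (x + v)%R)%E).
  apply: ge0_subset_integral => //.
  - by apply: bigsetU_measurable => G _; exact: mcell.
  - exact: measurable_funTS.
  - move=> x /hF[G GF xG]; rewrite -bigcup_seq; by exists G.
rewrite ge0_integral_bigsetU//; last 2 first.
- by apply/trivIsetP => G G' _ _ GG'; apply/seteqP; split => // x [/= h1 h2];
    move/eqP: GG'; apply; exact: (lattice_cell_unique uN h1 h2).
- exact: measurable_funTS.
rewrite -sum1_size natr_sum -sumEFin ge0_sume_distrl; last by move=> G _; rewrite lee_fin.
apply: lee_sum => G _; rewrite mul1e.
have := @ge0_integral_cell_shift R N uN (fun x => u (x + v)) (- val G) (muv v) (fun x => u0 _).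
rewrite -/(cell_at N (val G)) => ->; last first.
  by move=> x n; rewrite addrAC pu.
have := @ge0_integral_cell_shift R N uN u (- v) mu_ u0 pu; rewrite -/(cell_at N v) => <-.
rewrite (ge0_integral_shift v (mcell v))//; last exact: measurable_funTS.
rewrite le_eqVlt; apply/orP; left; apply/eqP; congr integral.
by apply/seteqP; split => x; rewrite /cell_at /= addrK.
Qed.

End CellCover.

(** * The lattices of the layers and quasi-periodic extensions *)

Section Layers.
Context {R : realType} (theta : 'I_3 -> R).
Local Notation plane := (R * R)%type.
Local Notation mplane := (measurableTypeR R * measurableTypeR R)%type.
Local Notation mu2 := (@mu2 R).
Local Notation C := (R[i]^o).
Local Notation tau := (orbital_shift theta).

Let sum2 (F : 'I_2 -> R) : \sum_i F i = F 0 + F 1.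
Proof. by rewrite !big_ord_recl big_ord0 addr0; congr (_ + F _); exact: val_inj. Qed.

Let mx2P (A B : 'M[R]_2) : A 0 0 = B 0 0 -> A 0 1 = B 0 1 -> A 1 0 = B 1 0 ->
  A 1 1 = B 1 1 -> A = B.
Proof.
have o2 (i : 'I_2) : i = 0 \/ i = 1.
  by case: i => [[|[|//]] hi]; [left|right]; exact: val_inj.
move=> h1 h2 h3 h4; apply/matrixP => i j.
by case: (o2 i) => ->; case: (o2 j) => ->.
Qed.

Lemma rotation_tr_mul (t : R) : (rotation t)^T *m rotation t = 1%:M.
Proof.
have h := cos2Dsin2 t.
apply: mx2P; rewrite !mxE !sum2 !mxE /= ?mulr1n ?mulr0n; lra.
Qed.

Lemma rotation_unit (t : R) : rotation t \in unitmx.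
Proof. by have [] := mulmx1_unit (rotation_tr_mul t). Qed.

Lemma graphene_mx_unit : @graphene_mx R \in unitmx.
Proof.
have s3 : Num.sqrt 3 != 0 :> R by rewrite gt_eqF// sqrtr_gt0.
have a0 : @lattice_const R / 2 != 0.
  by rewrite !mulf_eq0 !invr_eq0 !pnatr_eq0 (negbTE s3).
rewrite /graphene_mx unitmxZ ?unitfE//.
suff /mulmx1_unit[] : mx2 2 1 0 (Num.sqrt 3) *m mx2 (1 / 2) (- (1 / (2 * Num.sqrt 3))) 0
  (1 / Num.sqrt 3) = 1%:M :> 'M[R]_2 by [].
apply: mx2P; rewrite !mxE !sum2 !mxE /= ?mulr1n ?mulr0n; field => //.
Qed.

Lemma layer_mx_unit j : layer_mx theta j \in unitmx.
Proof. by rewrite unitmx_mul rotation_unit graphene_mx_unit. Qed.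

Let pi2 : 2 * pi != 0 :> R.
Proof. by apply: mulf_neq0 => //; rewrite gt_eqF// pi_gt0. Qed.

Lemma dual_mx_unit j : dual_mx theta j \in unitmx.
Proof.
rewrite unitmx_mul rotation_unit /graphene_dual_mx unitmxZ ?unitfE//.
by rewrite unitmx_tr unitmx_inv graphene_mx_unit.
Qed.

(** The rotations cancel, being orthogonal, and the transposed inverse leaves 2 pi. *)
Lemma layer_dual j q m :
  dot2 q (apply2 (layer_mx theta j) (zpt m)) = phase (dual_mx theta j) m q.
Proof.
rewrite /phase -{1}(apply2KV (dual_mx_unit j) q) dot2_apply2.
have -> : (dual_mx theta j)^T *m layer_mx theta j = (2 * pi)%:M.
  rewrite /dual_mx /layer_mx /graphene_dual_mx trmx_mul mulmxA -[_ *m _ *m rotation _]mulmxA.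
  have -> : ((2 * pi) *: (invmx (@graphene_mx R))^T)^T = (2 * pi) *: invmx graphene_mx.
    by apply/matrixP => i k; rewrite !mxE.
  rewrite rotation_tr_mul mulmx1 -scalemxAl mulVmx ?graphene_mx_unit//.
  by rewrite scalemx1.
by rewrite /apply2 /dot2 !mxE /=; ring.
Qed.

Lemma cell_pointP j q : bz theta j (q - val (cell_point theta j q)).
Proof.
have [G hG] := lattice_cell_ex (dual_mx_unit j) q.
by apply: (@xgetPex _ 0 [set G : lattice (dual_mx theta j) | bz theta j (q - val G)]); exists G.
Qed.

Lemma cell_point_eq j q (G : lattice (dual_mx theta j)) :
  bz theta j (q - val G) -> cell_point theta j q = G.
Proof. exact: (lattice_cell_unique (dual_mx_unit j) (cell_pointP j q)). Qed.

Implicit Types (s : orbital) (f : plane -> C).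
Local Notation ext := (quasi_periodic_ext theta).

Lemma quasi_periodic_extE s f q (G : lattice (dual_mx theta s.1)) :
  bz theta s.1 (q - val G) ->
  ext s f q = (expi (- dot2 (val G) (tau s)) : R[i]) * f (q - val G).
Proof. by move=> /cell_point_eq; rewrite /quasi_periodic_ext => ->. Qed.

Lemma normc_ext s f q (G : lattice (dual_mx theta s.1)) :
  bz theta s.1 (q - val G) -> normc (ext s f q) = normc (f (q - val G)).
Proof. by move=> /quasi_periodic_extE ->; rewrite normcM normc_expi mul1r. Qed.

Lemma normc_ext_periodic s f :
  lattice_periodic (dual_mx theta s.1) (fun q => normc (ext s f q)).
Proof.
move=> q n; have h := cell_pointP s.1 q.
pose G := cell_point theta s.1 q + lattice_pt (dual_mx theta s.1) n.
have E : q + apply2 (dual_mx theta s.1) (zpt n) - val G = q - val (cell_point theta s.1 q).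
  by rewrite opprD addrACA subrr addr0.
by rewrite (normc_ext f h) (@normc_ext _ _ _ G) E.
Qed.

(** On each translate of the cell the extension is a constant times the function displaced, and
    countably many translates make up the plane. *)
Lemma cmeasurable_ext s f : cmeasurable (bz theta s.1) (f : mplane -> C) ->
  cmeasurable setT (ext s f : mplane -> C).
Proof.
move=> mf; have uN := dual_mx_unit s.1.
suff h n : cmeasurable [set y : mplane | cell (dual_mx theta s.1) (y +
    (- apply2 (dual_mx theta s.1) (zpt n) + 0))] (ext s f : mplane -> C).
  by split; apply: (measurable_fun_tile uN (tilingB uN 0)) => n; have [] := h n.
rewrite addr0; set v := apply2 _ _.
have md : measurable ([set y : mplane | cell (dual_mx theta s.1) (y - v)] : set mplane).
  exact: measurable_cell_at.
have E : {in [set y : mplane | cell (dual_mx theta s.1) (y - v)],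
    (fun y : mplane => (expi (- dot2 v (tau s)) : R[i]) * f (y - v)) =1 ext s f}.
  move=> y; rewrite inE /= => yv.
  by rewrite (@quasi_periodic_extE _ _ _ (lattice_pt (dual_mx theta s.1) n)).
have mfv : cmeasurable [set y : mplane | cell (dual_mx theta s.1) (y - v)]
    (fun y : mplane => f (y - v)).
  have mD := measurable_cell uN.
  by case: mf => m1 m2; split;
    [apply: (measurable_comp mD _ m1)|apply: (measurable_comp mD _ m2)];
    [move=> _ [y /= ? <-]|apply: measurable_funTS; exact: measurable_shift
    |move=> _ [y /= ? <-]|apply: measurable_funTS; exact: measurable_shift].
have [h1 h2] := cmeasurableM (@cmeasurable_cst _ _ _ _ (expi (- dot2 v (tau s)))) mfv.
split.
  by apply: eq_measurable_fun h1 => y yD; rewrite /= E.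
by apply: eq_measurable_fun h2 => y yD; rewrite /= E.
Qed.

(** A mode is quasi-periodic by itself, because exp(i G.r) = 1 for [G] in the dual lattice. On
    modes, [translation] is thus the plain translation. *)
Lemma ext_bloch_mode s (r : lattice (layer_mx theta s.1)) :
  ext s (bloch_mode (dual_mx theta s.1) (val r + tau s))
  = bloch_mode (dual_mx theta s.1) (val r + tau s).
Proof.
apply/funext => q; rewrite /quasi_periodic_ext; set G := cell_point _ _ _.
rewrite /bloch_mode mulrCA -expiD; congr (_ * _).
have E := expi_dual (dual_mx_unit s.1) (layer_dual s.1) G r.
rewrite -[RHS]mulr1 -E -expiD; congr expi.
by rewrite dot2Dl dot2Nl !dot2Dr; ring.
Qed.

Lemma translation_bounded j s : exists2 K : R, 0 <= K & forall v f,
  in_L2 mu2 (bz theta s.1) f -> in_L2 mu2 (bz theta j) (translation theta s v f) /\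
  nrm2 mu2 (bz theta j) (translation theta s v f) <= K * nrm2 mu2 (bz theta s.1) f.
Proof.
have uN := dual_mx_unit s.1; have uJ := dual_mx_unit j.
have [B B0 hB] := cell_bounded (dual_mx theta j).
have [n hn] := ge0_integral_periodic_le uN (measurable_cell uJ) hB.
exists (Num.sqrt n%:R) => // v f Lf.
have mext := cmeasurable_ext (in_L2_cmeasurable Lf).
have mD := measurable_cell uN.
have mT : cmeasurable (bz theta j) (translation theta s v f : mplane -> C).
  have [m1 m2] := mext; split; apply: measurable_funTS.
    exact: measurableT_comp m1 (measurable_shift v).
  exact: measurableT_comp m2 (measurable_shift v).
have le_ : (sqint mu2 (bz theta j) (translation theta s v f)
    <= n%:R%:E * sqint mu2 (bz theta s.1) f)%E.
  apply: le_trans (hn v (fun q => (normc (ext s f q) ^+ 2)%:E) _ _ _) _.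
  - by apply/measurable_EFinP; exact: cmeasurable_sqr mext.
  - by move=> x; rewrite lee_fin sqr_ge0.
  - by move=> x m; rewrite normc_ext_periodic.
  - rewrite le_eqVlt; apply/orP; left; apply/eqP; congr (_ * _)%E.
    apply: eq_integral => q; rewrite inE => qD.
    by rewrite (@normc_ext _ _ _ 0) subr0.
have LT : in_L2 mu2 (bz theta j) (translation theta s v f).
  apply: in_L2P => //; apply: le_lt_trans le_ _.
  by case: Lf => _ _ Lf; apply: lte_mul_pinfty.
split=> //; rewrite -(@ler_pXn2r _ 2)// ?nnegrE ?mulr_ge0 ?sqrtr_ge0 ?nrm2_ge0//.
by rewrite -lee_fin nrm2_sqrE// exprMn sqr_sqrtr// EFinM nrm2_sqrE.
Qed.

End Layers.


(** * Sums of operators *)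

Section L2Sums.
Context d (T : measurableType d) (R : realType).
Variables (mu : {measure set T -> \bar R}) (D : set T).
Hypothesis mD : measurable D.
Local Notation C := (R[i]^o).
Local Notation L2 := (in_L2 mu D).
Local Notation nrm := (nrm2 mu D).
Implicit Types f g : T -> C.

Definition L2_linear (L : (T -> C) -> C) := forall (c : C) f g, L2 f -> L2 g ->
  L (fun x => (c : R[i]) * f x + g x) = (c : R[i]) * L f + L g.

Lemma nrm2_0 : nrm (fun=> 0) = 0.
Proof.
rewrite /nrm2 /sqint (eq_integral (fun=> 0%E)); last first.
  by move=> x _; rewrite (normc_real 0 : normc 0 = _) normr0 expr2 mulr0.
by rewrite integral0 sqrtr0.
Qed.

Lemma in_L2_0 : L2 (fun=> 0).
Proof.
apply: in_L2P; first exact: cmeasurable_cst.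
rewrite /sqint (eq_integral (fun=> 0%E)); first by rewrite integral0.
by move=> x _; rewrite (normc_real 0 : normc 0 = _) normr0 expr2 mulr0.
Qed.

Lemma in_L2_sum (J : Type) (s : seq J) (F : J -> T -> C) : (forall i, L2 (F i)) ->
  L2 (fun x => \sum_(i <- s) F i x).
Proof.
move=> LF; elim: s => [|i s IH].
  by under eq_fun do rewrite big_nil; exact: in_L2_0.
by under eq_fun do rewrite big_cons; exact: in_L2D.
Qed.

Lemma nrm2_sum (J : Type) (s : seq J) (F : J -> T -> C) : (forall i, L2 (F i)) ->
  nrm (fun x => \sum_(i <- s) F i x) <= \sum_(i <- s) nrm (F i).
Proof.
move=> LF; elim: s => [|i s IH].
  by under eq_fun do rewrite big_nil; rewrite nrm2_0 big_nil.
under eq_fun do rewrite big_cons; rewrite big_cons.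
by apply: le_trans (nrm2D mD _ _) _ => //; [exact: in_L2_sum|exact: lerD].
Qed.

End L2Sums.

(** * Bounds and limits tested on coefficients *)

Section WeakBounds.
Context d (T : measurableType d) (R : realType).
Variables (mu : {measure set T -> \bar R}) (D : set T).
Hypothesis mD : measurable D.
Hypothesis finD : (mu D < +oo)%E.
Local Notation C := (R[i]^o).
Variables (I : choiceType) (e : I -> T -> C) (K : R).
Hypothesis me : forall i, cmeasurable D (e i).
Hypothesis eK : forall i x, D x -> normc (e i x) <= K.
Hypothesis ortho : forall i j,
  cint mu D (fun x => (e i x : R[i]) * ((e j x)^*)%C) = (i == j)%:R.
Local Notation L2 := (in_L2 mu D).
Local Notation nrm := (nrm2 mu D).
Local Notation coef := (coef mu D e).
Hypothesis complete : forall f, L2 f -> (forall i, coef i f = 0) -> nrm f = 0.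
Implicit Types f g : T -> C.

Lemma coef_sum (J : Type) (s : seq J) (F : J -> T -> C) i : (forall k, L2 (F k)) ->
  coef i (fun x => \sum_(k <- s) F k x) = \sum_(k <- s) coef i (F k).
Proof.
move=> LF; elim: s => [|k s IH].
  by under eq_fun do rewrite big_nil; rewrite big_nil coef0.
under eq_fun do rewrite big_cons; rewrite big_cons.
by rewrite (coefD mD finD me eK)//; [rewrite IH|exact: in_L2_sum].
Qed.

(** The ball of radius [b] is weakly closed: on any finitely many coefficients, [g] is as close as
    desired to vectors of that ball. *)
Lemma nrm2_le_weak g (b : R) : L2 g -> 0 <= b ->
  (forall (G : {fset I}) (eta : R), 0 < eta -> exists h, [/\ L2 h, nrm h <= b &
     forall r, r \in G -> normc (coef r g - coef r h) <= eta]) ->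
  nrm g <= b.
Proof.
move=> Lg b0 wk; apply: (nrm2_le_coef mD finD me eK ortho complete) => // G.
have Lp c F := in_L2_psum mD finD me eK c F : L2 (psum e c F).
rewrite -(nrm2_psum mD finD me eK ortho) ler_pXn2r ?nnegrE ?nrm2_ge0//.
apply/ler_addgt0Pr => eps eps0.
pose n : R := (size G).+1%:R.
(* One more than the number of coefficients keeps the divisor positive, and the squared errors
   together stay below the square of [eps]. *)
have n0 : 0 < n by rewrite ltr0n.
have [h [Lh hb hG]] := wk G (eps / n) (divr_gt0 eps0 n0).
pose c1 := coef^~ h; pose c2 r : C := coef r g - coef r h.
have -> : psum e (coef^~ g) G = fun x => psum e c1 G x + psum e c2 G x.
  apply/funext => x; rewrite /psum -big_split; apply: eq_bigr => r _ /=.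
  by rewrite -mulrDl /c1 /c2 addrC subrK.
apply: le_trans (nrm2D mD (Lp _ _) (Lp _ _)) _; apply: lerD.
  apply: le_trans hb; rewrite -(@ler_pXn2r _ 2)// ?nnegrE ?nrm2_ge0//.
  by rewrite (nrm2_psum mD finD me eK ortho); exact: (bessel mD finD me eK ortho).
rewrite -(@ler_pXn2r _ 2)// ?nnegrE ?nrm2_ge0 ?(ltW eps0)//.
rewrite (nrm2_psum mD finD me eK ortho).
apply: (@le_trans _ _ (\sum_(r <- G) (eps / n) ^+ 2)).
  rewrite big_seq [leRHS]big_seq; apply: ler_sum => r rG.
  by rewrite ler_pXn2r ?nnegrE ?normc_ge0 ?(ltW (divr_gt0 eps0 n0))//; exact: hG.
rewrite big_const_seq count_predT iter_addr addr0 -mulr_natr exprMn -mulrA ler_piMr ?sqr_ge0//.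
rewrite exprVn mulrC ler_pdivrMr ?exprn_gt0// mul1r /n expr2.
by apply: le_trans (_ : (size G).+1%:R <= _); rewrite ?ler_nat// ler_peMl ?ler1n.
Qed.

Section Equibounded.
Variables (J : choiceType) (L : {fset J} -> (T -> C) -> C) (B : R).
Hypothesis B0 : 0 <= B.
Hypothesis linL : forall F, L2_linear mu D (L F).
Hypothesis LB : forall F f, L2 f -> normc (L F f) <= B * nrm f.

(** Linearity extends the convergence from the basis to finite combinations; the common bound
    carries it to their limits. *)
Lemma equibounded_cvg0 :
  (forall i (eps : R), 0 < eps -> exists F0, forall F, (F0 `<=` F)%fset ->
     normc (L F (e i)) <= eps) ->
  forall f (eps : R), L2 f -> 0 < eps -> exists F0, forall F, (F0 `<=` F)%fset ->
     normc (L F f) <= eps.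
Proof.
move=> Le.
have Lee i : L2 (e i) by exact: (in_L2_e mD finD me eK).
have fin (c : I -> C) (s : seq I) (eps : R) : 0 < eps ->
    exists F0, forall F, (F0 `<=` F)%fset ->
    normc (L F (fun x => \sum_(i <- s) (c i : R[i]) * e i x)) <= eps.
  elim: s eps => [|i s IH] eps eps0.
    exists fset0 => F _; under eq_fun do rewrite big_nil.
    by apply: le_trans (LB F (in_L2_0 mu D)) _; rewrite nrm2_0 mulr0 ltW.
  have e2 : 0 < eps / 2 by rewrite divr_gt0.
  have c1 : 0 < normc (c i) + 1 by rewrite ltr_wpDl// normc_ge0.
  have [F1 hF1] := IH _ e2; have [F2 hF2] := Le i _ (divr_gt0 e2 c1).
  exists (F1 `|` F2)%fset => F; rewrite fsubUset => /andP[/hF1 h1 /hF2 h2].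
  under eq_fun do rewrite big_cons; rewrite linL//; last first.
    by apply: in_L2_sum => // j; exact: in_L2Z.
  apply: le_trans (le_normcD _ _) _; rewrite [eps]splitr; apply: lerD => //.
  rewrite normcM; apply: le_trans (ler_wpM2l (normc_ge0 _) h2) _.
  rewrite mulrA ler_pdivrMr// mulrC; apply: ler_wpM2l; first exact: ltW.
  by rewrite lerDl.
move=> f eps Lf eps0; have e2 : 0 < eps / 2 by rewrite divr_gt0.
have B1 : 0 < B + 1 by rewrite ltr_wpDl.
have [E0 /(_ E0 (fsubset_refl _)) hE] :=
  L2_sum_coef mD finD me eK ortho complete Lf (divr_gt0 e2 B1).
have [F0 hF0] := fin (coef^~ f) E0 _ e2.
exists F0 => F /hF0 h.
have Lp : L2 (psum e (coef^~ f) E0) by exact: (in_L2_psum mD finD me eK).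
have -> : f = fun x => (1 : R[i]) * (f x - psum e (coef^~ f) E0 x) + psum e (coef^~ f) E0 x.
  by apply/funext => x; rewrite mul1r subrK.
rewrite linL//; last exact: in_L2B.
rewrite mul1r; apply: le_trans (le_normcD _ _) _; rewrite [eps]splitr; apply: lerD => //.
apply: le_trans (LB F (in_L2B mD Lf Lp)) _.
apply: le_trans (ler_wpM2l B0 hE) _.
rewrite mulrA ler_pdivrMr// mulrC; apply: ler_wpM2l; first exact: ltW.
by rewrite lerDl.
Qed.

End Equibounded.
End WeakBounds.

(** * From matrix elements to convergence in operator norm *)

Section OperatorSums.
Context d (T : measurableType d) (R : realType).
Variables (mu : {measure set T -> \bar R}).
Local Notation C := (R[i]^o).
Variables (D D' : set T).
Hypothesis mD : measurable D.
Hypothesis finD : (mu D < +oo)%E.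
Variables (I : choiceType) (e : I -> T -> C) (K : R).
Hypothesis me : forall i, cmeasurable D (e i).
Hypothesis eK : forall i x, D x -> normc (e i x) <= K.
Hypothesis ortho : forall i j,
  cint mu D (fun x => (e i x : R[i]) * ((e j x)^*)%C) = (i == j)%:R.
Hypothesis complete : forall f, in_L2 mu D f ->
  (forall i, coef mu D e i f = 0) -> nrm2 mu D f = 0.
Hypothesis mD' : measurable D'.
Hypothesis finD' : (mu D' < +oo)%E.
Variables (I' : choiceType) (e' : I' -> T -> C) (K' : R).
Hypothesis me' : forall i, cmeasurable D' (e' i).
Hypothesis eK' : forall i x, D' x -> normc (e' i x) <= K'.
Hypothesis ortho' : forall i j,
  cint mu D' (fun x => (e' i x : R[i]) * ((e' j x)^*)%C) = (i == j)%:R.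
Hypothesis complete' : forall f, in_L2 mu D' f ->
  (forall i, coef mu D' e' i f = 0) -> nrm2 mu D' f = 0.
Implicit Types f g : T -> C.

Variables (J : choiceType) (S : J -> (T -> C) -> (T -> C)) (A : (T -> C) -> (T -> C)).
Variables (a : J -> R) (B b : R).
Hypothesis S_L2 : forall i f, in_L2 mu D f -> in_L2 mu D' (S i f).
Hypothesis S_bounded : forall i f, in_L2 mu D f ->
  nrm2 mu D' (S i f) <= a i * nrm2 mu D f.
Hypothesis S_linear : forall i (c : C) f g,
  S i (fun x => (c : R[i]) * f x + g x) = fun x => (c : R[i]) * S i f x + S i g x.
Hypothesis a0 : forall i, 0 <= a i.
Hypothesis aB : forall F : {fset J}, \sum_(i <- F) a i <= B.
Hypothesis A_L2 : forall f, in_L2 mu D f -> in_L2 mu D' (A f).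
Hypothesis b0 : 0 <= b.
Hypothesis A_bounded : forall f, in_L2 mu D f -> nrm2 mu D' (A f) <= b * nrm2 mu D f.
(** Linearity is asked of the coefficients alone: [A] itself may be linear only up to null
    functions. *)
Hypothesis A_linear : forall r, L2_linear mu D (fun f => coef mu D' e' r (A f)).
Hypothesis A_coef : forall r' r (eps : R), 0 < eps -> exists F0, forall F, (F0 `<=` F)%fset ->
  normc (coef mu D' e' r' (A (e r)) - \sum_(i <- F) coef mu D' e' r' (S i (e r))) <= eps.

(** [F0] comes from the tail of the bounds [a], hence does not depend on [f]. For [F] beyond it, the
    error is a weak limit of sums of [S] over finite sets disjoint from [F0], all of norm at most
    [eps] times that of [f]. *)
Lemma operator_sum_of_coef (eps : R) : 0 < eps -> exists F0, forall F, (F0 `<=` F)%fset ->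
  forall f, in_L2 mu D f ->
  nrm2 mu D' (fun x => A f x - \sum_(i <- F) S i f x) <= eps * nrm2 mu D f.
Proof.
move=> eps0; have [F0 hF0] := small_tail a0 aB eps0.
exists F0 => F F0F f Lf.
(* A coefficient of the error left by a partial sum; as functionals of [f] these are bounded by
   [b + B] whatever the finite set. *)
pose L r (F : {fset J}) f := coef mu D' e' r (A f) - \sum_(i <- F) coef mu D' e' r (S i f).
have B0 : 0 <= B by have := aB fset0; rewrite big_seq_fset0.
have linL r G : L2_linear mu D (L r G).
  move=> c u v Lu Lv; rewrite /L A_linear// mulrBr addrACA -opprD; congr (_ - _).
  rewrite mulr_sumr -big_split; apply: eq_bigr => i _ /=.
  rewrite S_linear (coefD mD' finD' me' eK' r (in_L2Z mD' c (S_L2 i Lu)) (S_L2 i Lv)).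
  by rewrite (coefZ mD' finD' me' eK' r c (S_L2 i Lu)).
have Lb r G u : in_L2 mu D u -> normc (L r G u) <= (b + B) * nrm2 mu D u.
  move=> Lu; apply: le_trans (le_normcD _ _) _; rewrite mulrDl normcN; apply: lerD.
    apply: le_trans (normc_coef_le mD' finD' me' eK' ortho' r (A_L2 Lu)) _.
    exact: A_bounded.
  apply: le_trans (normc_sum _ _) _.
  apply: (@le_trans _ _ (\sum_(i <- G) a i * nrm2 mu D u)).
    apply: ler_sum => i _.
    apply: le_trans (normc_coef_le mD' finD' me' eK' ortho' r (S_L2 i Lu)) _.
    exact: S_bounded.
  by rewrite -mulr_suml; apply: ler_wpM2r; [exact: nrm2_ge0|exact: aB].
have bB : 0 <= b + B by rewrite addr_ge0.
have Lcvg r := equibounded_cvg0 mD finD me eK ortho complete bB (linL r) (Lb r) (A_coef r).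
have Lall (s : seq I') (eta : R) : 0 < eta -> exists F1, forall G, (F1 `<=` G)%fset ->
    forall r, r \in s -> normc (L r G f) <= eta.
  move=> eta0; elim: s => [|r s [F1 hF1]]; first by exists fset0.
  have [F2 hF2] := Lcvg r f eta Lf eta0.
  exists (F1 `|` F2)%fset => G; rewrite fsubUset => /andP[/hF1 h1 /hF2 h2] r'.
  by rewrite inE => /orP[/eqP ->//|]; exact: h1.
have LS G : in_L2 mu D' (fun x => \sum_(i <- G) S i f x).
  by apply: in_L2_sum => // i; exact: S_L2.
have LAf := A_L2 Lf.
have e0 : 0 <= eps * nrm2 mu D f by apply: mulr_ge0; [exact: ltW|exact: nrm2_ge0].
apply: (nrm2_le_weak mD' finD' me' eK' ortho' complete') => //.
  exact: in_L2B.
move=> G eta eta0; have [F1 hF1] := Lall G eta eta0.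
(* The error over [F] minus the terms that [F2] adds is the error over [F2], which is small on the
   coefficients in [G]. *)
pose F2 := (F `|` F1)%fset.
exists (fun x => \sum_(i <- (F2 `\` F)%fset) S i f x); split => //.
- apply: le_trans (nrm2_sum mD' _ (fun i => S_L2 i Lf)) _.
  apply: (@le_trans _ _ (\sum_(i <- (F2 `\` F)%fset) a i * nrm2 mu D f)).
    by apply: ler_sum => i _; exact: S_bounded.
  rewrite -mulr_suml; apply: ler_wpM2r; first exact: nrm2_ge0.
  apply: hF0; apply/fdisjointP => i; rewrite inE => /andP[iF _].
  by apply: contra iF; exact: (fsubsetP F0F).
- move=> r rG; rewrite (coefB mD' finD' me' eK')//.
  rewrite !(coef_sum mD' finD' me' eK' _ r (fun i => S_L2 i Lf)) -addrA -opprD.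
  rewrite -(big_fset_split (fun i => coef mu D' e' r (S i f)) (fsubsetUl F F1)).
  by apply: hF1 => //; exact: fsubsetUr.
Qed.

End OperatorSums.


(** * The Bloch transform and the momentum space Hamiltonian *)

Section Totally.
Context {R : realType}.
Local Notation C := (R[i]^o).

Lemma near_totallyP (I : choiceType) (P : set {fset I}) :
  (\forall F \near totally, P F) <-> exists F0, forall F, (F0 `<=` F)%fset -> P F.
Proof.
split=> [[F0 _ h]|[F0 h]]; first by exists F0 => F; exact: h.
by exists F0.
Qed.

Lemma totally_cvg0P (I : choiceType) (g : {fset I} -> R) : (forall F, 0 <= g F) ->
  g F @[F --> totally] --> 0 <->
  forall eps : R, 0 < eps -> exists F0, forall F, (F0 `<=` F)%fset -> g F <= eps.
Proof.
move=> g0; have FF := @totally_filter I.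
split=> [/cvgrPdist_le h eps /h /near_totallyP[F0 hF]|h].
  by exists F0 => F /hF; rewrite sub0r normrN ger0_norm.
apply/cvgrPdist_le => eps /h[F0 hF]; apply/near_totallyP; exists F0 => F /hF.
by rewrite sub0r normrN ger0_norm.
Qed.

Lemma partial_sumE (I : choiceType) (V : zmodType) (x : I -> V) F :
  partial_sum x F = \sum_(i <- F) x i.
Proof. by rewrite big_seq_fsetE. Qed.

Lemma sum_eventually (I : choiceType) (x : I -> C) (i0 : I) :
  (forall i, i != i0 -> x i = 0) -> sum x = x i0.
Proof.
move=> x0; have FF := @totally_filter I; apply: cvg_lim; first exact: norm_hausdorff.
apply: cvg_near_cst; apply/near_totallyP; exists [fset i0]%fset => F.
rewrite fsub1set => iF; rewrite partial_sumE (bigD1_seq i0)//= big1 ?addr0//.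
Qed.

Lemma sum_zero (I : choiceType) (x : I -> C) : (forall i, x i = 0) -> sum x = 0.
Proof.
move=> x0; have FF := @totally_filter I; apply: cvg_lim; first exact: norm_hausdorff.
apply: cvg_near_cst; apply/near_totallyP; exists fset0 => F _.
by rewrite partial_sumE big1.
Qed.

Lemma sum_uniq_fset (I : choiceType) (V : nmodType) (s : seq I) (a : I -> V) : uniq s ->
  \sum_(i <- s) a i = \sum_(i <- seq_fset tt s) a i.
Proof. by move=> us; rewrite (perm_big _ (seq_fset_perm tt s)) undup_id. Qed.

End Totally.

(** * Sites grouped by orbital *)

Section Sites.
Context {R : realType} (theta : 'I_3 -> R).
Local Notation plane := (R * R)%type.
Local Notation C := (R[i]^o).
Local Notation sites := (sites theta).

Definition site_orbital (w : sites) : orbital := (tag w, (tagged w).2).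

Definition orbital_site (p : orbital) (r : lattice (layer_mx theta p.1)) : sites :=
  site (r, p.2).

Lemma orbital_site_inj p : injective (@orbital_site p).
Proof.
move=> r r' /eqP.
by rewrite -[orbital_site r']/(Tagged (layer_sites theta) (r', p.2)) eq_Tagged /= => /eqP[].
Qed.

Lemma orbital_siteP w : exists r, w = @orbital_site (site_orbital w) r.
Proof. by case: w => j [r b]; exists r. Qed.

(* A partial inverse of [orbital_site], by excluded middle: the lattice depends on
   the orbital, so that comparing sites directly would require casts. *)
Definition site_index (p : orbital) (w : sites) : option (lattice (layer_mx theta p.1)) :=
  if pselect (exists r, w = orbital_site r) is left h then Some (projT1 (cid h)) else None.

Lemma site_indexK p (r : lattice (layer_mx theta p.1)) :
  site_index p (orbital_site r) = Some r.
Proof.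
rewrite /site_index; case: pselect => [h|[]]; last by exists r.
by case: (cid h) => r' /= /orbital_site_inj ->.
Qed.

Lemma site_index_ocancel p : ocancel (site_index p) (@orbital_site p).
Proof. by move=> w; rewrite /site_index; case: pselect => //= h; case: (cid h). Qed.

Lemma site_index_neq p w : p != site_orbital w -> site_index p w = None.
Proof.
rewrite /site_index; case: pselect => // h pw; exfalso; case: h => r E.
by move: pw; rewrite E /site_orbital /= -surjective_pairing eqxx.
Qed.

Lemma sum_sites (V : nmodType) (a : sites -> V) (s : seq sites) :
  \sum_(w <- s) a w
  = \sum_(p : orbital) \sum_(r <- pmap (site_index p) s) a (@orbital_site p r).
Proof.
under [RHS]eq_bigr do rewrite big_pmap.
rewrite exchange_big; apply: eq_bigr => -[j [r b]] _ /=.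
rewrite (bigD1 (j, b))//= big1 ?addr0; last by move=> p pw; rewrite site_index_neq.
by rewrite -[existT _ _ _]/(@orbital_site (j, b) r) site_indexK.
Qed.

Lemma ell2_ge (psi : sites -> C) (F : {fset sites}) :
  ((\sum_(w <- F) normc (psi w) ^+ 2)%:E <= ell2_sq psi)%E.
Proof.
apply: esum_ge; exists [set` F]; first by split.
by rewrite fsbig_finite// set_fsetK sumEFin.
Qed.

Lemma ell2_sq_ge0 (psi : sites -> C) : (0 <= ell2_sq psi)%E.
Proof. by have := ell2_ge psi fset0; rewrite big_seq_fset0. Qed.

Lemma ell2_norm_sqr (psi : sites -> C) : ell2 psi ->
  (ell2_norm psi ^+ 2)%:E = ell2_sq psi.
Proof.
move=> h; rewrite sqr_sqrtr ?fine_ge0 ?ell2_sq_ge0// fineK//.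
by rewrite ge0_fin_numE ?ell2_sq_ge0.
Qed.

Lemma ell2_orbital_le (psi : sites -> C) p (F : {fset lattice (layer_mx theta p.1)}) :
  ell2 psi -> \sum_(r <- F) normc (psi (orbital_site r)) ^+ 2 <= ell2_norm psi ^+ 2.
Proof.
move=> h; rewrite -lee_fin ell2_norm_sqr//.
have u : uniq [seq orbital_site r | r <- F].
  by rewrite map_inj_uniq ?fset_uniq//; exact: orbital_site_inj.
have := ell2_ge psi (seq_fset tt [seq orbital_site r | r <- F]).
by rewrite -sum_uniq_fset// big_map.
Qed.

Lemma ell2_bound (psi : sites -> C) (B : R) : 0 <= B ->
  (forall F : {fset sites}, \sum_(w <- F) normc (psi w) ^+ 2 <= B ^+ 2) ->
  ell2 psi /\ ell2_norm psi <= B.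
Proof.
move=> B0 hB; have le_ : (ell2_sq psi <= (B ^+ 2)%:E)%E.
  apply: ge_ereal_sup => _ [A [fA _] <-].
  by rewrite fsbig_finite// sumEFin lee_fin; exact: hB.
have h : ell2 psi by apply: le_lt_trans le_ _; exact: ltry.
split=> //; rewrite -(@ler_pXn2r _ 2)// ?nnegrE ?sqrtr_ge0//.
by rewrite -lee_fin ell2_norm_sqr.
Qed.

End Sites.

(** * The Bloch transform and its inverse *)

Section BlochTransform.
Context {R : realType} (theta : 'I_3 -> R).
Local Notation plane := (R * R)%type.
Local Notation mplane := (measurableTypeR R * measurableTypeR R)%type.
Local Notation mu2 := (@mu2 R).
Local Notation C := (R[i]^o).
Local Notation sites := (sites theta).
Local Notation tau := (orbital_shift theta).
Implicit Types (p s : orbital) (f g : plane -> C).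

Definition mode p (r : lattice (layer_mx theta p.1)) : mplane -> C :=
  bloch_mode (dual_mx theta p.1) (val r + tau p).

Local Notation D p := (bz theta p.1 : set mplane).
Local Notation L2p p := (in_L2 mu2 (D p)).
Local Notation nrm p := (nrm2 mu2 (D p)).

Lemma measurable_bz j : measurable (bz theta j : set mplane).
Proof. exact: measurable_cell (dual_mx_unit theta j). Qed.

Lemma mu2_bz_lty j : (mu2 (bz theta j) < +oo)%E.
Proof. exact: mu2_cell_lty (dual_mx_unit theta j). Qed.

Lemma cstar_gt0 j : 0 < cstar theta j.
Proof. exact: cell_width_gt0 (dual_mx_unit theta j). Qed.

Lemma cmeasurable_mode p r : cmeasurable (D p) (@mode p r).
Proof. by apply: cmeasurable_bloch_mode; exact: measurable_bz. Qed.

Lemma normc_mode p r q : D p q -> normc (@mode p r q) <= (cstar theta p.1)^-1.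
Proof. by move=> _; rewrite normc_bloch_mode//; exact: dual_mx_unit. Qed.

Lemma mode_ortho p r r' :
  cint mu2 (D p) (fun q => (@mode p r q : R[i]) * ((@mode p r' q)^*)%C) = (r == r')%:R.
Proof.
exact: (bloch_mode_ortho (tau p) (layer_mx_unit theta p.1) (dual_mx_unit theta p.1)
  (layer_dual theta p.1)).
Qed.

Definition mode_coef p (r : lattice (layer_mx theta p.1)) f : C :=
  coef mu2 (D p) (@mode p) r f.

Lemma mode_complete p f : L2p p f -> (forall r, @mode_coef p r f = 0) -> nrm p f = 0.
Proof. exact: (bloch_mode_complete (dual_mx_unit theta p.1) (layer_dual theta p.1)). Qed.

Let mDp p := measurable_bz p.1.
Let finDp p := mu2_bz_lty p.1.

Lemma mode_coefD p r f g : L2p p f -> L2p p g ->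
  @mode_coef p r (fun q => f q + g q) = mode_coef r f + mode_coef r g.
Proof. exact: (coefD (mDp p) (finDp p) (@cmeasurable_mode p) (@normc_mode p)). Qed.

Lemma mode_coefZ p r (c : C) f : L2p p f ->
  @mode_coef p r (fun q => (c : R[i]) * f q) = (c : R[i]) * mode_coef r f.
Proof. exact: (coefZ (mDp p) (finDp p) (@cmeasurable_mode p) (@normc_mode p)). Qed.

Lemma mode_coefB p r f g : L2p p f -> L2p p g ->
  @mode_coef p r (fun q => f q - g q) = mode_coef r f - mode_coef r g.
Proof. exact: (coefB (mDp p) (finDp p) (@cmeasurable_mode p) (@normc_mode p)). Qed.

Lemma mode_coef0 p r : @mode_coef p r 0 = 0.
Proof. exact: coef0. Qed.

Lemma mode_bessel p f (F : {fset lattice (layer_mx theta p.1)}) : L2p p f ->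
  \sum_(r <- F) normc (mode_coef r f) ^+ 2 <= nrm p f ^+ 2.
Proof.
exact: (bessel (mDp p) (finDp p) (@cmeasurable_mode p) (@normc_mode p) (@mode_ortho p)).
Qed.

Lemma nrm2_le_mode_coef p f (b : R) : L2p p f -> 0 <= b ->
  (forall F : {fset lattice (layer_mx theta p.1)},
    \sum_(r <- F) normc (mode_coef r f) ^+ 2 <= b ^+ 2) -> nrm p f <= b.
Proof.
exact: (nrm2_le_coef (mDp p) (finDp p) (@cmeasurable_mode p) (@normc_mode p)
  (@mode_ortho p) (@mode_complete p)).
Qed.

Lemma mode_coef_inj p f g : L2p p f -> L2p p g ->
  (forall r, @mode_coef p r f = mode_coef r g) -> ae_eq mu2 (bz theta p.1) f g.
Proof.
move=> Lf Lg fg; have Lfg := in_L2B (mDp p) Lf Lg.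
have := (nrm2_eq0P (mDp p) Lfg).1 (mode_complete Lfg _).
move=> h; apply: filterS (h _) => [q /= h' qD|r].
  by apply/eqP; rewrite -subr_eq0; apply/eqP; exact: h'.
by rewrite mode_coefB// fg subrr.
Qed.

(** The inverse of the Bloch transform, up to null functions: the value at a site is the coefficient
    of its mode in the component of its orbital. *)
Definition mode_coefs (f : orbital -> plane -> C) (w : sites) : C :=
  let: existT j x := w in @mode_coef (j, x.2) x.1 (f (j, x.2)).

Lemma mode_coefsE (f : orbital -> plane -> C) p r : mode_coefs f (@orbital_site R theta p r) = mode_coef r (f p).
Proof. by case: p r. Qed.

(** The Bloch series is the expansion in modes with coefficients [psi], so its convergence to [f]
    can be read on the coefficients of [f]. *)
Lemma is_blochP (psi : sites -> C) (f : orbital -> plane -> C) : L2sum theta f ->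
  is_bloch psi f <-> mode_coefs f = psi.
Proof.
move=> Lf.
have key p : L2_norm theta p.1 (f p - (fun q => ((cstar theta p.1)^-1)%:C *
      partial_sum (fun r : lattice (layer_mx theta p.1) =>
        expi (- dot2 q (val r + tau p)) * psi (site (r, p.2))) F))
    @[F --> totally] --> (0 : R)
    <-> forall r, @mode_coef p r (f p) = psi (orbital_site r).
  rewrite -(L2_sum_cvgP (mDp p) (finDp p) (@cmeasurable_mode p) (@normc_mode p)
    (@mode_ortho p) (@mode_complete p) (fun r => psi (orbital_site r)) (Lf p)).
  have E F : L2_norm theta p.1 (f p - (fun q => ((cstar theta p.1)^-1)%:C *
      partial_sum (fun r : lattice (layer_mx theta p.1) =>
        expi (- dot2 q (val r + tau p)) * psi (site (r, p.2))) F))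
    = nrm p (fun q => f p q - psum (@mode p) (fun r => psi (orbital_site r)) F q).
    congr (nrm2 _ _ _); apply/funext => q; rewrite -[LHS]/(f p q - _); congr (_ - _).
    rewrite partial_sumE mulr_sumr; apply: eq_bigr => r _.
    by rewrite mulrA mulrC.
  by under eq_fun do rewrite E; rewrite totally_cvg0P// => F; exact: nrm2_ge0.
split=> [h|E p].
  apply/funext => w; have [r ->] := orbital_siteP w.
  by rewrite mode_coefsE; have [_ /key] := h (site_orbital w).
by split; [exact: Lf|apply/(key p) => r; rewrite -E mode_coefsE].
Qed.

(** For a square-summable [psi], Riesz-Fischer supplies in each orbital a function with the
    prescribed coefficients, so the choice made by [bloch] does not fall back on its default
    value. *)
Lemma bloch_spec (psi : sites -> C) : ell2 psi ->
  L2sum theta (bloch psi) /\ mode_coefs (bloch psi) = psi.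
Proof.
move=> h; suff : is_bloch psi (bloch psi).
  by move=> hb; have L : L2sum theta (bloch psi) by [move=> p; case: (hb p)];
    split; last exact: (is_blochP psi L).1.
apply: (@xgetPex _ 0 [set f | is_bloch psi f]).
have ex p : {f | L2p p f & forall r, @mode_coef p r f = psi (orbital_site r)}.
  apply: cid2.
  have [f Lf hf] := riesz_fischer (mDp p) (finDp p) (@cmeasurable_mode p) (@normc_mode p)
    (@mode_ortho p) (fun F => ell2_orbital_le F h).
  exists f => //; exact: (coef_sum_cvg (mDp p) (finDp p) (@cmeasurable_mode p)
    (@normc_mode p) (@mode_ortho p) Lf hf).
pose f p : plane -> C := s2val (ex p).
have Lf : L2sum theta f by move=> p; exact: s2valP (ex p).
exists f; apply/(is_blochP psi Lf)/funext => w; have [r ->] := orbital_siteP w.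
by rewrite mode_coefsE; exact: (s2valP' (ex _)).
Qed.

Lemma bloch_norm_le (psi : sites -> C) p : ell2 psi -> nrm p (bloch psi p) <= ell2_norm psi.
Proof.
move=> h; have [L E] := bloch_spec h.
apply: nrm2_le_mode_coef; [exact: L|exact: sqrtr_ge0|move=> F].
by under eq_bigr do rewrite -mode_coefsE E; exact: ell2_orbital_le.
Qed.

Lemma L2sum_norm_sqr (f : orbital -> plane -> C) :
  L2sum_norm theta f ^+ 2 = \sum_p nrm p (f p) ^+ 2.
Proof. by rewrite sqr_sqrtr// sumr_ge0// => p _; rewrite sqr_ge0. Qed.

(** Bessel's inequality in each orbital, after grouping the sites. *)
Lemma ell2_mode_coefs (f : orbital -> plane -> C) : L2sum theta f ->
  ell2 (mode_coefs f) /\ ell2_norm (mode_coefs f) <= L2sum_norm theta f.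
Proof.
move=> Lf; apply: ell2_bound => [|F]; first exact: sqrtr_ge0.
rewrite sum_sites L2sum_norm_sqr; apply: ler_sum => p _.
under eq_bigr do rewrite mode_coefsE.
rewrite sum_uniq_fset; first exact: mode_bessel (Lf p).
exact: (pmap_uniq (@site_index_ocancel R theta p) (fset_uniq F)).
Qed.

Lemma mode_coefs_linear (c : R[i]) (f g : orbital -> plane -> C) :
  L2sum theta f -> L2sum theta g ->
  mode_coefs (c *: f + g) = c *: mode_coefs f + mode_coefs g.
Proof.
move=> Lf Lg; apply/funext => w; have [r ->] := orbital_siteP w.
set p := site_orbital w in r *.
rewrite -[RHS]/(c * mode_coefs f (orbital_site r) + mode_coefs g (orbital_site r)).
rewrite !mode_coefsE -mode_coefZ; last exact: Lf.
by rewrite -(mode_coefD r (in_L2Z (mDp p) c (Lf p)) (Lg p)).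
Qed.

Lemma L2sum_linear (c : R[i]) (f g : orbital -> plane -> C) :
  L2sum theta f -> L2sum theta g -> L2sum theta (c *: f + g).
Proof.
by move=> Lf Lg p; exact: (in_L2D (mDp p) (in_L2Z (mDp p) c (Lf p)) (Lg p)).
Qed.

Lemma mode_coefs_inj (f g : orbital -> plane -> C) : L2sum theta f -> L2sum theta g ->
  mode_coefs f = mode_coefs g -> L2sum_eq theta f g.
Proof.
move=> Lf Lg fg p; apply: mode_coef_inj; [exact: Lf|exact: Lg|move=> r].
by rewrite -!mode_coefsE fg.
Qed.

End BlochTransform.


(** * The conjugate of the Hamiltonian and its entries *)

Section MomentumHamiltonian.
Context {R : realType} (theta : 'I_3 -> R).
Local Notation plane := (R * R)%type.
Local Notation mplane := (measurableTypeR R * measurableTypeR R)%type.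
Local Notation mu2 := (@mu2 R).
Local Notation C := (R[i]^o).
Local Notation sites := (sites theta).
Local Notation tau := (orbital_shift theta).
Local Notation L2p p := (in_L2 mu2 (bz theta p.1 : set mplane)).
Local Notation nrm p := (nrm2 mu2 (bz theta p.1 : set mplane)).
Local Notation coefs := (@mode_coefs R theta).
Local Notation orbital_site := (@orbital_site R theta).

Lemma ereal_sup_lty_bound (T : Type) (u : T -> R) :
  (ereal_sup [set (u x)%:E | x in [set: T]] < +oo)%E -> exists A, forall x, u x <= A.
Proof.
set S := ereal_sup _ => Sy; exists (fine S) => x.
have uS : ((u x)%:E <= S)%E by apply: ereal_sup_ubound; exists x.
rewrite -lee_fin fineK// fin_numElt Sy andbT.
by apply: lt_le_trans uS; exact: ltNyr.
Qed.

(** Both suprema are nonnegative, so neither can offset the other and a finite sum bounds each of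
    them. *)
Lemma exp_decay_adde (u v : plane -> R) : (forall x, 0 <= u x) -> (forall x, 0 <= v x) ->
  (ereal_sup [set (u x)%:E | x in [set: plane]]
   + ereal_sup [set (v x)%:E | x in [set: plane]] < +oo)%E ->
  exists A, forall x, u x <= A /\ v x <= A.
Proof.
move=> u0 v0; set S := ereal_sup _; set S' := ereal_sup _ => SS.
have h : (0 <= S)%E.
  by apply: (@le_trans _ _ (u 0)%:E); [rewrite lee_fin|apply: ereal_sup_ubound; exists 0].
have h' : (0 <= S')%E.
  by apply: (@le_trans _ _ (v 0)%:E); [rewrite lee_fin|apply: ereal_sup_ubound; exists 0].
have [A hA] : exists A, forall x, u x <= A.
  by apply: ereal_sup_lty_bound; apply: le_lt_trans SS; exact: leeDl.
have [B hB] : exists A, forall x, v x <= A.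
  by apply: ereal_sup_lty_bound; apply: le_lt_trans SS; exact: leeDr.
exists (Num.max A B) => x; rewrite !le_max hA hB orbT; by split.
Qed.

Definition single_orbital (s : orbital) (f : plane -> C) : orbital -> plane -> C :=
  fun s' => if s' == s then f else 0.

Lemma L2sum_single s f : L2p s f -> L2sum theta (single_orbital s f).
Proof.
move=> Lf s'; rewrite /single_orbital; case: eqP => [->|_]; first exact: Lf.
exact: (in_L2_0 mu2 (bz theta s'.1 : set mplane)).
Qed.

Lemma L2sum_norm_single s f : L2sum_norm theta (single_orbital s f) = nrm s f.
Proof.
apply/eqP; rewrite -(@eqrXn2 _ 2)// ?sqrtr_ge0// L2sum_norm_sqr.
rewrite (bigD1 s)//= /single_orbital eqxx big1 ?addr0// => s' /negbTE ->.
by rewrite (nrm2_0 mu2 (bz theta s'.1 : set mplane)) expr2 mulr0.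
Qed.

Lemma single_orbital_linear s (c : R[i]) (f g : plane -> C) :
  single_orbital s (fun q => (c : R[i]) * f q + g q)
  = c *: single_orbital s f + single_orbital s g.
Proof.
apply/funext => s'; rewrite -[RHS]/(c *: single_orbital s f s' + single_orbital s g s').
rewrite /single_orbital; case: eqP => // _; apply/funext => q.
by rewrite -[RHS]/(c * 0 + 0 : R[i]) mulr0 addr0.
Qed.

Definition delta (w0 : sites) : sites -> C := fun w => (w == w0)%:R.

(** A mode is the Bloch transform of a Dirac mass, so the action of the conjugate on modes is that
    of [H] on Dirac masses. *)
Lemma mode_coefs_single s (r0 : lattice (layer_mx theta s.1)) :
  mode_coefs (single_orbital s (mode r0)) = delta (orbital_site r0).
Proof.
apply/funext => w; have [r E] := orbital_siteP w; rewrite E.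
move: (site_orbital w) r {E} => p r; rewrite mode_coefsE /single_orbital /delta.
have [E|ne] := eqVneq p s.
  by subst s; rewrite /mode_coef /coef mode_ortho eq_sym (inj_eq (@orbital_site_inj _ _ p)).
rewrite mode_coef0; case: eqP => // /(congr1 (@site_orbital R theta)).
by rewrite /site_orbital /= -!surjective_pairing => /eqP; rewrite (negbTE ne).
Qed.

Lemma in_L2_mode s r : L2p s (@mode R theta s r).
Proof.
exact: (in_L2_e (measurable_bz theta s.1) (mu2_bz_lty theta s.1) (@cmeasurable_mode R theta s)
  (@normc_mode R theta s)).
Qed.

Lemma modeE p (r : lattice (layer_mx theta p.1)) q :
  mode r q = ((cstar theta p.1)^-1)%:C * expi (- dot2 q (val r + tau p)) :> R[i].
Proof. by []. Qed.

Lemma modeJ p (r : lattice (layer_mx theta p.1)) q :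
  ((mode r q)^*)%C = ((cstar theta p.1)^-1)%:C * expi (dot2 q (val r + tau p)) :> R[i].
Proof. exact: bloch_modeJ. Qed.

Lemma translation_mode s (v q : plane) (r : lattice (layer_mx theta s.1)) :
  translation theta s v (mode r) q = mode r (q + v).
Proof. exact: (congr1 (@^~ (q + v)) (ext_bloch_mode r)). Qed.

(** The product of the two widths undoes the normalizations of the modes. The factor exp(i G.tau)
    completes the phase: since exp(i G.r') = 1 it equals exp(i G.(r' + tau)), and everything besides
    [z] becomes a function of q + G. *)
Lemma mode_mul_translated_conj p s (G : lattice (dual_mx theta p.1)) (z : R[i])
    (r : lattice (layer_mx theta s.1)) (r' : lattice (layer_mx theta p.1)) q :
  (cstar theta p.1 * cstar theta s.1)%:C * expi (dot2 (val G) (tau p)) * z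
    * mode r (q + val G) * ((mode r' q)^*)%C
  = z * expi (dot2 (q + val G) (val r' + tau p - val r - tau s)).
Proof.
have E1 := expi_dual (dual_mx_unit theta p.1) (layer_dual theta p.1) G r'.
have cN j : cstar theta j != 0 by rewrite gt_eqF// cstar_gt0.
have ccE : ((cstar theta p.1 * cstar theta s.1)%:C : R[i])
    * ((cstar theta s.1)^-1)%:C * ((cstar theta p.1)^-1)%:C = 1.
  by rewrite -!rmorphM /= mulfK ?mulfV.
rewrite modeE modeJ.
have -> : expi (dot2 (q + val G) (val r' + tau p - val r - tau s))
    = expi (dot2 (val G) (tau p)) * expi (- dot2 (q + val G) (val r + tau s))
      * expi (dot2 q (val r' + tau p)) :> R[i].
  rewrite -[RHS]mulr1 -E1 -!expiD; congr expi.
  by rewrite !dot2Dl !dot2Dr !dot2Nr; ring.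
rewrite -[RHS]mul1r -ccE.
have comm (a b c e1 e2 e3 : R[i]) :
  a * e1 * z * (b * e2) * (c * e3) = a * b * c * (z * (e1 * e2 * e3)) by ring.
exact: comm.
Qed.

Lemma ell2_delta w0 : ell2 (delta w0).
Proof.
have [r ->] := orbital_siteP w0; rewrite -mode_coefs_single.
by have [] := ell2_mode_coefs (L2sum_single (in_L2_mode r)).
Qed.

Variables (hintra : forall j : 'I_3, bool -> bool -> lattice (layer_mx theta j) -> C)
  (hinter : orbital -> orbital -> plane -> C).
Hypothesis hhop : standing_assumptions hintra hinter.
Variable H : (sites -> C) -> (sites -> C).
Hypothesis hH : is_hamiltonian hintra hinter H.

Lemma hamiltonian_delta_intra j a b (r r0 : lattice (layer_mx theta j)) :
  H (delta (@orbital_site (j, b) r0)) (@orbital_site (j, a) r) = hintra a b (r - r0).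
Proof.
rewrite (hH.2 _ (ell2_delta _)) /hamiltonian_formula.
rewrite big1 ?addr0; last first.
  move=> k kj; apply: sum_zero => x; rewrite /delta.
  have -> : (site x == @orbital_site (j, b) r0) = false.
    by apply/eqP => /(congr1 (fun w : sites => tag w)) /= /eqP; rewrite (negbTE kj).
  by rewrite mulr0.
rewrite (@sum_eventually _ _ _ (r0, b)); last first.
  move=> x xr; rewrite /delta.
  rewrite -[X in _ == X]/(Tagged (layer_sites theta) (r0, b)) eq_Tagged /=.
  by rewrite (negbTE xr) mulr0.
by rewrite /delta eqxx mulr1.
Qed.

Lemma hamiltonian_delta_inter j k a b (r : lattice (layer_mx theta j))
    (r0 : lattice (layer_mx theta k)) : k != j ->
  H (delta (@orbital_site (k, b) r0)) (@orbital_site (j, a) r)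
  = hinter (j, a) (k, b) (val r + tau (j, a) - val r0 - tau (k, b)).
Proof.
move=> kj; rewrite (hH.2 _ (ell2_delta _)) /hamiltonian_formula.
have ne l (x : layer_sites theta l) : l != k -> (site x == @orbital_site (k, b) r0) = false.
  by move=> lk; apply/eqP => /(congr1 (fun w : sites => tag w)) /= /eqP; rewrite (negbTE lk).
rewrite sum_zero ?add0r; last by move=> x; rewrite /delta ne 1?eq_sym// mulr0.
rewrite (bigD1 k)//= [X in _ + X]big1 ?addr0; last first.
  by move=> l /andP[_ lk]; apply: sum_zero => x; rewrite /delta ne// mulr0.
rewrite (@sum_eventually _ _ _ (r0, b)); last first.
  move=> x xr; rewrite /delta.
  rewrite -[X in _ == X]/(Tagged (layer_sites theta) (r0, b)) eq_Tagged /=.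
  by rewrite (negbTE xr) mulr0.
by rewrite /delta eqxx mulr1.
Qed.

Let opH := hH.1.

Lemma hamiltonian_bounded : exists2 B : R, 0 <= B &
  forall psi, ell2 psi -> ell2_norm (H psi) <= B * ell2_norm psi.
Proof.
have [B hB] := operator_bounded opH; exists (Num.max B 0); first by rewrite le_max lexx orbT.
move=> psi /hB h; apply: le_trans h _; apply: ler_wpM2r; first exact: sqrtr_ge0.
by rewrite le_max lexx.
Qed.

(** The value is a representative chosen by [bloch], so that linearity holds only almost
    everywhere. *)
Definition momentum_hamiltonian (f : orbital -> plane -> C) := bloch (H (mode_coefs f)).
Local Notation Ht := momentum_hamiltonian.

Lemma momentum_coefs f : L2sum theta f ->
  L2sum theta (Ht f) /\ coefs (Ht f) = H (coefs f).
Proof.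
by move=> /ell2_mode_coefs[h _]; apply: bloch_spec; exact: (operator_maps opH).
Qed.

(** Coefficients do not see the choice of representative, so here linearity is an equality. *)
Lemma momentum_coefs_linear (c : R[i]) f g : L2sum theta f -> L2sum theta g ->
  coefs (Ht (c *: f + g)) = c *: coefs (Ht f) + coefs (Ht g).
Proof.
move=> Lf Lg; have Lfg := L2sum_linear c Lf Lg.
have [ef _] := ell2_mode_coefs Lf; have [eg _] := ell2_mode_coefs Lg.
apply: etrans (momentum_coefs Lfg).2 _.
apply: etrans (congr1 H (mode_coefs_linear c Lf Lg)) _.
apply: etrans (operator_linear opH c ef eg) _.
exact: (congr2 (fun u v => c *: u + v) (esym (momentum_coefs Lf).2)
  (esym (momentum_coefs Lg).2)).
Qed.

Lemma momentum_norm_le : exists2 B : R, 0 <= B & forall f p, L2sum theta f ->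
  nrm p (Ht f p) <= B * L2sum_norm theta f.
Proof.
have [B B0 hB] := hamiltonian_bounded; exists B => // f p Lf.
have [ec ecn] := ell2_mode_coefs Lf.
apply: le_trans (bloch_norm_le p (operator_maps opH ec)) _.
by apply: le_trans (hB _ ec) _; exact: ler_wpM2l.
Qed.

Lemma momentum_operator : L2sum_operator theta Ht.
Proof.
split.
- by move=> f /momentum_coefs[].
- move=> c f g Lf Lg; have Lfg := L2sum_linear c Lf Lg.
  apply: mode_coefs_inj.
  + by have [] := momentum_coefs Lfg.
  + by apply: L2sum_linear; [have [] := momentum_coefs Lf|have [] := momentum_coefs Lg].
  + rewrite momentum_coefs_linear// mode_coefs_linear//.
      by have [] := momentum_coefs Lf.
    by have [] := momentum_coefs Lg.
- have [B B0 hB] := momentum_norm_le.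
  (* Each component is bounded by the norm of the whole family, and there are as many components as
     orbitals. *)
  exists (Num.sqrt #|{: orbital}|%:R * B) => f Lf.
  have n0 : 0 <= L2sum_norm theta f by exact: sqrtr_ge0.
  rewrite -(@ler_pXn2r _ 2)// ?nnegrE ?sqrtr_ge0//; last by rewrite !mulr_ge0 ?sqrtr_ge0.
  rewrite L2sum_norm_sqr -mulrA exprMn sqr_sqrtr//.
  apply: (@le_trans _ _ (\sum_(p : orbital) (B * L2sum_norm theta f) ^+ 2)).
    apply: ler_sum => p _; rewrite ler_pXn2r ?nnegrE ?nrm2_ge0 ?mulr_ge0//.
    exact: hB.
  by rewrite sumr_const mulr_natl.
Qed.

Lemma momentum_intertwines : intertwines H Ht.
Proof.
move=> psi h p; rewrite /Ht (bloch_spec h).2.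
exact: ae_eq_refl.
Qed.

(** A competitor might a priori tell apart functions that agree almost everywhere. Boundedness
    excludes this: [f] differs from the representative [g] chosen by [bloch] by a function of norm
    zero, whose image is null, and on [g] the intertwining relation decides. *)
Lemma momentum_unique Ht' : L2sum_operator theta Ht' -> intertwines H Ht' ->
  forall f, L2sum theta f -> L2sum_eq theta (Ht' f) (Ht f).
Proof.
move=> opT itT f Lf; have [ec _] := ell2_mode_coefs Lf.
have [Lb bE] := bloch_spec ec; set g := bloch (mode_coefs f) in Lb bE *.
have Lgf := L2sum_linear (-1) Lb Lf.
have z : L2sum_norm theta (-1 *: g + f) = 0.
  apply/eqP; rewrite -(@eqrXn2 _ 2)// ?sqrtr_ge0// L2sum_norm_sqr big1; first by rewrite expr2 mulr0.
  move=> p _; rewrite (mode_complete (Lgf p)) ?expr2 ?mulr0// => r.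
  by rewrite -mode_coefsE mode_coefs_linear// bE scaleN1r addNr.
have [B hB] := operator_bounded opT.
have LT := operator_maps opT Lgf.
have T0 p : nrm p (Ht' (-1 *: g + f) p) = 0.
  have : L2sum_norm theta (Ht' (-1 *: g + f)) ^+ 2 = 0.
    have := hB _ Lgf; rewrite z mulr0 => h.
    by apply/eqP; rewrite sqrf_eq0 eq_le h sqrtr_ge0.
  rewrite L2sum_norm_sqr => /eqP; rewrite psumr_eq0; last by move=> q _; rewrite sqr_ge0.
  by move=> /allP /(_ p (mem_index_enum p)) /=; rewrite sqrf_eq0 => /eqP.
have := itT _ ec; rewrite -/g => itg p.
have h1 := (nrm2_eq0P (measurable_bz theta p.1) (LT p)).1 (T0 p).
have h2 := operator_linear opT (-1) Lb Lf p.
have h3 := itg p.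
apply: filterS2 (filterI h1 h2) h3 => q [/= e1 e2] e3 qD.
have := e2 qD; rewrite (e1 qD) /= => /esym.
rewrite -[X in X = _ -> _]/(-1 * Ht' g p q + Ht' f p q) mulN1r => /eqP.
by rewrite addrC subr_eq0 => /eqP ->; rewrite -(e3 qD).
Qed.

(** The matrix elements of the entry between modes are the values of [H] on Dirac masses; the last
    hypothesis compares these with the partial sums. *)
Lemma entry_operator_sum (p s : orbital) (J : choiceType)
    (S : J -> (plane -> C) -> (plane -> C)) (a : J -> R) (B : R) :
  (forall i f, L2p s f -> L2p p (S i f) /\ nrm p (S i f) <= a i * nrm s f) ->
  (forall i (c : C) f g,
    S i (fun x => (c : R[i]) * f x + g x) = fun x => (c : R[i]) * S i f x + S i g x) ->
  (forall i, 0 <= a i) -> (forall F : {fset J}, \sum_(i <- F) a i <= B) ->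
  (forall r' r (eps : R), 0 < eps -> exists F0, forall F, (F0 `<=` F)%fset ->
    normc (H (delta (@orbital_site s r)) (@orbital_site p r')
      - \sum_(i <- F) mode_coef r' (S i (mode r))) <= eps) ->
  operator_sum theta s.1 p.1 S (entry Ht p s).
Proof.
move=> S_le S_lin a0 aB S_coef.
split=> [i f Lf|eps eps0]; first by have [] := S_le i f Lf.
have [b b0 hb] := momentum_norm_le.
have eE f (r : lattice (layer_mx theta p.1)) : L2p s f ->
    mode_coef r (entry Ht p s f) = coefs (Ht (single_orbital s f)) (orbital_site r).
  by rewrite mode_coefsE.
have [||||F0 hF0] := @operator_sum_of_coef _ _ R mu2 (bz theta s.1) (bz theta p.1)
  (measurable_bz theta s.1) (mu2_bz_lty theta s.1) _ _ _ (@cmeasurable_mode R theta s)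
  (@normc_mode R theta s) (@mode_ortho R theta s) (@mode_complete R theta s)
  (measurable_bz theta p.1) (mu2_bz_lty theta p.1) _ _ _ (@cmeasurable_mode R theta p)
  (@normc_mode R theta p) (@mode_ortho R theta p) (@mode_complete R theta p)
  J S (entry Ht p s) a B b (fun i f Lf => (S_le i f Lf).1) (fun i f Lf => (S_le i f Lf).2)
  S_lin a0 aB _ b0 _ _ _ eps eps0.
- by move=> f /L2sum_single/momentum_coefs[L _]; exact: L.
- move=> f Lf; rewrite -(L2sum_norm_single s f).
  by apply: hb; exact: L2sum_single.
- move=> r c f g Lf Lg.
  have Lfg := in_L2D (measurable_bz theta s.1) (in_L2Z (measurable_bz theta s.1) c Lf) Lg.
  have E : coefs (Ht (single_orbital s (fun x => (c : R[i]) * f x + g x)))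
      = c *: coefs (Ht (single_orbital s f)) + coefs (Ht (single_orbital s g)).
    apply: etrans (congr1 (coefs \o Ht) (single_orbital_linear s c f g)) _.
    exact: momentum_coefs_linear (L2sum_single Lf) (L2sum_single Lg).
  apply: etrans (eE _ r Lfg) _; apply: etrans (congr1 (@^~ (orbital_site r)) E) _.
  exact: (congr2 (fun u v : C => (c : R[i]) * u + v) (esym (eE _ r Lf)) (esym (eE _ r Lg))).
- move=> r' r e e0; have [F0 hF0] := S_coef r' r e e0; exists F0 => F /hF0.
  have := eE _ r' (in_L2_mode r); rewrite /mode_coef => ->.
  by rewrite (momentum_coefs (L2sum_single (in_L2_mode r))).2 mode_coefs_single.
apply/near_totallyP; exists F0 => F FF f Lf.
have := hF0 F FF f Lf; congr (nrm2 _ _ _ <= _).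
by rewrite partial_sumE fct_sumE.
Qed.

Lemma intra_entry j a b : momentum_entry hintra hinter (j, a) (j, b) (entry Ht (j, a) (j, b)).
Proof.
rewrite /momentum_entry eqxx /=.
have [g1 [g2 [g10 _ _ hd]]] := hopping_decay hhop.
have [A hA] := ereal_sup_lty_bound (hd j a b).
have uM := layer_mx_unit theta j.
have [B hB] := @laplace2_lattice_sum R (layer_mx theta j) uM (g1 / 2) ltac:(lra).
have A0 : 0 <= A.
  by apply: le_trans (hA 0); rewrite mulr_ge0 ?normc_ge0 ?expR_ge0.
have mD := measurable_bz theta j.
(* The moduli of the hoppings bound the norms of the terms and are summable by exponential decay. *)
apply: (@entry_operator_sum (j, a) (j, b) _ _ (fun r => normc (hintra a b r)) (A * B)) => /=.
- move=> r f Lf; apply: (in_L2_le mD) => //.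
  + apply: cmeasurableM; last exact: in_L2_cmeasurable Lf.
    apply: cmeasurableM; last exact: cmeasurable_cst.
    apply: measurable_expi; apply: measurable_funTS; apply: measurableT_comp => //.
    exact: measurable_dot2.
  + exact: normc_ge0.
  + by move=> q _; rewrite /multiplication !normcM normc_expi mul1r.
- by move=> r c f g; apply/funext => q; rewrite /multiplication; ring.
- by move=> r; exact: normc_ge0.
- move=> F; apply: le_trans (ler_wpM2l A0 (hB F)); rewrite mulr_sumr.
  by apply: ler_sum => r _; exact: exp_decay_laplace2.
(* Only the index [r' - r] contributes to this matrix element, which is exact as soon as the partial
   sum contains it. *)
move=> r' r eps eps0; exists [fset (r' - r)%R]%fset => F; rewrite fsub1set => rF.
rewrite hamiltonian_delta_intra.
have E (x : lattice (layer_mx theta j)) : @mode_coef R theta (j, a) r' (multiplication (fun q => (expi (- dot2 q (val x + tau (j, a)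
      - tau (j, b))) : R[i]) * hintra a b x) (@mode R theta (j, b) r))
    = (hintra a b x : R[i]) * (r + x == r')%:R.
  rewrite -(@mode_ortho R theta (j, a) (r + x) r').
  rewrite -[X in _ * X]/(@mode_coef R theta (j, a) r' (@mode R theta (j, a) (r + x))).
  rewrite -mode_coefZ; last exact: (@in_L2_mode (j, a)).
  congr mode_coef; apply/funext => q; rewrite /multiplication /mode /bloch_mode /=.
  have -> : expi (- dot2 q (val r + val x + tau (j, a)))
      = expi (- dot2 q (val x + tau (j, a) - tau (j, b)))
        * expi (- dot2 q (val r + tau (j, b))) :> R[i].
    by rewrite -expiD; congr expi; rewrite !dot2Dr !dot2Nr; ring.
  ring.
under eq_bigr do rewrite E.
rewrite (bigD1_seq (r' - r) rF (fset_uniq F)) /= big1 => [|x xr].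
  by rewrite [r + _]addrC subrK eqxx mulr1 addr0 subrr (normc_real 0 : normc 0 = _) normr0 ltW.
case: eqP => [rx|_]; last by rewrite mulr0.
by move: xr; rewrite -rx [r + x]addrC addrK eqxx.
Qed.

Lemma inter_entry (p s : orbital) : p.1 != s.1 ->
  momentum_entry hintra hinter p s (entry Ht p s).
Proof.
move=> ps; rewrite /momentum_entry eq_sym (negbTE ps).
have [g1 [g2 [g10 g20 hd _]]] := hopping_decay hhop.
set h := hinter p s.
have [A hA] := @exp_decay_adde (fun x => normc (h x) * expR (g1 * norm2 x))
  (fun x => normc (fourier h x) * expR (g2 * norm2 x))
  (fun x => mulr_ge0 (normc_ge0 _) (expR_ge0 _)) (fun x => mulr_ge0 (normc_ge0 _) (expR_ge0 _))
  (hd _ _ ps).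
have ch : continuous h := inter_continuous hhop ps.
have ih : cintegrable mu2 setT h.
  exact: exp_decay_cintegrable g10 (continuous_cmeasurable ch) (fun x => (hA x).1).
have mF := cmeasurable_fourier ih.
have iF : cintegrable mu2 setT (fourier h).
  exact: exp_decay_cintegrable g20 mF (fun x => (hA x).2).
have hB x : normc (h x) <= A.
  apply: le_trans (hA x).1; rewrite ler_peMr ?normc_ge0//.
  by rewrite -expR0 ler_expR mulr_ge0 ?sqrtr_ge0 ?(ltW g10).
have uN := dual_mx_unit theta p.1.
have g2' : 0 < g2 / 2 by rewrite divr_gt0.
have [B hBs] := laplace2_lattice_sum uN g2'.
have A0 : 0 <= A by exact: le_trans (normc_ge0 _) (hB 0).
have [K K0 hK] := cell_bounded (dual_mx theta p.1).
have [N N0 hN] := @translation_bounded R theta p.1 s.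
have mD := measurable_bz theta p.1.
pose cc := cstar theta p.1 * cstar theta s.1.
have cc0 : 0 < cc by rewrite mulr_gt0 ?cstar_gt0.
(* [K] bounds the coordinates on the cell, so replacing q + G by G in the decaying factor costs
   exp(g2 K); the rate g2 / 2 is the one left by the product form of the decay. *)
pose V := cc * (A * expR (g2 / 2 * (2 * K))).
have V0 : 0 <= V.
  apply: (mulr_ge0 (ltW cc0)); apply: (mulr_ge0 A0); exact: expR_ge0.
(* [N] bounds the translations for all [G] at once, so the decay of the multiplier in [G] passes to
   the operators. *)
pose W := V * N; have W0 : 0 <= W := mulr_ge0 V0 N0.
pose m (G : lattice (dual_mx theta p.1)) (q : plane) : C :=
  (cc%:C : R[i]) * expi (dot2 (val G) (tau p)) * fourier h (q + val G).
have mle G q : bz theta p.1 q ->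
    normc (m G q) <= V * laplace2 (g2 / 2) (val G).
  move=> qD; rewrite /m normcM normcM normc_expi mulr1 normc_real (ger0_norm (ltW cc0)).
  rewrite /V -[leRHS]mulrA; apply: (@ler_wpM2l _ cc (ltW cc0)).
  apply: le_trans (exp_decay_laplace2 g20 (hA (q + val G)).2) _.
  rewrite -[leRHS]mulrA; apply: (ler_wpM2l A0); have [q1 q2] := hK _ qD.
  (* The displacement is by -q, from q + G back to G. *)
  have := @laplace2_shift R (g2 / 2) K (q + val G) (- q) (ltW g2').
  by rewrite addrAC subrr add0r /= !normrN; apply.
have mm G : cmeasurable (bz theta p.1) (m G : mplane -> C).
  apply: cmeasurableM; first exact: cmeasurable_cst.
  have [m1 m2] := mF; split; apply: measurable_funTS.
    exact: measurableT_comp m1 (measurable_shift (val G)).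
  exact: measurableT_comp m2 (measurable_shift (val G)).
apply: (@entry_operator_sum p s _ _ (fun G => W * laplace2 (g2 / 2) (val G)) (W * B)).
- move=> G f Lf; have [LT nT] := hN (val G) f Lf.
  have k0 : 0 <= V * laplace2 (g2 / 2) (val G) := mulr_ge0 V0 (ltW (laplace2_gt0 _ _)).
  pose T := translation theta s (val G) f.
  have le_ q : bz theta p.1 q ->
      normc (multiplication (m G) T q) <= V * laplace2 (g2 / 2) (val G) * normc (T q).
    move=> qD; rewrite /multiplication normcM; apply: ler_wpM2r; first exact: normc_ge0.
    exact: mle.
  have [L1 n1] := in_L2_le mD (cmeasurableM (mm G) (in_L2_cmeasurable LT)) LT k0 le_.
  split=> //; apply: le_trans n1 _; apply: le_trans (ler_wpM2l k0 nT) _.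
  by rewrite /W le_eqVlt; apply/orP; left; apply/eqP; ring.
- move=> G c f g; apply/funext => q.
  have comm (x y z : R[i]) : x * (y * (c * z)) = c * (x * (y * z)) by ring.
  by rewrite /multiplication /translation /quasi_periodic_ext mulrDr mulrDr comm.
- by move=> G; exact: mulr_ge0 W0 (ltW (laplace2_gt0 _ _)).
- by move=> F; rewrite -mulr_sumr; apply: ler_wpM2l.
move=> r' r eps eps0.
pose y := val r' + tau p - val r - tau s.
have HE : H (delta (orbital_site r)) (orbital_site r') = h y.
  move: ps r r' @y; rewrite /h; case: (p) (s) => j a [k b] /= ps r r'.
  by rewrite hamiltonian_delta_inter// eq_sym.
rewrite HE -(fourier_inversion y ch hB ih iF).
pose F xi : C := (fourier h xi : R[i]) * expi (dot2 xi y).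
have iFy : cintegrable mu2 setT (F : mplane -> C).
  apply: (exp_decay_cintegrable g20 (A := A)).
    by apply: cmeasurableM mF _; apply: measurable_expi; exact: measurable_dot2.
  by move=> xi; rewrite normcM normc_expi mulr1; exact: (hA xi).2.
have [F0 hF0] := cint_cell_cvg uN iFy eps0.
exists F0 => Fs /hF0; congr (normc (_ - _) <= _).
apply: eq_bigr => G _; apply: eq_cint => q _; apply: esym.
by rewrite /multiplication translation_mode mode_mul_translated_conj.
Qed.

End MomentumHamiltonian.

Theorem proposition3p1 (R : realType) (theta : 'I_3 -> R)
    (hR : incommensurate (layer_mx theta))
    (hRdual : incommensurate (dual_mx theta))
    (hintra : forall j : 'I_3, bool -> bool -> lattice (layer_mx theta j) -> R[i]^o)
    (hinter : orbital -> orbital -> (R * R)%type -> R[i]^o)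
    (hhop : standing_assumptions hintra hinter)
    (H : (sites theta -> R[i]^o) -> (sites theta -> R[i]^o))
    (hH : is_hamiltonian hintra hinter H) :
  exists Ht : (orbital -> R * R -> R[i]^o) -> (orbital -> R * R -> R[i]^o),
    [/\ L2sum_operator theta Ht,
        intertwines H Ht,
        (forall Ht', L2sum_operator theta Ht' -> intertwines H Ht' ->
           forall f, L2sum theta f -> L2sum_eq theta (Ht' f) (Ht f)) &
        forall p s : orbital,
          momentum_entry hintra hinter p s (entry Ht p s)].
Proof.
exists (momentum_hamiltonian H); split.
- exact: momentum_operator hH.
- exact: momentum_intertwines.
- exact: momentum_unique.
move=> p s; have [|ps] := eqVneq p.1 s.1; last exact: inter_entry.
case: p s => j a [k b] /= jk; subst k; exact: intra_entry.
Qed.
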